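(* Let $X=(X_n)_{n\ge 0}$ be an ergodic Markov chain with values in a finite set $\mathbb{S}=\{a_1,\dots,a_d\}\subset\mathbb{R}$, with transition matrix $\Lambda=(\lambda_{ij})$, $\lambda_{ij}=\mathrm{P}(X_n=a_j\mid X_{n-1}=a_i)$, initial distribution $\nu$ and invariant distribution $\mu$. Let $h:\mathbb{S}\to\mathbb{R}$, let $(\xi_n)_{n\ge1}$ be i.i.d. real random variables, independent of $X$, whose law has a density $g$ with respect to the Lebesgue measure on $\mathbb{R}$, and for $\sigma>0$ let $Y^\sigma_n=h(X_n)+\sigma\xi_n$, $n\ge1$. Assume: (1) $g$ does not vanish on $\mathbb{R}$, is bounded and has two bounded derivatives; (2) there is a $\delta>0$ such that $$\int_{-\infty}^\infty\left(\frac{g'(x)}{\min_{|u|\le\delta}g(x+u)}\right)^2g(x)\,dx<\infty\quad\text{and}\quad\int_{-\infty}^\infty\left(\frac{\max_{|v|\le\delta}|g''(x+v)|}{\min_{|u|\le\delta}g(x+u)}\right)^2g(x)\,dx<\infty .$$ Let $I=\int_{-\infty}^\infty\frac{(g'(x))^2}{g(x)}\,dx<\infty$ be the Fisher information of $g$. Then the algebraic Lyapunov equation $$P=\Lambda^*P\Lambda+\big(\mathrm{diag}(\mu)-\mu\mu^*\big)h\,I\,h^*\big(\mathrm{diag}(\mu)-\mu\mu^*\big)$$ has a unique solution $P$ in the class of nonnegative definite matrices with $\sum_{i,j}P_{ij}=0$, and $$\lim_{\sigma\to\infty}\sigma^2\big(\mathcal{E}^\infty-\mathcal{E}^\sigma\big)=a^*Pa,$$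 where $a$ is the vector with entries $a_1,\dots,a_d$, $\mathcal{E}^\sigma$ is the steady-state minimal mean square filtering error, and $\mathcal{E}^\infty=\sum_i a_i^2\mu_i-\big(\sum_i a_i\mu_i\big)^2$ is the a priori mean square error.
   Context: Probability measures on $\mathbb{S}$ are identified with column vectors in the simplex $\mathcal{S}^{d-1}=\{x\in\mathbb{R}^d:x_i\ge0,\ \sum_i x_i=1\}$, and functions on $\mathbb{S}$ with column vectors in $\mathbb{R}^d$; in particular $h$ also denotes the column vector with entries $h(a_i)$. The superscript $*$ denotes transposition and $\mathrm{diag}(x)$ is the diagonal matrix with diagonal entries $x_i$. The chain $X$ is ergodic if the limits $\mu_i=\lim_{n\to\infty}\mathrm{P}(X_n=a_i)$ exist, are unique (independent of $\nu$) and positive; equivalently, $\Lambda^q$ has positive entries for some integer $q\ge1$. Then $\mu$ is the unique solution of $\Lambda^*\mu=\mu$ in $\mathcal{S}^{d-1}$. Let $\mathcal{F}^{Y^\sigma}_n=\sigma\{Y^\sigma_m:1\le m\le n\}$ and $\pi^\sigma_n(i)=\mathrm{P}(X_n=a_i\mid\mathcal{F}^{Y^\sigma}_n)$. The minimal mean square error at time $n$ is $$\mathcal{E}^\sigma_n=\min_{\theta\in L^2(\Omega,\mathcal{F}^{Y^\sigma}_n,\mathrm{P})}\mathrm{E}(X_n-\theta)^2=\mathrm{E}X_n^2-\mathrm{E}\Big(\sum_{i=1}^d a_i\pi^\sigma_n(i)\Big)^2 ,$$ and $\mathcal{E}^\sigma:=\lim_{n\to\infty}\mathcal{E}^\sigma_n$.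 It is known that, when $X$ is ergodic and $g$ is bounded and does not vanish, this limit exists and does not depend on $\nu$ (equivalently, the Markov process $(\pi^\sigma_n)$ on $\mathcal{S}^{d-1}$ has a unique invariant probability measure). *)

(* Defs.v *)
From HB Require Import structures.
From mathcomp Require Import all_boot all_order all_algebra.
From mathcomp Require Import finmap.
From mathcomp Require Import all_classical all_reals all_analysis.

Set Implicit Arguments.
Unset Strict Implicit.
Unset Printing Implicit Defensive.

Import Order.TTheory GRing.Theory Num.Theory.
Import numFieldNormedType.Exports.

Local Open Scope classical_set_scope.
Local Open Scope ring_scope.

Section FiniteStateSpace.
Context {R : realType} {d : nat}.
Implicit Types (m nu mu : 'cV[R]_d) (L P : 'M[R]_d).

Definition in_simplex m : Prop :=
  (forall i, 0 <= m i 0) /\ \sum_i m i 0 = 1.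

Definition is_stochastic L : Prop :=
  (forall i j, 0 <= L i j) /\ (forall i, \sum_j L i j = 1).

(* The vector (P(X_n = a_i))_i for a chain X started from [nu]. *)
Definition marginal_law L nu (n : nat) : 'cV[R]_d :=
  iter n (mulmx L^T) nu.

Definition is_ergodic L : Prop :=
  exists m, (forall i, 0 < m i 0) /\
    forall nu, in_simplex nu ->
      forall i, marginal_law L nu n i 0 @[n --> \oo] --> m i 0.

Definition is_invariant L mu : Prop := in_simplex mu /\ L^T *m mu = mu.

Definition is_nonneg_definite P : Prop :=
  P^T = P /\ forall x : 'cV[R]_d, 0 <= (x^T *m P *m x) 0 0.

Definition lyapunov_solution L mu (hv : 'cV[R]_d) (I : R) P : Prop :=
  let C := diag_mx mu^T - mu *m mu^T in
  [/\ P = L^T *m P *m L + I *: (C *m hv *m hv^T *m C),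
      is_nonneg_definite P &
      \sum_i \sum_j P i j = 0].

Definition apriori_error (a : 'I_d -> R) mu : R :=
  \sum_i a i ^+ 2 * mu i 0 - (\sum_i a i * mu i 0) ^+ 2.

End FiniteStateSpace.

Section NoiseDensity.
Context {R : realType}.
Implicit Types (f g : R -> R) (delta x : R).

Definition bounded_fct f : Prop := exists M, forall x, `|f x| <= M.

(* [inf] and [sup] stand for the min and max over the window |u| <= delta; the
   second derivative need not be continuous, so its max may not be attained. *)
Definition min_near delta g x : R :=
  inf [set g (x + u) | u in [set u : R | `|u| <= delta]].

Definition max_abs_near delta f x : R :=
  sup [set `|f (x + v)| | v in [set v : R | `|v| <= delta]].

Definition noise_regularity g : Prop :=
  [/\ (forall x, g x != 0),
      (forall x, derivable g x 1) /\ (forall x, derivable (derive1 g) x 1) &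
      [/\ bounded_fct g, bounded_fct (derive1 g) &
          bounded_fct (derive1 (derive1 g))]].

Definition noise_integrability g : Prop :=
  exists2 delta : R, 0 < delta &
    (\int[lebesgue_measure]_x
       ((derive1 g x / min_near delta g x) ^+ 2 * g x)%:E < +oo)%E /\
    (\int[lebesgue_measure]_x
       ((max_abs_near delta (derive1 (derive1 g)) x / min_near delta g x) ^+ 2
          * g x)%:E < +oo)%E.

Definition fisher_information g : \bar R :=
  (\int[lebesgue_measure]_x (derive1 g x ^+ 2 / g x)%:E)%E.

End NoiseDensity.

Section Processes.
Context {disp : measure_display} {T : measurableType disp} {R : realType}.
Variable P : probability T R.
Implicit Types (X Y Z : nat -> T -> R).

Definition sigma_generated (D : set nat) Z : set (set T) :=
  <<s \bigcup_(k in D) preimage_set_system setT (Z k) measurable >>.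

(* Markov property with conditional probabilities multiplied out, so that
   histories of probability 0 need no convention. *)
Definition is_markov_chain {d : nat} (a : 'I_d -> R) (L : 'M[R]_d)
    (nu : 'cV[R]_d) X : Prop :=
  [/\ (forall n w, exists i, X n w = a i),
      (forall i, P [set w | X 0%N w = a i] = (nu i 0)%:E) &
      forall (n : nat) (x : nat -> 'I_d) (j : 'I_d),
        (P [set w | (forall k, (k <= n)%N -> X k w = a (x k)) /\
                    X n.+1 w = a j] =
         P [set w | forall k, (k <= n)%N -> X k w = a (x k)]
           * (L (x n) j)%:E)%E].

Definition mutually_independent (D : set nat) Z : Prop :=
  forall (J : {fset nat}) (B : nat -> set R),
    (forall k, k \in J -> D k) ->
    (forall k, measurable (B k)) ->
    P (\bigcap_(k in [set` J]) (Z k @^-1` B k)) =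
    (\prod_(k <- J) P (Z k @^-1` B k))%E.

Definition independent_sigma_algebras (F G : set (set T)) : Prop :=
  forall A B, F A -> G B -> (P (A `&` B) = P A * P B)%E.

Definition has_density (Z : T -> R) (g : R -> R) : Prop :=
  [/\ measurable_fun setT g,
      (forall x, 0 <= g x) &
      forall B : set R, measurable B ->
        P (Z @^-1` B) = (\int[lebesgue_measure]_(x in B) (g x)%:E)%E].

(* The time index 0 is not used by the noise sequence. *)
Definition is_iid_noise (g : R -> R) Z : Prop :=
  mutually_independent [set k | (1 <= k)%N] Z /\
  forall k, (1 <= k)%N -> has_density (Z k) g.

Definition observation (h : R -> R) X Z (sigma : R) : nat -> T -> R :=
  fun n w => h (X n w) + sigma * Z n w.

(* [Lfun] only knows the ambient sigma-algebra; measurability with respect to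
   the sub-sigma-algebra [F] is the first conjunct. *)
Definition L2_sub (F : set (set T)) : set (T -> R) :=
  [set theta | (forall B : set R, measurable B -> F (theta @^-1` B)) /\
               theta \in Lfun P 2%:E].

Definition mmse X Y (n : nat) : R :=
  fine (ereal_inf
    [set 'E_P[(fun w => ((X n w - theta w) ^+ 2)%R)]%E |
       theta in L2_sub (sigma_generated [set k | (1 <= k <= n)%N] Y)]).

(* [limn] is a total operator; the limit is known to exist when the chain is
   ergodic and the noise density is bounded and does not vanish. *)
Definition steady_state_mmse X Y : R := limn (mmse X Y).

End Processes.

(* Main.v *)
(* With eps = 1/sigma the observations amount to xi_n + eps h(X_n), and the filter
   pi_n is a Markov process on the simplex.  Ergodicity makes L^T a strict
   contraction of zero-sum vectors for a suitable norm, and for small eps one step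
   of the filter is a small perturbation of the prediction pi |-> L^T pi, so it
   contracts Lipschitz functions in mean and E phi(pi_n) converges.

   The loss apriori_error - mmse tends to lim E (a . pi_n - a . mu)^2.  Let M be
   the Gramian solving M = L M L^T + b b^T with b = a - (a . mu) 1, and let
   V(x) = x^T M x.  Then V(L^T pi) = V(pi) - (a . pi - a . mu)^2, whereas the Bayes
   update of p = L^T pi increases the mean of V by eps^2 I c^T M c + o(eps^2),
   uniformly in p, where c = (diag p - p p^T) h.  In the steady state the two
   effects balance.  Applied to the vectors L e_i in place of a, this balance also
   shows that p is within O(eps) of mu in L^2, so p may be replaced by mu, and
   moving the powers L^k from b to c in the series for M turns I c^T M c into
   a^T P a. *)

Require Import Defs.
From HB Require Import structures.
From mathcomp Require Import all_boot all_order all_algebra.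
From mathcomp Require Import finmap.
From mathcomp Require Import all_classical all_reals all_analysis.
From mathcomp Require Import measurable_realfun.
From mathcomp Require Import ring lra.

Set Implicit Arguments.
Unset Strict Implicit.
Unset Printing Implicit Defensive.

Import Order.TTheory GRing.Theory Num.Theory.
Import numFieldNormedType.Exports.

Local Open Scope classical_set_scope.
Local Open Scope ring_scope.

(** * Ergodic stochastic matrices and the Lyapunov equation *)

Section Linear.
Context {R : realType} {d : nat}.
Implicit Types (x y b v : 'cV[R]_d) (L A S M : 'M[R]_d).

(** The Bayes update is not a contraction for each observation: normalisation may spread two laws
    apart. But the difference of two posteriors, multiplied by the predictive density, is [g] times
    the difference of the predicted laws plus a remainder of order eps with finite integral, and the
    mean of a Lipschitz function needs no more than this weighted form. No invariant law of the
    filter is constructed. The mean of every quadratic V converges along the filter, so its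
    increments vanish and the balance holds in the limit of large n at each fixed eps; all other
    error terms are kept uniform in n. Only afterwards does eps tend to 0. In the Bayes step the
    first-order term disappears exactly, because the likelihoods and their mixtures are all
    probability densities. In the second-order term the predictive density is replaced by [g] inside
    the Fisher integrand; this rests on dominated convergence, so the error is o(eps^2) without a
    rate. Quotients by the predictive density are controlled uniformly in the law through the local
    minimum of [g], which bounds every mixture of slightly shifted densities from below. *)

Definition l1norm x : R := \sum_i `|x i 0|.

Definition dotv b x : R := \sum_i b i 0 * x i 0.

Definition quadf M x : R := dotv x (M *m x).

Definition zero_sum x : Prop := \sum_i x i 0 = 0.

Lemma cvg_sumr (I U : Type) (r : seq I) (F : set_system U) (FF : Filter F)
    (f : I -> U -> R) (l : I -> R) :
  (forall i, f i n @[n --> F] --> l i) ->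
  \sum_(i <- r) f i n @[n --> F] --> \sum_(i <- r) l i.
Proof. by move=> fl; apply: cvg_big => [|i _]; [exact: add_continuous|exact: fl]. Qed.

Lemma l1norm_ge0 x : 0 <= l1norm x.
Proof. by apply: sumr_ge0. Qed.

Lemma l1normD x y : l1norm (x + y) <= l1norm x + l1norm y.
Proof. by rewrite -big_split /=; apply: ler_sum => i _; rewrite mxE ler_normD. Qed.

Lemma l1normZ c x : l1norm (c *: x) = `|c| * l1norm x.
Proof. by rewrite mulr_sumr; apply: eq_bigr => i _; rewrite mxE normrM. Qed.

Lemma entry_le_l1norm x i : `|x i 0| <= l1norm x.
Proof. by rewrite /l1norm (bigD1 i)//= lerDl sumr_ge0. Qed.

Lemma dotvC x y : dotv x y = dotv y x.
Proof. by apply: eq_bigr => i _; rewrite mulrC. Qed.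

Lemma dotvDr b x y : dotv b (x + y) = dotv b x + dotv b y.
Proof. by rewrite -big_split; apply: eq_bigr => i _; rewrite mxE mulrDr. Qed.

Lemma dotvNr b x : dotv b (- x) = - dotv b x.
Proof. by rewrite -sumrN; apply: eq_bigr => i _; rewrite mxE mulrN. Qed.

Lemma dotvBr b x y : dotv b (x - y) = dotv b x - dotv b y.
Proof. by rewrite dotvDr dotvNr. Qed.

Lemma dotvZr c b x : dotv b (c *: x) = c * dotv b x.
Proof. by rewrite mulr_sumr; apply: eq_bigr => i _; rewrite mxE mulrCA. Qed.

Lemma dotvBl b x y : dotv (x - y) b = dotv x b - dotv y b.
Proof. by rewrite !(dotvC _ b) dotvBr. Qed.

Lemma dotv_const c x : dotv (const_mx c) x = c * \sum_i x i 0.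
Proof. by rewrite mulr_sumr; apply: eq_bigr => i _; rewrite mxE. Qed.

Lemma dotv_delta b i : dotv b (delta_mx i 0) = b i 0.
Proof.
rewrite /dotv (bigD1 i)//= mxE !eqxx mulr1 big1 ?addr0// => j ji.
by rewrite mxE (negbTE ji) mulr0.
Qed.

Lemma dotv_mulmx A b x : dotv b (A^T *m x) = dotv (A *m b) x.
Proof.
rewrite /dotv; under eq_bigr do rewrite mxE mulr_sumr.
rewrite exchange_big /=; apply: eq_bigr => i _; rewrite mxE mulr_suml.
by apply: eq_bigr => j _; rewrite mxE; ring.
Qed.

Lemma le_dotv b x : `|dotv b x| <= l1norm b * l1norm x.
Proof.
apply: (le_trans (ler_norm_sum _ _ _)).
rewrite /l1norm mulr_suml; apply: ler_sum => i _; rewrite normrM.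
by apply: ler_wpM2l => //; exact: entry_le_l1norm.
Qed.

Lemma dotvE b x : dotv b x = (b^T *m x) 0 0.
Proof. by rewrite mxE; apply: eq_bigr => i _; rewrite mxE. Qed.

Lemma quadfE M x : quadf M x = (x^T *m M *m x) 0 0.
Proof. by rewrite /quadf dotvE mulmxA. Qed.

Lemma quadf_sum M x : quadf M x = \sum_i \sum_j M i j * (x i 0 * x j 0).
Proof.
apply: eq_bigr => i _; rewrite mxE mulr_sumr.
by apply: eq_bigr => j _; ring.
Qed.

Lemma quadf_rank1 v x : quadf (v *m v^T) x = dotv v x ^+ 2.
Proof.
rewrite /quadf -mulmxA expr2.
suff -> : v^T *m x = (dotv v x)%:M by rewrite mul_mx_scalar dotvZr (dotvC x).
by apply/matrixP => i j; rewrite !ord1 -dotvE mxE eqxx mulr1n.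
Qed.

Lemma quadfDl M S x : quadf (M + S) x = quadf M x + quadf S x.
Proof. by rewrite /quadf mulmxDl dotvDr. Qed.

Lemma quadf_conj L M x : quadf M (L^T *m x) = quadf (L *m M *m L^T) x.
Proof. by rewrite !quadfE trmx_mul trmxK !mulmxA. Qed.

Lemma iter_mulmxD A k x y :
  iter k (mulmx A) (x + y) = iter k (mulmx A) x + iter k (mulmx A) y.
Proof. by elim: k => //= k ->; rewrite mulmxDr. Qed.

Lemma iter_mulmxZ A k c x :
  iter k (mulmx A) (c *: x) = c *: iter k (mulmx A) x.
Proof. by elim: k => //= k ->; rewrite scalemxAr. Qed.

Lemma iter_mulmx_sum A k (I : Type) (r : seq I) (f : I -> 'cV[R]_d) :
  iter k (mulmx A) (\sum_(i <- r) f i) = \sum_(i <- r) iter k (mulmx A) (f i).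
Proof. by elim: k => //= k ->; rewrite mulmx_sumr. Qed.

Lemma dotv_iter A b x k :
  dotv b (iter k (mulmx A^T) x) = dotv (iter k (mulmx A) b) x.
Proof. by elim: k b => //= k IH b; rewrite dotv_mulmx IH -iterSr. Qed.

Lemma cV_sum_delta x : x = \sum_i x i 0 *: (delta_mx i 0 : 'cV[R]_d).
Proof.
rewrite {1}(matrix_sum_delta x); apply: eq_bigr => i _.
by rewrite big_ord1.
Qed.

End Linear.

Section Stochastic.
Context {R : realType} {d : nat}.
Variables (L : 'M[R]_d).
Hypothesis L_stoch : is_stochastic L.
Implicit Types (x y b : 'cV[R]_d).

Lemma sum_trmulmx x : \sum_i (L^T *m x) i 0 = \sum_i x i 0.
Proof.
under eq_bigr do rewrite mxE.
rewrite exchange_big /=; apply: eq_bigr => j _.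
rewrite -mulr_suml; under eq_bigr do rewrite mxE.
by rewrite L_stoch.2 mul1r.
Qed.

Lemma simplex_trmulmx x : in_simplex x -> in_simplex (L^T *m x).
Proof.
move=> [x0 x1]; split=> [i|]; last by rewrite sum_trmulmx.
by rewrite mxE sumr_ge0// => j _; rewrite mxE mulr_ge0 ?L_stoch.1.
Qed.

Lemma zero_sum_trmulmx x : zero_sum x -> zero_sum (L^T *m x).
Proof. by rewrite /zero_sum sum_trmulmx. Qed.

Lemma zero_sum_iter x n : zero_sum x -> zero_sum (iter n (mulmx L^T) x).
Proof. by move=> x0; elim: n => //= n; exact: zero_sum_trmulmx. Qed.

Lemma zero_sum_simplexB x y : in_simplex x -> in_simplex y -> zero_sum (x - y).
Proof.
move=> [_ x1] [_ y1]; rewrite /zero_sum.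
by under eq_bigr do rewrite !mxE; rewrite big_split /= sumrN x1 y1 subrr.
Qed.

Lemma simplex_le1 x i : in_simplex x -> x i 0 <= 1.
Proof. by move=> [x0 <-]; rewrite (bigD1 i)//= lerDl sumr_ge0. Qed.

Lemma l1norm_simplex x : in_simplex x -> l1norm x = 1.
Proof. by move=> [x0 <-]; apply: eq_bigr => i _; rewrite ger0_norm. Qed.

Lemma l1norm_simplexB x y : in_simplex x -> in_simplex y -> l1norm (x - y) <= 2.
Proof.
move=> xs ys; apply: (le_trans (l1normD _ _)).
by rewrite -scaleN1r l1normZ normrN1 mul1r !l1norm_simplex.
Qed.

Lemma simplex_delta i : in_simplex (delta_mx i 0 : 'cV[R]_d).
Proof.
split=> [j|]; first by rewrite mxE; case: (_ && _).
rewrite (bigD1 i)//= mxE !eqxx big1 ?addr0// => j ji.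
by rewrite mxE (negbTE ji).
Qed.

Lemma l1norm_trmulmx x : l1norm (L^T *m x) <= l1norm x.
Proof.
rewrite /l1norm; apply: (@le_trans _ _ (\sum_i \sum_j L j i * `|x j 0|)).
  apply: ler_sum => i _; rewrite mxE; apply: (le_trans (ler_norm_sum _ _ _)).
  by apply: ler_sum => j _; rewrite mxE normrM ger0_norm ?L_stoch.1.
rewrite exchange_big /=; apply: ler_sum => j _.
by rewrite -mulr_suml L_stoch.2 mul1r.
Qed.

Lemma l1norm_iter x n : l1norm (iter n (mulmx L^T) x) <= l1norm x.
Proof. by elim: n => //= n IH; exact: le_trans (l1norm_trmulmx _) _. Qed.

(* Equivalent to [l1norm], but on zero-sum vectors strictly contracted by [L^T]
   itself and not only by a power of it. *)
Definition orbit_norm (K : nat) x : R :=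
  \sum_(k < K) l1norm (iter k (mulmx L^T) x).

Lemma orbit_normD K x y : orbit_norm K (x + y) <= orbit_norm K x + orbit_norm K y.
Proof.
rewrite -big_split; apply: ler_sum => k _ /=.
by rewrite iter_mulmxD l1normD.
Qed.

Lemma orbit_normZ K c x : orbit_norm K (c *: x) = `|c| * orbit_norm K x.
Proof.
rewrite mulr_sumr; apply: eq_bigr => k _.
by rewrite iter_mulmxZ l1normZ.
Qed.

Lemma orbit_norm_ge0 K x : 0 <= orbit_norm K x.
Proof. by apply: sumr_ge0 => k _; exact: l1norm_ge0. Qed.

Lemma orbit_norm_le K x : orbit_norm K x <= K%:R * l1norm x.
Proof.
apply: (@le_trans _ _ (\sum_(k < K) l1norm x)).
  by apply: ler_sum => k _; exact: l1norm_iter.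
by rewrite sumr_const card_ord mulr_natl.
Qed.

Lemma l1norm_le_orbit_norm K x : l1norm x <= orbit_norm K.+1 x.
Proof.
by rewrite /orbit_norm big_ord_recl /= lerDl sumr_ge0// => k _; exact: l1norm_ge0.
Qed.

(** Shifting the orbit drops the term [l1norm x] and adds the last iterate, which is at most half of
    it. The net loss [l1norm x / 2] is at least the fraction 1/(2(K+1)) of the whole sum, because no
    term of the orbit exceeds [l1norm x]. *)
Lemma orbit_norm_trmulmx K x :
    l1norm (iter K.+1 (mulmx L^T) x) <= l1norm x / 2 ->
  orbit_norm K.+1 (L^T *m x) <= (1 - (2 * K.+1%:R)^-1) * orbit_norm K.+1 x.
Proof.
move=> xK.
have -> : orbit_norm K.+1 (L^T *m x) =
    orbit_norm K.+1 x - l1norm x + l1norm (iter K.+1 (mulmx L^T) x).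
  have shift (f : nat -> R) n :
      \sum_(k < n) f k.+1 = \sum_(k < n) f k - f 0%N + f n.
    elim: n => [|n IH]; first by rewrite !big_ord0; ring.
    by rewrite !big_ord_recr /= IH; ring.
  rewrite -[l1norm x]/(l1norm (iter 0 (mulmx L^T) x)).
  rewrite -(shift (fun k => l1norm (iter k (mulmx L^T) x))).
  by apply: eq_bigr => k _; rewrite -iterSr.
have := orbit_norm_le K.+1 x.
have K0 : 0 < K.+1%:R :> R by [].
move=> h; have : orbit_norm K.+1 x / (2 * K.+1%:R) <= l1norm x / 2.
  rewrite ler_pdivrMr ?mulr_gt0//; apply: (le_trans h).
  by rewrite le_eqVlt; apply/orP; left; apply/eqP; field.
rewrite mulrBl mul1r (mulrC _^-1); move: xK.
move=> xK h2; rewrite -addrA lerD2l.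
have : forall q l s : R, s <= l / 2 -> q <= l / 2 -> - l + s <= - q by move=> *; lra.
exact.
Qed.

End Stochastic.

Section Ergodic.
Context {R : realType} {d : nat}.
Variables (L : 'M[R]_d) (mu : 'cV[R]_d).
Hypothesis L_stoch : is_stochastic L.
Hypothesis L_erg : is_ergodic L.
Hypothesis mu_inv : is_invariant L mu.
Implicit Types (x y b : 'cV[R]_d).

(** [is_ergodic] gives a common limit for all initial laws; started at the fixed point [mu] the
    sequence is constant, so that limit is [mu]. *)
Lemma ergodic_cvg nu i : in_simplex nu ->
  marginal_law L nu n i 0 @[n --> \oo] --> mu i 0.
Proof.
case: L_erg => m [_ mP] nus; case: mu_inv => mus muE.
suff -> : mu i 0 = m i 0 by exact: mP.
have := mP _ mus i; rewrite (_ : (fun n => _) = fun=> mu i 0).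
  by move/cvg_lim => <-//; rewrite lim_cst.
apply/funext => n; suff -> : marginal_law L mu n = mu by [].
by elim: n => //= n ->.
Qed.

(** The coefficients of a zero-sum vector sum to zero, so [mu] can be subtracted from each (L^T)^n
    e_i for free; these finitely many differences are uniformly small for large n. *)
Lemma zero_sum_halving :
  exists K, forall x, zero_sum x ->
    l1norm (iter K.+1 (mulmx L^T) x) <= l1norm x / 2.
Proof.
(* Each of the [d] coordinates may cost a fraction 1/(2(d+1)); the added 1 keeps the threshold
   positive for every [d]. *)
have e0 : 0 < 2^-1 / (d%:R + 1) :> R by rewrite divr_gt0// ltr_wpDl.
have : \forall n \near \oo, forall i j : 'I_d,
    `|mu j 0 - marginal_law L (delta_mx i 0) n j 0| <= 2^-1 / (d%:R + 1).
  apply: filter_forall => i; apply: filter_forall => j.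
  have := @ergodic_cvg (delta_mx i 0) j (simplex_delta i).
  by move/cvgr_dist_le; apply.
move=> [K _ HK]; exists K => x x0.
have {}HK := HK K.+1 (leqnSn K).
have -> : iter K.+1 (mulmx L^T) x =
    \sum_i x i 0 *: (iter K.+1 (mulmx L^T) (delta_mx i 0) - mu).
  under eq_bigr do rewrite scalerBr.
  rewrite big_split /= sumrN -scaler_suml x0 scale0r subr0.
  rewrite {1}(cV_sum_delta x) -[L^T *m _]iterS iter_mulmx_sum.
  by apply: eq_bigr => i _; rewrite iter_mulmxZ.
apply: (@le_trans _ _ (\sum_(j < d) \sum_i `|x i 0| * (2^-1 / (d%:R + 1)))).
  rewrite /l1norm; apply: ler_sum => j _; rewrite summxE.
  apply: (le_trans (ler_norm_sum _ _ _)).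
  apply: ler_sum => i _; rewrite mxE normrM ler_wpM2l//.
  have := HK i j; rewrite distrC; congr (`|_| <= _).
  by rewrite [RHS]mxE; congr (_ + _); rewrite mxE.
rewrite exchange_big /= /l1norm mulr_suml; apply: ler_sum => i _.
rewrite -mulr_sumr ler_wpM2l// sumr_const card_ord -[leLHS]mulr_natr -mulrA.
by rewrite ler_piMr// mulrC ler_pdivrMr ?ltr_wpDl// mul1r lerDl.
Qed.

Definition ergodic_rate (K : nat) : R := 1 - (2 * K.+1%:R)^-1.

Lemma ergodic_rate_ge0 K : 0 <= ergodic_rate K.
Proof.
rewrite subr_ge0 invf_le1; last by rewrite mulr_gt0.
by rewrite -natrM ler1n muln_gt0.
Qed.

Lemma ergodic_rate_lt1 K : ergodic_rate K < 1.
Proof. by rewrite ltrBlDr ltrDl invr_gt0 mulr_gt0. Qed.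

Section Rate.
Variable K : nat.
Hypothesis HK : forall x, zero_sum x ->
    l1norm (iter K.+1 (mulmx L^T) x) <= l1norm x / 2.

Lemma orbit_norm_contr x : zero_sum x ->
  orbit_norm L K.+1 (L^T *m x) <= ergodic_rate K * orbit_norm L K.+1 x.
Proof. by move=> x0; apply: orbit_norm_trmulmx => //; exact: HK. Qed.

Lemma l1norm_iter_decay x n : zero_sum x ->
  l1norm (iter n (mulmx L^T) x) <= K.+1%:R * l1norm x * ergodic_rate K ^+ n.
Proof.
move=> x0; apply: (le_trans (l1norm_le_orbit_norm L K _)).
apply: (@le_trans _ _ (orbit_norm L K.+1 x * ergodic_rate K ^+ n)); last first.
  by rewrite ler_wpM2r ?exprn_ge0 ?ergodic_rate_ge0// orbit_norm_le.
elim: n => [|n IH]; first by rewrite expr0 mulr1.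
rewrite iterS; apply: (le_trans (orbit_norm_contr _)); first exact: zero_sum_iter.
by rewrite exprS mulrCA ler_wpM2l ?ergodic_rate_ge0.
Qed.

(** By duality, entry i of L^n b is [b] paired with (L^T)^n (e_i - mu), since [mu] is fixed by L^T
    and orthogonal to [b]. The pairing inherits the decay of zero-sum vectors. *)
Lemma iter_mulmx_decay b n i : dotv b mu = 0 ->
  `|iter n (mulmx L) b i 0| <= l1norm b * (K.+1%:R * 2) * ergodic_rate K ^+ n.
Proof.
move=> bmu.
have -> : iter n (mulmx L) b i 0 =
    dotv b (iter n (mulmx L^T) (delta_mx i 0 - mu)).
  rewrite dotv_iter dotvBr dotv_delta -dotv_iter.
  suff -> : iter n (mulmx L^T) mu = mu by rewrite bmu subr0.
  by elim: n => //= n ->; exact: mu_inv.2.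
apply: (le_trans (le_dotv _ _)); rewrite -mulrA ler_wpM2l ?l1norm_ge0//.
have dz : zero_sum (delta_mx i 0 - mu).
  by apply: zero_sum_simplexB; [exact: simplex_delta|exact: mu_inv.1].
apply: (le_trans (l1norm_iter_decay _ dz)).
rewrite ler_wpM2r ?exprn_ge0 ?ergodic_rate_ge0// ler_wpM2l//.
by apply: l1norm_simplexB; [exact: simplex_delta|exact: mu_inv.1].
Qed.
End Rate.

End Ergodic.

(** * Gramians as sums of series of rank-one matrices *)

Section Gramian.
Context {R : realType} {d : nat}.
Variables (A : 'M[R]_d) (v : 'cV[R]_d) (C rho : R).
Hypothesis rho_ge0 : 0 <= rho.
Hypothesis rho_lt1 : rho < 1.
Hypothesis decay : forall k i, `|iter k (mulmx A) v i 0| <= C * rho ^+ k.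

Let vk k := iter k (mulmx A) v.

Definition gramian : 'M[R]_d :=
  \matrix_(i, j) limn (series (fun k => vk k i 0 * vk k j 0)).

Let partial n : 'M[R]_d := \sum_(0 <= k < n) vk k *m (vk k)^T.

Let partialE n i j :
  partial n i j = series (fun k => vk k i 0 * vk k j 0) n.
Proof.
rewrite summxE; apply: eq_bigr => k _.
by rewrite mxE big_ord1 mxE.
Qed.

Let partial_cvg i j : partial n i j @[n --> \oo] --> gramian i j.
Proof.
under eq_fun do rewrite partialE.
rewrite mxE; apply: (@normed_cvg R R).
apply: (@series_le_cvg _ _ (geometric (C ^+ 2) rho)) => //=.
- by move=> n; apply: mulr_ge0; [exact: sqr_ge0|exact: exprn_ge0].
- move=> n; rewrite normrM.
  (* The terms decay like rho^(2n); one factor rho^n suffices for a geometric majorant, so the other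
     is bounded by 1. *)
  have CC : C ^+ 2 * rho ^+ n >= (C * rho ^+ n) * (C * rho ^+ n).
    rewrite mulrACA -expr2 ler_wpM2l ?sqr_ge0// ler_piMr ?exprn_ge0//.
    by rewrite exprn_ile1// ltW.
  by apply: le_trans CC; apply: ler_pM => //; exact: decay.
- by apply: is_cvg_geometric_series; rewrite ger0_norm.
Qed.

Lemma gramian_cvg (x : 'cV[R]_d) :
  series (fun k => dotv (vk k) x ^+ 2) n @[n --> \oo] --> quadf gramian x.
Proof.
have -> : series (fun k => dotv (vk k) x ^+ 2) = fun n => quadf (partial n) x.
  apply/funext => n; rewrite /partial /series /=.
  elim: n => [|n IH]; last by rewrite !big_nat_recr//= quadfDl -IH quadf_rank1.
  by rewrite !big_geq// /quadf mul0mx /dotv big1// => i _; rewrite mxE mulr0.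
rewrite quadf_sum; under eq_fun do rewrite quadf_sum.
apply: cvg_sumr => i; apply: cvg_sumr => j.
by apply: cvgM; [exact: partial_cvg|exact: cvg_cst].
Qed.

(** Splitting off the first term of a partial sum and factoring [A] out of the others gives the
    recursion before the limit. *)
Lemma gramian_eq : gramian = A *m gramian *m A^T + v *m v^T.
Proof.
apply/matrixP => i j.
have h1 : partial n.+1 i j @[n --> \oo] --> gramian i j.
  by have := @partial_cvg i j; rewrite -cvg_shiftS.
have h2 : partial n.+1 i j @[n --> \oo] -->
    (A *m gramian *m A^T + v *m v^T) i j.
  have -> : (fun n => partial n.+1 i j) =
            fun n => (A *m partial n *m A^T + v *m v^T) i j.
    apply/funext => n; congr (fun_of_matrix _ i j).
    rewrite /partial big_nat_recl//= addrC mulmx_sumr mulmx_suml.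
    by congr (_ + _); apply: eq_bigr => k _; rewrite /vk /= trmx_mul !mulmxA.
  rewrite [X in _ --> X]mxE; under eq_fun do rewrite mxE.
  apply: cvgD; last exact: cvg_cst.
  rewrite mxE; under eq_fun do rewrite mxE.
  apply: cvg_sumr => p; apply: cvgM; last exact: cvg_cst.
  rewrite mxE; under eq_fun do rewrite mxE.
  by apply: cvg_sumr => q; apply: cvgM; [exact: cvg_cst|exact: partial_cvg].
exact: (cvg_unique (@Rhausdorff R) h1 h2).
Qed.

Lemma gramian_tr : gramian^T = gramian.
Proof.
apply/matrixP => i j; rewrite !mxE; congr (limn (series _)).
by apply/funext => k; rewrite mulrC.
Qed.

Lemma gramian_ge0 x : 0 <= quadf gramian x.
Proof.
rewrite -(cvg_lim (@Rhausdorff R) (gramian_cvg (x := x))); apply: limr_ge.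
  by apply/cvg_ex; exists (quadf gramian x); exact: gramian_cvg.
by apply: nearW => n; apply: sumr_ge0 => k _; exact: sqr_ge0.
Qed.

End Gramian.

Section Lyapunov.
Context {R : realType} {d : nat}.
Variables (L : 'M[R]_d) (mu : 'cV[R]_d).
Hypothesis L_stoch : is_stochastic L.
Hypothesis L_erg : is_ergodic L.
Hypothesis mu_inv : is_invariant L mu.
Implicit Types (x y b h p : 'cV[R]_d) (Q : 'M[R]_d).

Definition centered b : 'cV[R]_d := b - const_mx (dotv b mu).

(** Entry i is the covariance, under the law [p], of [h] with the indicator of state i. *)
Definition cov_vec p h : 'cV[R]_d := \col_i (p i 0 * (h i 0 - dotv h p)).

Lemma cov_vecE p h : (diag_mx p^T - p *m p^T) *m h = cov_vec p h.
Proof.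
apply/matrixP => i j; rewrite ord1 {j} mulmxBl -mulmxA.
have -> : p^T *m h = (dotv p h)%:M.
  by apply/matrixP => ? ?; rewrite !ord1 -dotvE mxE eqxx mulr1n.
rewrite mul_mx_scalar !mxE (bigD1 i)//= !mxE eqxx mulr1n big1 ?addr0.
  by rewrite (dotvC p); ring.
by move=> k ki; rewrite !mxE eq_sym (negbTE ki) mul0r.
Qed.

Lemma cov_mx_tr p : (diag_mx p^T - p *m p^T)^T = diag_mx p^T - p *m p^T.
Proof. by rewrite linearB /= tr_diag_mx trmx_mul trmxK. Qed.

Lemma zero_sum_cov_vec p h : in_simplex p -> zero_sum (cov_vec p h).
Proof.
move=> [_ p1]; rewrite /zero_sum; under eq_bigr do rewrite mxE mulrBr.
rewrite big_split /= sumrN -mulr_suml p1 mul1r.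
by apply/eqP; rewrite subr_eq0; apply/eqP/eq_bigr => i _; rewrite mulrC.
Qed.

Lemma dotv_centered b x : in_simplex x -> dotv (centered b) x = dotv b x - dotv b mu.
Proof. by move=> [_ x1]; rewrite dotvBl dotv_const x1 mulr1. Qed.

Lemma dotv_centered_mu b : dotv (centered b) mu = 0.
Proof. by rewrite dotv_centered ?subrr//; exact: mu_inv.1. Qed.

Lemma dotv_centered_zero_sum b x : zero_sum x -> dotv (centered b) x = dotv b x.
Proof. by move=> x0; rewrite dotvBl dotv_const x0 mulr0 subr0. Qed.

(** The equation yields one-step identities, the series yields duality. Both are bundled so that the
    observability side ([L] with centered functions) and the Lyapunov side ([L^T] with covariance
    vectors) share one notion. *)
Definition is_gramian (A : 'M[R]_d) v (S : 'M[R]_d) : Prop :=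
  [/\ S = A *m S *m A^T + v *m v^T, S^T = S, forall x, 0 <= quadf S x &
      forall x, series (fun k => dotv (iter k (mulmx A) v) x ^+ 2) n
        @[n --> \oo] --> quadf S x].

Lemma gramian_centered b : exists M, is_gramian L (centered b) M.
Proof.
have [K HK] := zero_sum_halving L_erg mu_inv.
have decay k i := iter_mulmx_decay L_stoch mu_inv HK k i (dotv_centered_mu b).
have r0 := ergodic_rate_ge0 (R := R) K.
have r1 := ergodic_rate_lt1 (R := R) K.
exists (gramian L (centered b)); split.
- exact: gramian_eq r0 r1 decay.
- exact: gramian_tr.
- exact: gramian_ge0 r0 r1 decay.
- exact: gramian_cvg r0 r1 decay.
Qed.

Lemma gramian_cov h : exists Q, is_gramian L^T (cov_vec mu h) Q.
Proof.
have [K HK] := zero_sum_halving L_erg mu_inv.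
have z := zero_sum_cov_vec h mu_inv.1.
have decay k i : `|iter k (mulmx L^T) (cov_vec mu h) i 0| <= _ :=
  le_trans (entry_le_l1norm _ i) (l1norm_iter_decay L_stoch HK k z).
have r0 := ergodic_rate_ge0 (R := R) K.
have r1 := ergodic_rate_lt1 (R := R) K.
exists (gramian L^T (cov_vec mu h)); split.
- exact: gramian_eq r0 r1 decay.
- exact: gramian_tr.
- exact: gramian_ge0 r0 r1 decay.
- exact: gramian_cvg r0 r1 decay.
Qed.

(* With [w_k = (L^T)^k w] and [b_k = L^k b'], where [w] is the covariance vector
   and [b'] the centered [b], both sides are the sum over [k] of [(b' . w_k)^2 =
   (b_k . w)^2]. *)
Lemma gramian_duality h b Q M :
  is_gramian L^T (cov_vec mu h) Q -> is_gramian L (centered b) M ->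
  quadf Q b = quadf M (cov_vec mu h).
Proof.
move=> [_ _ _ Qc] [_ _ _ Mc].
apply: (cvg_unique (@Rhausdorff R) (Qc b)).
suff -> : (fun k => dotv (iter k (mulmx L^T) (cov_vec mu h)) b ^+ 2) =
  fun k => dotv (iter k (mulmx L) (centered b)) (cov_vec mu h) ^+ 2 by exact: Mc.
apply/funext => k; congr (_ ^+ 2).
have zk : zero_sum (iter k (mulmx L^T) (cov_vec mu h)).
  by apply: zero_sum_iter => //; apply: zero_sum_cov_vec; exact: mu_inv.1.
by rewrite dotvC -(dotv_centered_zero_sum b zk) dotv_iter.
Qed.

(** Since the covariance matrix is symmetric, the forcing term is I times the rank-one square of
    [cov_vec mu h]. The sum of all entries of Q is its quadratic form at the all-ones vector, and
    every vector of the orbit is orthogonal to that vector. *)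
Lemma lyapunov_gramian h (I : R) Q : 0 <= I -> is_gramian L^T (cov_vec mu h) Q ->
  lyapunov_solution L mu h I (I *: Q).
Proof.
move=> I0 [Qeq Qtr Q0 Qc]; split.
- rewrite {1}Qeq trmxK scalerDr -scalemxAr -scalemxAl; congr (_ + _ *: _).
  by rewrite -!mulmxA -{2}(cov_mx_tr mu) -trmx_mul !mulmxA cov_vecE.
- split; first by rewrite linearZ /= Qtr.
  by move=> x; rewrite -scalemxAr -scalemxAl mxE mulr_ge0// -quadfE.
- have z : quadf Q (const_mx 1) = 0.
    rewrite -(cvg_lim (@Rhausdorff R) (Qc (const_mx 1))).
    rewrite (_ : series _ = fun=> 0) ?lim_cst//.
    apply/funext => n; apply: big1 => k _.
    rewrite dotvC dotv_const zero_sum_iter ?mulr0 ?expr0n//.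
    by apply: zero_sum_cov_vec; exact: mu_inv.1.
  transitivity (I * quadf Q (const_mx 1)); last by rewrite z mulr0.
  rewrite quadf_sum mulr_sumr; apply: eq_bigr => i _.
  by rewrite mulr_sumr; apply: eq_bigr => j _; rewrite !mxE !mulr1.
Qed.

(** The difference D satisfies D = (L^T)^k D L^k for all k. As L^k e_j tends to mu_j times the
    all-ones vector, D_ij is mu_i mu_j times the sum of the entries of D, which is zero. *)
Lemma lyapunov_unique h (I : R) Q Q' :
  lyapunov_solution L mu h I Q -> lyapunov_solution L mu h I Q' -> Q = Q'.
Proof.
move=> [Qe _ Qs] [Qe' _ Qs']; apply/eqP; rewrite -subr_eq0; apply/eqP.
set D := Q - Q'.
have De : D = L^T *m D *m L.
  by rewrite /D {1}Qe {1}Qe' opprD addrACA subrr addr0 mulmxBr mulmxBl.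
have Ds : \sum_i \sum_j D i j = 0.
  transitivity (\sum_i \sum_j Q i j - \sum_i \sum_j Q' i j).
    2: by rewrite Qs Qs' subrr.
  rewrite -sumrB; apply: eq_bigr => i _.
  by rewrite -sumrB; apply: eq_bigr => j _; rewrite !mxE.
apply/matrixP => i j; rewrite [RHS]mxE.
pose e (i : 'I_d) : 'cV[R]_d := delta_mx i 0.
have Dk k : D i j =
    dotv (iter k (mulmx L) (e i)) (D *m iter k (mulmx L) (e j)).
  elim: k => [|k IH] /=.
    by rewrite /e dotvC dotv_delta -colE [RHS]mxE.
  by rewrite -dotv_mulmx !mulmxA -De.
have ecvg (r p : 'I_d) : iter k (mulmx L) (e r) p 0 @[k --> \oo] --> mu r 0.
  under eq_fun do rewrite -dotv_delta -dotv_iter dotvC dotv_delta.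
  by apply: (ergodic_cvg L_erg mu_inv); exact: simplex_delta.
have : (fun k : nat => D i j) @ \oo -->
    \sum_p mu i 0 * \sum_q D p q * mu j 0.
  under eq_fun => k do rewrite (Dk k).
  apply: cvg_sumr => p; apply: cvgM; first exact: ecvg.
  under eq_fun do rewrite mxE.
  apply: cvg_sumr => q; apply: cvgM; first exact: cvg_cst.
  exact: ecvg.
move/(cvg_lim (@Rhausdorff R)); rewrite lim_cst// => ->.
under eq_bigr do rewrite -mulr_suml.
by rewrite -mulr_sumr -mulr_suml Ds mul0r mulr0.
Qed.

(* One prediction step decreases the quadratic form of the observability Gramian
   by exactly the squared deviation whose stationary mean is sought. *)
Lemma quadf_gramian_pred b M x : is_gramian L (centered b) M -> in_simplex x ->
  quadf M (L^T *m x) = quadf M x - (dotv b x - dotv b mu) ^+ 2.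
Proof.
move=> [Me _ _ _] xs; rewrite quadf_conj {2}Me quadfDl quadf_rank1.
by rewrite dotv_centered// addrK.
Qed.

End Lyapunov.

(** * The noise density *)

Section Integration.
Context {dd : measure_display} {T : measurableType dd} {R : realType}.
Variable m : {measure set T -> \bar R}.
Implicit Types (f F : T -> R).

(** The integral of a nonnegative function is a supremum over the simple functions below it, so the
    comparison also covers integrands of unclear measurability, such as those built from
    [max_abs_near]. *)
Lemma ge0_le_integral_lower (f1 f2 : T -> \bar R) :
  (forall x, 0 <= f1 x)%E -> (forall x, f1 x <= f2 x)%E ->
  (\int[m]_x f1 x <= \int[m]_x f2 x)%E.
Proof.
move=> f10 f12; rewrite !ge0_integralTE//; last first.
  by move=> x; exact: le_trans (f10 x) (f12 x).
apply: ereal_sup_le => _ [h hf <-]; exists h => // x.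
exact: le_trans (hf x) (f12 x).
Qed.

Lemma integrable_dominated f F : measurable_fun setT f ->
  (forall x, `|f x| <= F x) -> m.-integrable setT (EFin \o F) ->
  m.-integrable setT (EFin \o f).
Proof.
move=> mf fF; apply: le_integrable => //; first exact/measurable_EFinP.
by move=> x _; rewrite lee_fin (le_trans (fF x))// ler_norm.
Qed.

Lemma le_normr_Rintegral_dominated f F : measurable_fun setT f ->
  (forall x, `|f x| <= F x) -> m.-integrable setT (EFin \o F) ->
  `|\int[m]_x f x| <= \int[m]_x F x.
Proof.
move=> mf fF iF; have intf := integrable_dominated mf fF iF.
apply: (le_trans (le_normr_Rintegral _ intf)) => //.
by apply: le_Rintegral => //; exact: integrable_norm.
Qed.

Lemma ge0_integrable F : measurable_fun setT F -> (forall x, 0 <= F x) ->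
  (\int[m]_x (F x)%:E < +oo)%E -> m.-integrable setT (EFin \o F).
Proof.
move=> mF F0 Foo; apply/integrableP; split; first exact/measurable_EFinP.
by under eq_integral do rewrite gee0_abs ?lee_fin//.
Qed.

Lemma integrable_sumr (I : Type) (r : seq I) (f : I -> T -> R) :
  (forall i, m.-integrable setT (EFin \o f i)) ->
  m.-integrable setT (EFin \o (fun x => \sum_(i <- r) f i x)).
Proof.
move=> fi; rewrite (_ : _ \o _ = fun x => (\sum_(i <- r) (f i x)%:E)%E).
  exact: (@integrable_sum _ _ _ _ _ measurableT _ r xpredT
    (fun i x => (f i x)%:E) (fun i _ => fi i)).
by apply/funext => x; rewrite /= -sumEFin.
Qed.

Lemma integrableZlr c f : m.-integrable setT (EFin \o f) ->
  m.-integrable setT (EFin \o (fun x => c * f x)).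
Proof. by move=> fi; have := integrableZl measurableT c fi; apply: eq_integrable. Qed.

Lemma integrableDr f F : m.-integrable setT (EFin \o f) ->
  m.-integrable setT (EFin \o F) -> m.-integrable setT (EFin \o (fun x => f x + F x)).
Proof. by move=> fi Fi; have := integrableD measurableT fi Fi; apply: eq_integrable. Qed.

Lemma integrableBr f F : m.-integrable setT (EFin \o f) ->
  m.-integrable setT (EFin \o F) -> m.-integrable setT (EFin \o (fun x => f x - F x)).
Proof. by move=> fi Fi; have := integrableB measurableT fi Fi; apply: eq_integrable. Qed.

Lemma Rintegral_sum (I : Type) (r : seq I) (f : I -> T -> R) :
  (forall i, m.-integrable setT (EFin \o f i)) ->
  \int[m]_x (\sum_(i <- r) f i x) = \sum_(i <- r) \int[m]_x f i x.
Proof.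
move=> fi; elim: r => [|i r IH].
  by under eq_Rintegral do rewrite big_nil; rewrite big_nil Rintegral_cst// mul0r.
under eq_Rintegral do rewrite big_cons; rewrite big_cons -IH RintegralD//.
exact: integrable_sumr.
Qed.

Lemma EFin_Rintegral f : m.-integrable setT (EFin \o f) ->
  (\int[m]_x f x)%:E = (\int[m]_x (f x)%:E)%E.
Proof. by move=> fi; rewrite fineK//; exact: integrable_fin_num. Qed.

Lemma measurable_inv_gt0 f : measurable_fun setT f -> (forall x, 0 < f x) ->
  measurable_fun setT (fun x => (f x)^-1).
Proof.
move=> mf f0; rewrite (_ : (fun x => _) = (fun x => powR (f x) (-1))).
  exact: (measurableT_comp (measurable_powR (-1))).
by apply/funext => x; rewrite powR_inv1// ltW.
Qed.

End Integration.

Section Translation.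
Context {R : realType}.
Notation leb := (@lebesgue_measure R).

(** The image of Lebesgue measure under a translation gives each half-open interval its length, and
    a measure with this property is unique. *)
Lemma lebesgue_measure_shift (t : R) (A : set R) : measurable A ->
  leb ((fun x => x - t) @^-1` A) = leb A.
Proof.
move=> mA.
have mphi : measurable_fun setT ((fun x => x - t) : measurableTypeR R -> measurableTypeR R).
  by apply: measurable_funB => //; exact: measurable_cst.
pose shift (x : measurableTypeR R) : measurableTypeR R := x - t.
pose phi : {mfun measurableTypeR R >-> measurableTypeR R} :=
  HB.pack shift (isMeasurableFun.Build _ _ _ _ shift mphi).
apply/esym; have := @lebesgue_measure_unique R (pushforward leb phi).
apply => // _ [[a b] _ <-] /=.
have -> : pushforward leb shift `]a, b]%classic = leb `]a + t, b + t]%classic.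
  congr (leb _).
  by apply/seteqP; split => x /=; rewrite /shift !in_itv/= ltrBrDr lerBlDr.
rewrite !lebesgue_measure_itv /= !lte_fin ltrD2r.
by case: ifP => // _; rewrite -!EFinD; congr EFin; ring.
Qed.

Lemma ge0_integral_shift (t : R) (f : R -> \bar R) : measurable_fun setT f ->
  (forall x, 0 <= f x)%E -> (\int[leb]_x f (x - t)%R = \int[leb]_x f x)%E.
Proof.
move=> mf f0.
have mphi : measurable_fun setT ((fun x => x - t) : measurableTypeR R -> measurableTypeR R).
  by apply: measurable_funB => //; exact: measurable_cst.
have := @ge0_integral_pushforward _ _ _ (measurableTypeR R) R _ mphi leb setT f
  measurableT mf (fun y _ => f0 y).
rewrite preimage_setT => <-.
apply: eq_measure_integral => A mA _; rewrite /pushforward.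
exact: lebesgue_measure_shift.
Qed.

End Translation.

Section Density.
Context {R : realType}.
Notation leb := (@lebesgue_measure R).
Variables (g : R -> R) (delta : R).
Hypothesis g_regular : noise_regularity g.
Hypothesis g_ge0 : forall x, 0 <= g x.
Hypothesis delta_gt0 : 0 < delta.

Let w := min_near delta g.
Let M := max_abs_near delta (derive1 (derive1 g)).

Lemma density_gt0 x : 0 < g x.
Proof. by rewrite lt0r g_ge0 andbT; case: g_regular. Qed.

Lemma density_derive x : is_derive x (1 : R) g (derive1 g x).
Proof.
by case: g_regular => _ [dg _] _; rewrite derive1E; apply: derivableP; exact: dg.
Qed.

Lemma density_derive2 x : is_derive x (1 : R) (derive1 g) (derive1 (derive1 g) x).
Proof.
case: g_regular => _ [_ dg] _; rewrite (derive1E (derive1 g)).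
by apply: derivableP; exact: dg.
Qed.

Lemma density_continuous : continuous g.
Proof.
move=> x; apply: differentiable_continuous; apply/derivable1_diffP.
by case: g_regular => _ [dg _] _; exact: dg.
Qed.

Lemma derive1_density_continuous : continuous (derive1 g).
Proof.
move=> x; apply: differentiable_continuous; apply/derivable1_diffP.
by case: g_regular => _ [_ dg] _; exact: dg.
Qed.

Lemma measurable_density : measurable_fun setT g.
Proof. by apply: continuous_measurable_fun; exact: density_continuous. Qed.

Lemma measurable_derive1_density : measurable_fun setT (derive1 g).
Proof. by apply: continuous_measurable_fun; exact: derive1_density_continuous. Qed.

Lemma min_near_le x u : `|u| <= delta -> w x <= g (x + u).
Proof.
move=> ud; apply: ge_inf; last by exists u.
by exists 0 => _ [v _ <-]; exact: g_ge0.
Qed.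

Lemma min_near_le_density x : w x <= g x.
Proof. by have := @min_near_le x 0; rewrite addr0 normr0; apply; exact: ltW. Qed.

(** By continuity the infimum over the compact window is bounded below by an attained value of [g],
    which is positive. *)
Lemma min_near_gt0 x : 0 < w x.
Proof.
have [|c _ cP] := @EVT_min R g (x - delta) (x + delta) _
  (continuous_subspaceT density_continuous).
  by rewrite lerD2l ge0_cp// ltW.
apply: lt_le_trans (density_gt0 c) _; apply: lb_le_inf.
  by exists (g (x + 0)); exists 0 => //=; rewrite normr0 ltW.
move=> _ [u /= ud <-]; apply: cP; rewrite in_itv /=.
by move: ud; rewrite ler_norml !lerD2l.
Qed.

(** A superlevel set of an infimum of continuous functions is an intersection of closed sets; this
    is what makes [min_near] measurable although the window is uncountable. *)
Lemma min_near_closed c : closed [set x | c <= w x].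
Proof.
rewrite (_ : [set x | c <= w x] =
    \bigcap_(u in [set u | `|u| <= delta]) [set x | c <= g (x + u)]).
  apply: closed_bigI => u _.
  apply: (@preimage_closed _ _ (fun x => g (x + u)) [set y | c <= y]).
    move=> x _; apply: continuous_comp; last exact: density_continuous.
    by apply: cvgD; [exact: cvg_id|exact: cvg_cst].
  exact: closed_ge.
apply/seteqP; split => x /= cx.
  by move=> u /= ud; exact: le_trans cx (min_near_le x ud).
apply: lb_le_inf.
  by exists (g (x + 0)); exists 0 => //=; rewrite normr0 ltW.
by move=> _ [u ud <-]; exact: cx.
Qed.

Lemma measurable_min_near : measurable_fun setT w.
Proof.
apply: (measurability _ (RGenCInfty.measurableE R)).
move=> /= _ [_ [a ->]] <-; apply: measurableI => //; apply: closed_measurable.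
rewrite (_ : _ @^-1` _ = [set x | a <= w x]); first exact: min_near_closed.
by apply/seteqP; split => x /=; rewrite in_itv/= andbT.
Qed.

Lemma max_abs_near_ge x v : `|v| <= delta -> `|derive1 (derive1 g) (x + v)| <= M x.
Proof.
move=> vd; apply: ub_le_sup; last by exists v.
case: g_regular => _ _ [_ _ [B HB]].
by exists B => _ [u _ <-]; exact: HB.
Qed.

Lemma max_abs_near_ge0 x : 0 <= M x.
Proof.
apply: le_trans (@max_abs_near_ge x 0 _); first exact: normr_ge0.
by rewrite normr0 ltW.
Qed.

Lemma mean_value_between (f df : R -> R) a b :
  (forall x, is_derive x (1 : R) f (df x)) ->
  exists2 c, `|c - a| <= `|b - a| & f b - f a = df c * (b - a).
Proof.
move=> fd.
have fc (x y : R) : {within `[x, y], continuous f}.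
  by apply: derivable_within_continuous => z _; exact: ex_derive.
have [ab|/ltW ba] := leP a b.
  have [c] := MVT_segment ab (fun x _ => fd x) (@fc a b).
  rewrite in_itv /= => /andP[ac cb] fE; exists c => //.
  by rewrite !ger0_norm ?subr_ge0// lerD2r.
have [c] := MVT_segment ba (fun x _ => fd x) (@fc b a).
rewrite in_itv /= => /andP[bc ca] fE; exists c.
  by rewrite (distrC c) (distrC b) !ger0_norm ?subr_ge0// lerD2l lerN2.
by rewrite -(opprB (f a)) fE -mulrN opprB.
Qed.

(** Two applications of the mean value theorem, to [g] and then to its derivative, use only the
    existence of g''. The constant 1 instead of 1/2 is harmless. *)
Lemma density_taylor y t : `|t| <= delta ->
  `|g (y - t) - g y + t * derive1 g y| <= t ^+ 2 * M y.
Proof.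
move=> td.
have [c cy ->] := @mean_value_between g _ y (y - t) density_derive.
rewrite [y - t - y]addrAC subrr add0r normrN in cy *.
have [c' c'y cE] := @mean_value_between _ _ y c density_derive2.
rewrite (_ : _ + _ = - t * (derive1 g c - derive1 g y)); last by ring.
rewrite cE normrM normrN normrM expr2.
have -> : t * t * M y = `|t| * (M y * `|t|).
  by rewrite -expr2 -real_normK ?num_real// expr2; ring.
rewrite ler_wpM2l//; apply: ler_pM => //.
have -> : c' = y + (c' - y) by ring.
by apply: max_abs_near_ge; exact: le_trans (le_trans c'y cy) td.
Qed.

(** Since w <= g, the quotient 1/g is at most g/w^2; hence the first integrability condition makes
    the Fisher information finite. *)
Lemma fisher_le x :
  derive1 g x ^+ 2 / g x <= (derive1 g x / w x) ^+ 2 * g x.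
Proof.
have g0 := density_gt0 x; have w0 := min_near_gt0 x.
rewrite expr_div_n -[leRHS]mulrA; apply: ler_wpM2l; first exact: sqr_ge0.
rewrite [leRHS]mulrC ler_pdivlMr ?exprn_gt0// mulrC ler_pdivrMr//.
by rewrite -expr2 lerXn2r// ?nnegrE ?(ltW w0)// min_near_le_density.
Qed.

End Density.

(** * The filter recursion as an operator on functions *)

Section Bayes.
Context {R : realType} {d : nat}.
Notation leb := (@lebesgue_measure R).
Implicit Types (p x : 'cV[R]_d) (phi : 'cV[R]_d -> R).

(** Measurability is tested along measurable families of laws, so that only values on the simplex
    count and composition with the filter is immediate. *)
Definition simplex_measurable phi : Prop :=
  forall (dd : measure_display) (S : measurableType dd) (u : S -> 'cV[R]_d),
    (forall i, measurable_fun setT (fun s => u s i 0)) ->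
    (forall s, in_simplex (u s)) -> measurable_fun setT (fun s => phi (u s)).

Definition lik (G : 'I_d -> R -> R) p (y : R) : R := \sum_i p i 0 * G i y.

Definition bayes (G : 'I_d -> R -> R) p (y : R) : 'cV[R]_d :=
  \col_i (p i 0 * G i y / lik G p y).

(* If [x] is the current conditional law of the chain, this is the conditional
   mean of [phi] at the next one: [L^T *m x] is the predicted law, [lik] the
   density of the next observation and [bayes] the posterior. *)
Definition bayes_op (G : 'I_d -> R -> R) (L : 'M[R]_d) phi x : R :=
  \int[leb]_y (phi (bayes G (L^T *m x) y) * lik G (L^T *m x) y).

Definition is_lik (G : 'I_d -> R -> R) : Prop :=
  [/\ forall i, measurable_fun setT (G i), forall i y, 0 < G i y &
      forall i, (\int[leb]_y (G i y)%:E = 1)%E].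

Section Facts.
Variable G : 'I_d -> R -> R.
Hypothesis G_lik : is_lik G.

Let mG : forall i, measurable_fun setT (G i). Proof. by case: G_lik. Qed.
Let G_gt0 : forall i y, 0 < G i y. Proof. by case: G_lik. Qed.

Lemma is_lik_integrable i : leb.-integrable setT (EFin \o G i).
Proof.
apply: ge0_integrable; first exact: mG.
  by move=> y; exact: ltW.
by case: G_lik => _ _ ->; rewrite ltry.
Qed.

Lemma is_lik_int1 i : \int[leb]_y G i y = 1.
Proof. by rewrite /Rintegral; case: G_lik => _ _ ->. Qed.

Lemma lik_gt0 p y : in_simplex p -> 0 < lik G p y.
Proof.
move=> [p0 p1]; rewrite lt0r sumr_ge0 ?andbT; last first.
  by move=> i _; rewrite mulr_ge0// ltW.
apply/eqP => s0; have := oner_neq0 R; rewrite -p1 => /eqP; apply.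
apply: big1 => i _; have := s0; rewrite /lik.
move/eqP; rewrite psumr_eq0; last by move=> j _; rewrite mulr_ge0// ltW.
move/allP => /(_ i); rewrite mem_index_enum => /(_ isT) /=.
by rewrite mulf_eq0 (gt_eqF (G_gt0 _ _)) orbF => /eqP.
Qed.

Lemma bayes_simplex p y : in_simplex p -> in_simplex (bayes G p y).
Proof.
move=> ps; have l0 := lik_gt0 y ps; split=> [i|].
  by rewrite mxE divr_ge0 ?(ltW l0)// mulr_ge0 ?(ltW (G_gt0 _ _))//; case: ps.
by under eq_bigr do rewrite mxE; rewrite -mulr_suml divff ?gt_eqF.
Qed.

Lemma lik_bayes p y i : in_simplex p -> lik G p y * bayes G p y i 0 = p i 0 * G i y.
Proof. by move=> ps; rewrite mxE mulrC divfK// gt_eqF ?lik_gt0. Qed.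

Lemma measurable_lik p : measurable_fun setT (lik G p).
Proof.
apply: measurable_sum => i; apply: measurable_funM; first exact: measurable_cst.
exact: mG.
Qed.

Lemma lik_integrable p : leb.-integrable setT (EFin \o lik G p).
Proof.
apply: integrable_sumr => i; apply: integrableZlr; exact: is_lik_integrable.
Qed.

Lemma Rintegral_lik p : in_simplex p -> \int[leb]_y lik G p y = 1.
Proof.
move=> [_ p1]; rewrite Rintegral_sum; last first.
  by move=> i; apply: integrableZlr; exact: is_lik_integrable.
rewrite -[RHS]p1; apply: eq_bigr => i _.
by rewrite RintegralZl// ?is_lik_int1 ?mulr1//; exact: is_lik_integrable.
Qed.

Lemma measurable_bayes p i : in_simplex p ->
  measurable_fun setT (fun y => bayes G p y i 0).
Proof.
move=> ps; under eq_fun do rewrite mxE.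
apply: measurable_funM.
  by apply: measurable_funM; [exact: measurable_cst|exact: mG].
by apply: measurable_inv_gt0; [exact: measurable_lik|move=> y; exact: lik_gt0].
Qed.

Lemma measurable_bayes_integrand phi p : simplex_measurable phi -> in_simplex p ->
  measurable_fun setT (fun y => phi (bayes G p y) * lik G p y).
Proof.
move=> mphi ps; apply: measurable_funM; last exact: measurable_lik.
apply: mphi => [i|y]; first exact: measurable_bayes.
exact: bayes_simplex.
Qed.

Lemma bayes_integrand_integrable phi B p : simplex_measurable phi ->
  (forall x, in_simplex x -> `|phi x| <= B) -> in_simplex p ->
  leb.-integrable setT (EFin \o (fun y => phi (bayes G p y) * lik G p y)).
Proof.
move=> mphi phiB ps.
apply: (integrable_dominated _ _ (integrableZlr B (lik_integrable p))).
  exact: measurable_bayes_integrand.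
move=> y; rewrite normrM [X in _ * X]gtr0_norm ?lik_gt0//.
apply: ler_wpM2r; first by rewrite ltW ?lik_gt0.
by apply: phiB; exact: bayes_simplex.
Qed.

End Facts.
End Bayes.

(** * Contraction of Lipschitz functions by the filter operator *)

Section Lipschitz.
Context {R : realType} {d : nat}.
Notation leb := (@lebesgue_measure R).
Variables (L : 'M[R]_d) (K : nat).
Hypothesis L_stoch : is_stochastic L.
Implicit Types (p x : 'cV[R]_d) (phi : 'cV[R]_d -> R).

Local Notation N := (orbit_norm L K).

Definition simplex_lipschitz (l : R) phi : Prop :=
  forall x y, in_simplex x -> in_simplex y -> `|phi x - phi y| <= l * N (x - y).

Lemma simplex_lipschitz_bounded l phi : 0 <= l -> simplex_lipschitz l phi ->
  exists B, forall x, in_simplex x -> `|phi x| <= B.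
Proof.
move=> l0 lphi; have [[x0 x0s]|/forallNP nex] := pselect (exists x0, in_simplex x0); last first.
  by exists 0 => x /nex.
exists (`|phi x0| + l * (K%:R * 2)) => x xs.
rewrite -[phi x](subrK (phi x0)) addrC; apply: (le_trans (ler_normD _ _)).
rewrite lerD2l (le_trans (lphi _ _ xs x0s))// ler_wpM2l//.
apply: (le_trans (orbit_norm_le L_stoch _ _)); rewrite ler_wpM2l//.
exact: l1norm_simplexB.
Qed.

Section Contraction.
Variables (G : 'I_d -> R -> R) (g D : R -> R) (rho : R).
Hypothesis G_lik : is_lik G.
Hypothesis D_ge0 : forall y, 0 <= D y.
Hypothesis GD : forall i y, `|G i y - g y| <= D y.
Hypothesis g_ge0 : forall y, 0 <= g y.
Hypothesis g_int : leb.-integrable setT (EFin \o g).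
Hypothesis D_int : leb.-integrable setT (EFin \o D).
Hypothesis g_int1 : \int[leb]_y g y = 1.
Hypothesis contr : forall x, zero_sum x -> N (L^T *m x) <= rho * N x.
Hypothesis l1N : forall x, l1norm x <= N x.

(** The entries of p - p' sum to zero, so [g y] can be subtracted from every likelihood and only the
    deviations bounded by [D] remain. *)
Lemma likB_le p p' y : in_simplex p -> in_simplex p' ->
  `|lik G p y - lik G p' y| <= D y * l1norm (p - p').
Proof.
move=> ps ps'; have z := zero_sum_simplexB ps ps'.
have -> : lik G p y - lik G p' y = \sum_i (p - p') i 0 * (G i y - g y).
  under [RHS]eq_bigr do rewrite mulrBr.
  rewrite big_split /= sumrN -mulr_suml z mul0r subr0 -sumrB.
  by apply: eq_bigr => i _; rewrite !mxE mulrBl.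
apply: (le_trans (ler_norm_sum _ _ _)); rewrite mulr_sumr.
by apply: ler_sum => i _; rewrite normrM mulrC ler_wpM2r.
Qed.

(** Unnormalised posteriors are nearly [g] times the predicted laws. The weight [lik G p y] clears
    one denominator; the mismatch with the other costs [lik G p y - lik G p' y], which is again of
    order [D]. Each of the two effects contributes one [D]. *)
Lemma bayes_stability p p' y : in_simplex p -> in_simplex p' ->
  N (lik G p y *: (bayes G p y - bayes G p' y)) <=
  g y * N (p - p') + K%:R * (2 * D y * l1norm (p - p')).
Proof.
move=> ps ps'; have bs' := bayes_simplex G_lik y ps'.
pose r := lik G p y *: (bayes G p y - bayes G p' y) - g y *: (p - p').
have -> : lik G p y *: (bayes G p y - bayes G p' y) = g y *: (p - p') + r.
  by rewrite /r addrCA subrr addr0.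
apply: (le_trans (orbit_normD _ _ _ _)).
rewrite orbit_normZ ger0_norm// lerD2l.
apply: (le_trans (orbit_norm_le L_stoch _ _)); rewrite ler_wpM2l//.
have rE i : r i 0 = (p - p') i 0 * (G i y - g y) -
    bayes G p' y i 0 * (lik G p y - lik G p' y).
  have := lik_bayes G_lik y i ps; have := lik_bayes G_lik y i ps'.
  rewrite /r; move: (bayes G p y) (bayes G p' y) => b b' e1 e2.
  by rewrite !mxE !mulrBr e2 (mulrC (b' i 0) (lik G p' y)) e1; ring.
apply: (@le_trans _ _ (\sum_i (`|(p - p') i 0| * D y +
    bayes G p' y i 0 * (D y * l1norm (p - p'))))).
  apply: ler_sum => i _; rewrite rE; apply: (le_trans (ler_normB _ _)).
  rewrite !normrM; apply: lerD; first by rewrite ler_wpM2l.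
  have b0 : 0 <= bayes G p' y i 0 by case: bs' => + _; apply.
  by rewrite (ger0_norm b0) ler_wpM2l ?likB_le.
rewrite big_split /= -!mulr_suml -/(l1norm _); case: bs' => _ ->.
by rewrite le_eqVlt; apply/orP; left; apply/eqP; ring.
Qed.

(** The integrand splits into the change of [phi] between the two posteriors, weighted by [lik], and
    the change of [lik] itself. By [bayes_stability] the former contributes rho and 2K times the
    integral of [D], the latter another 2K, whence 4K. *)
Lemma bayes_op_lipschitz l phi : 0 <= l -> simplex_measurable phi ->
  simplex_lipschitz l phi ->
  simplex_lipschitz ((rho + 4 * K%:R * \int[leb]_y D y) * l) (bayes_op G L phi).
Proof.
move=> l0 mphi lphi x x' xs xs'.
have [B phiB] := simplex_lipschitz_bounded l0 lphi.
pose p := L^T *m x; pose p' := L^T *m x'.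
have ps : in_simplex p by exact: simplex_trmulmx.
have ps' : in_simplex p' by exact: simplex_trmulmx.
have ip := bayes_integrand_integrable G_lik mphi phiB ps.
have ip' := bayes_integrand_integrable G_lik mphi phiB ps'.
(* Both predictive densities integrate to 1, so subtracting [c] times their difference leaves the
   integral unchanged; it replaces the size of [phi] by its oscillation, which the Lipschitz
   constant bounds. *)
pose c := phi p'.
pose f y := phi (bayes G p y) * lik G p y - phi (bayes G p' y) * lik G p' y.
pose k y := c * (lik G p y - lik G p' y).
have il := lik_integrable G_lik p; have il' := lik_integrable G_lik p'.
have if_ : leb.-integrable setT (EFin \o f) by exact: integrableBr.
have ik : leb.-integrable setT (EFin \o k).
  by apply: integrableZlr; exact: integrableBr.
have -> : bayes_op G L phi x - bayes_op G L phi x' = \int[leb]_y (f y - k y).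
  rewrite RintegralB// /k RintegralZl//; last exact: integrableBr.
  by rewrite RintegralB// !Rintegral_lik// subrr mulr0 subr0 RintegralB.
pose F y := l * (N (p - p') * g y + 4 * K%:R * l1norm (p - p') * D y).
have iF : leb.-integrable setT (EFin \o F).
  by apply: integrableZlr; apply: integrableDr; apply: integrableZlr.
have fF y : `|f y - k y| <= F y.
  have bs := bayes_simplex G_lik y ps; have bs' := bayes_simplex G_lik y ps'.
  have -> : f y - k y = (phi (bayes G p y) - phi (bayes G p' y)) * lik G p y +
      (phi (bayes G p' y) - c) * (lik G p y - lik G p' y).
    by rewrite /f /k; ring.
  apply: (le_trans (ler_normD _ _)); rewrite !normrM.
  have -> : F y = l * (g y * N (p - p') + K%:R * (2 * D y * l1norm (p - p'))) +
      l * (K%:R * 2) * (D y * l1norm (p - p')) by rewrite /F; ring.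
  apply: lerD.
    apply: (@le_trans _ _ (l * N (bayes G p y - bayes G p' y) * `|lik G p y|)).
      by apply: ler_wpM2r => //; exact: lphi.
    rewrite -mulrA ler_wpM2l// mulrC -orbit_normZ.
    exact: bayes_stability.
  apply: ler_pM => //; last exact: likB_le.
  apply: (le_trans (lphi _ _ bs' ps')); rewrite ler_wpM2l//.
  apply: (le_trans (orbit_norm_le L_stoch _ _)); rewrite ler_wpM2l//.
  exact: l1norm_simplexB.
have mf : measurable_fun setT (fun y => f y - k y).
  have := integrableBr if_ ik.
  by move=> /measurable_int /measurable_EFinP.
apply: le_trans; first by apply: (le_normr_Rintegral_dominated _ _ iF).
rewrite /F RintegralZl//; last by apply: integrableDr; apply: integrableZlr.
rewrite RintegralD ?RintegralZl//; [|exact: integrableZlr..].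
rewrite g_int1 mulr1 [X in _ <= X * _]mulrC -[leRHS]mulrA ler_wpM2l// [leRHS]mulrDl.
have z := zero_sum_simplexB xs xs'.
have ppE : p - p' = L^T *m (x - x') by rewrite mulmxBr.
apply: lerD; first by rewrite ppE; exact: contr.
rewrite -!mulrA ler_wpM2l// ler_wpM2l// mulrC ler_wpM2l//.
  exact: Rintegral_ge0.
rewrite ppE; apply: (le_trans (l1norm_trmulmx L_stoch _)); exact: l1N.
Qed.

End Contraction.
End Lipschitz.

(** * Bounds for quadratic functions and covariance vectors on the simplex *)

Section QuadraticFunctions.
Context {R : realType} {d : nat}.
Implicit Types (x y h : 'cV[R]_d) (M : 'M[R]_d).

Definition mx_abs_sum M : R := \sum_i \sum_j `|M i j|.

Lemma mx_abs_sum_ge0 M : 0 <= mx_abs_sum M.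
Proof. by apply: sumr_ge0 => i _; apply: sumr_ge0. Qed.

Lemma quadfB_le M x y B e : (forall i, `|x i 0| <= B) -> (forall i, `|y i 0| <= B) ->
  (forall i, `|x i 0 - y i 0| <= e) ->
  `|quadf M x - quadf M y| <= mx_abs_sum M * (2 * B * e).
Proof.
move=> xB yB xye; rewrite !quadf_sum -sumrB; apply: (le_trans (ler_norm_sum _ _ _)).
rewrite mulr_suml; apply: ler_sum => i _; rewrite -sumrB.
apply: (le_trans (ler_norm_sum _ _ _)); rewrite mulr_suml; apply: ler_sum => j _.
rewrite -mulrBr normrM ler_wpM2l//.
have -> : x i 0 * x j 0 - y i 0 * y j 0 =
    x i 0 * (x j 0 - y j 0) + (x i 0 - y i 0) * y j 0 by ring.
apply: (le_trans (ler_normD _ _)); rewrite !normrM.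
rewrite -mulrA mulr_natl mulr2n; apply: lerD; first exact: ler_pM.
by rewrite mulrC; exact: ler_pM.
Qed.

Lemma quadf_le M x B : (forall i, `|x i 0| <= B) -> `|quadf M x| <= mx_abs_sum M * B ^+ 2.
Proof.
move=> xB; rewrite quadf_sum; apply: (le_trans (ler_norm_sum _ _ _)).
rewrite mulr_suml; apply: ler_sum => i _; apply: (le_trans (ler_norm_sum _ _ _)).
rewrite mulr_suml; apply: ler_sum => j _.
by rewrite normrM ler_wpM2l// normrM expr2 ler_pM.
Qed.

Lemma simplex_entry_le1 x i : in_simplex x -> `|x i 0| <= 1.
Proof. by move=> xs; rewrite ger0_norm ?simplex_le1//; case: xs. Qed.

Lemma quadf_simplex_le M x : in_simplex x -> `|quadf M x| <= mx_abs_sum M.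
Proof.
move=> xs; have := @quadf_le M x 1 (fun i => simplex_entry_le1 i xs).
by rewrite expr1n mulr1.
Qed.

Lemma entryB_le_l1norm x y i : `|x i 0 - y i 0| <= l1norm (x - y).
Proof. by have := entry_le_l1norm (x - y) i; rewrite !mxE. Qed.

Lemma quadf_simplex_lipschitz (L : 'M[R]_d) K M :
  simplex_lipschitz L K.+1 (mx_abs_sum M * 2) (quadf M).
Proof.
move=> x y xs ys.
apply: (@le_trans _ _ (mx_abs_sum M * (2 * 1 * l1norm (x - y)))).
  apply: quadfB_le => i; [exact: simplex_entry_le1..|exact: entryB_le_l1norm].
rewrite mulr1 mulrA ler_wpM2l ?mulr_ge0 ?mx_abs_sum_ge0//.
exact: l1norm_le_orbit_norm.
Qed.

Lemma simplex_measurable_dotv (b : 'cV[R]_d) : simplex_measurable (dotv b).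
Proof.
move=> d' S u mu _; apply: measurable_sum => i.
by apply: measurable_funM => //; exact: measurable_cst.
Qed.

Lemma simplex_measurable_quadf M : simplex_measurable (quadf M).
Proof.
move=> d' S u mu _; under eq_fun do rewrite quadf_sum.
apply: measurable_sum => i; apply: measurable_sum => j.
apply: measurable_funM; first exact: measurable_cst.
exact: measurable_funM.
Qed.

Variables (h : 'cV[R]_d) (H : R).
Hypothesis hH : forall i, `|h i 0| <= H.

Lemma dotv_simplex_le x : in_simplex x -> `|dotv h x| <= H.
Proof.
move=> [x0 x1]; apply: (le_trans (ler_norm_sum _ _ _)).
rewrite -[H]mulr1 -x1 mulr_sumr; apply: ler_sum => i _.
by rewrite normrM (ger0_norm (x0 i)) ler_wpM2r.
Qed.

Lemma dotvB_le x y : `|dotv h x - dotv h y| <= H * l1norm (x - y).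
Proof.
rewrite -dotvBr; apply: (le_trans (ler_norm_sum _ _ _)).
by rewrite mulr_sumr; apply: ler_sum => i _; rewrite normrM ler_wpM2r.
Qed.

Lemma cov_vec_le x i : in_simplex x -> `|cov_vec x h i 0| <= 2 * H.
Proof.
move=> xs; rewrite mxE normrM -[leRHS]mul1r; apply: ler_pM => //.
  exact: simplex_entry_le1.
apply: (le_trans (ler_normB _ _)); rewrite mulr_natl mulr2n.
by apply: lerD => //; exact: dotv_simplex_le.
Qed.

Lemma cov_vecB_le x y i : in_simplex x -> in_simplex y ->
  `|cov_vec x h i 0 - cov_vec y h i 0| <= 3 * H * l1norm (x - y).
Proof.
move=> xs ys; rewrite !mxE.
have -> : x i 0 * (h i 0 - dotv h x) - y i 0 * (h i 0 - dotv h y) =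
  (x i 0 - y i 0) * (h i 0 - dotv h x) - y i 0 * (dotv h x - dotv h y) by ring.
apply: (le_trans (ler_normB _ _)); rewrite !normrM.
rewrite (_ : 3 * H * _ = l1norm (x - y) * (H + H) + 1 * (H * l1norm (x - y))); last by ring.
apply: lerD; apply: ler_pM => //.
- exact: entryB_le_l1norm.
- by apply: (le_trans (ler_normB _ _)); apply: lerD => //; exact: dotv_simplex_le.
- exact: simplex_entry_le1.
- exact: dotvB_le.
Qed.

Lemma quadf_cov_vecB_le M x y : in_simplex x -> in_simplex y ->
  `|quadf M (cov_vec x h) - quadf M (cov_vec y h)| <=
  mx_abs_sum M * (12 * H ^+ 2) * l1norm (x - y).
Proof.
move=> xs ys; rewrite [leRHS](_ : _ =
  mx_abs_sum M * (2 * (2 * H) * (3 * H * l1norm (x - y)))); last by ring.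
apply: quadfB_le => i; [exact: cov_vec_le..|exact: cov_vecB_le].
Qed.

End QuadraticFunctions.

Section BayesMeasurable.
Context {R : realType} {d : nat}.
Notation leb := (@lebesgue_measure R).
Variables (G : 'I_d -> R -> R) (L : 'M[R]_d).
Hypothesis G_lik : is_lik G.
Hypothesis L_stoch : is_stochastic L.

(** The integral over the observation is a section integral on a product space, measurable by
    Tonelli; hence the sign condition, lifted later by adding a constant to [phi]. *)
Lemma simplex_measurable_bayes_op phi : simplex_measurable phi ->
  (forall x, in_simplex x -> 0 <= phi x) -> simplex_measurable (bayes_op G L phi).
Proof.
move=> mphi phi0 d' S u mu us.
have [mG G0 _] := G_lik.
pose p s := L^T *m u s.
have ps s : in_simplex (p s) by exact: simplex_trmulmx.
have mp i : measurable_fun setT (fun s => p s i 0).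
  under eq_fun do rewrite mxE; apply: measurable_sum => j.
  by apply: measurable_funM => //; exact: measurable_cst.
have mp1 i : measurable_fun setT (fun z : S * R => p z.1 i 0).
  exact: (measurableT_comp (mp i) measurable_fst).
have mG2 i : measurable_fun setT (fun z : S * R => G i z.2).
  exact: (measurableT_comp (mG i) measurable_snd).
have mK : measurable_fun setT (fun z : S * R => lik G (p z.1) z.2).
  by apply: measurable_sum => i; exact: measurable_funM.
have mb i : measurable_fun setT (fun z : S * R => bayes G (p z.1) z.2 i 0).
  under eq_fun do rewrite mxE; apply: measurable_funM; first exact: measurable_funM.
  by apply: measurable_inv_gt0 => // z; exact: lik_gt0.
have mf : measurable_fun setT (fun z : S * R =>
    (phi (bayes G (p z.1) z.2) * lik G (p z.1) z.2)%:E).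
  apply/measurable_EFinP; apply: measurable_funM => //; apply: mphi => // z.
  exact: bayes_simplex.
have f0 (z : S * R) : (0 <= (phi (bayes G (p z.1) z.2) * lik G (p z.1) z.2)%:E)%E.
  rewrite lee_fin; apply: mulr_ge0; last exact/ltW/lik_gt0.
  by apply: phi0; exact: bayes_simplex.
have mF := @measurable_fun_fubini_tonelli_F _ _ S _ R leb _ mf f0.
exact: (measurableT_comp (fine_measurable measurableT) mF).
Qed.

End BayesMeasurable.

(** * Expansion for a weak signal *)

Section Signal.
Context {R : realType} {d : nat}.
Notation leb := (@lebesgue_measure R).
Variables (g : R -> R) (delta : R).
Hypothesis g_regular : noise_regularity g.
Hypothesis g_ge0 : forall x, 0 <= g x.
Hypothesis g_int1 : (\int[leb]_x (g x)%:E = 1)%E.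
Hypothesis delta_gt0 : 0 < delta.

Let w := min_near delta g.
Let M := max_abs_near delta (derive1 (derive1 g)).

Hypothesis score_energy : (\int[leb]_x ((derive1 g x / w x) ^+ 2 * g x)%:E < +oo)%E.
Hypothesis curvature_energy : (\int[leb]_x ((M x / w x) ^+ 2 * g x)%:E < +oo)%E.

Variables (hv : 'cV[R]_d) (H : R).
Hypothesis H_ge1 : 1 <= H.
Hypothesis hvH : forall i, `|hv i 0| <= H.

Let g_gt0 := density_gt0 g_regular g_ge0.
Let w_gt0 := min_near_gt0 g_regular g_ge0 delta_gt0.
Let mg := measurable_density g_regular.
Let mg1 := measurable_derive1_density g_regular.
Let mw := measurable_min_near g_regular g_ge0 delta_gt0.
Let wg : forall x, w x <= g x := min_near_le_density g_ge0 delta_gt0.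

(* [eps] is 1 / sigma: the observations are rescaled to [xi n + eps * h (X n)]. *)
Definition signal_lik (eps : R) (i : 'I_d) (y : R) : R := g (y - eps * hv i 0).

(* The Taylor remainder itself stands in for the supremum of |g''| over a window,
   whose measurability is not clear since g'' need not be continuous. *)
Definition lik_rem (eps y : R) : R :=
  \sum_i `|signal_lik eps i y - g y + eps * hv i 0 * derive1 g y| / eps ^+ 2.

(** For small eps, eps times this function bounds the deviation of every likelihood from [g]; it is
    the [D] of the contraction estimate. *)
Definition lik_dom (eps y : R) : R := H * `|derive1 g y| + lik_rem eps y.

(** The last bound keeps every shift eps h_i inside the window of radius delta; eps <= 1 lets higher
    powers of eps be absorbed into lower ones. *)
Definition small_noise_ratio (eps : R) : Prop :=
  [/\ 0 < eps, eps <= 1 & eps * H <= delta].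

Lemma measurable_signal_lik eps i : measurable_fun setT (signal_lik eps i).
Proof.
apply: (measurableT_comp mg); apply: measurable_funB => //; exact: measurable_cst.
Qed.

Lemma signal_lik_gt0 eps i y : 0 < signal_lik eps i y.
Proof. exact: g_gt0. Qed.

Lemma signal_lik_int1 eps i : (\int[leb]_y (signal_lik eps i y)%:E = 1)%E.
Proof.
rewrite -g_int1 -(@ge0_integral_shift _ (eps * hv i 0) (EFin \o g))//.
exact/measurable_EFinP.
Qed.

Lemma density_integrable : leb.-integrable setT (EFin \o g).
Proof. by apply: ge0_integrable => //; rewrite g_int1 ltry. Qed.

Lemma Rintegral_density : \int[leb]_y g y = 1.
Proof. by rewrite /Rintegral g_int1. Qed.

Lemma measurable_lik_rem eps : measurable_fun setT (lik_rem eps).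
Proof.
apply: measurable_sum => i; apply: measurable_funM; last exact: measurable_cst.
apply: measurableT_comp => //; apply: measurable_funD.
  by apply: measurable_funB => //; exact: measurable_signal_lik.
by apply: measurable_funM => //; exact: measurable_cst.
Qed.

Lemma lik_rem_ge0 eps y : 0 <= lik_rem eps y.
Proof. by apply: sumr_ge0 => i _; rewrite divr_ge0// sqr_ge0. Qed.

Lemma lik_dom_ge0 eps y : 0 <= lik_dom eps y.
Proof. by rewrite addr_ge0 ?lik_rem_ge0// mulr_ge0// (le_trans _ H_ge1). Qed.

Lemma measurable_lik_dom eps : measurable_fun setT (lik_dom eps).
Proof.
apply: measurable_funD; last exact: measurable_lik_rem.
apply: measurable_funM; first exact: measurable_cst.
exact: measurableT_comp.
Qed.

Section SmallRatio.
Variable eps : R.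
Hypothesis eps_small : small_noise_ratio eps.

Lemma signal_shift_le i : `|eps * hv i 0| <= delta.
Proof.
case: eps_small => e0 _; apply: le_trans.
by rewrite normrM gtr0_norm// ler_wpM2l// ltW.
Qed.

Lemma min_near_le_signal_lik i y : w y <= signal_lik eps i y.
Proof. by apply: min_near_le => //; rewrite normrN signal_shift_le. Qed.

(** [d.+1] in place of the number [d] of summands makes the constant positive, since it serves as a
    divisor in [lik_energy_bounded]. *)
Lemma lik_rem_le y : lik_rem eps y <= d.+1%:R * H ^+ 2 * M y.
Proof.
have M0 := max_abs_near_ge0 g_regular delta_gt0 y.
apply: (@le_trans _ _ (\sum_(i < d) H ^+ 2 * M y)).
  case: eps_small => e0 _ _.
  apply: ler_sum => i _; rewrite ler_pdivrMr ?exprn_gt0//.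
  apply: (le_trans (density_taylor g_regular y (signal_shift_le i))).
  have hH : hv i 0 ^+ 2 <= H ^+ 2.
    by rewrite -real_normK ?num_real// lerXn2r ?nnegrE// (le_trans _ H_ge1).
  rewrite [leLHS](_ : _ = hv i 0 ^+ 2 * (M y * eps ^+ 2)); last by rewrite /M; ring.
  by rewrite -[leRHS]mulrA; apply: ler_wpM2r => //; rewrite mulr_ge0 ?sqr_ge0.
rewrite sumr_const card_ord -[leLHS]mulr_natl -[leRHS]mulrA.
by rewrite ler_wpM2r ?ler_nat// mulr_ge0// sqr_ge0.
Qed.

Lemma signal_lik_expansion i y :
  `|signal_lik eps i y - g y + eps * hv i 0 * derive1 g y| <= eps ^+ 2 * lik_rem eps y.
Proof.
case: eps_small => e0 _ _; rewrite /lik_rem mulr_sumr.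
under eq_bigr do rewrite mulrC divfK ?gt_eqF ?exprn_gt0//.
by rewrite (bigD1 i)//= lerDl sumr_ge0.
Qed.

Lemma signal_likB_le i y : `|signal_lik eps i y - g y| <= eps * lik_dom eps y.
Proof.
have := signal_lik_expansion i y; case: eps_small => e0 e1 _ h.
rewrite -[_ - g y](addrK (eps * hv i 0 * derive1 g y)).
apply: (le_trans (ler_normB _ _)).
rewrite addrC /lik_dom mulrDr; apply: lerD.
  rewrite !normrM gtr0_norm// -mulrA ler_wpM2l ?(ltW e0)// ler_wpM2r//.
apply: (le_trans h); rewrite expr2 -mulrA ler_piMl//.
by rewrite mulr_ge0 ?lik_rem_ge0// ltW.
Qed.

End SmallRatio.

(** This one integrand controls both the integral of [lik_dom] and the square of [lik_dom] divided
    by the predictive density, which is at least [w]. *)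
Definition lik_energy (eps y : R) : R := (lik_dom eps y / w y) ^+ 2 * g y.

Lemma measurable_lik_energy eps : measurable_fun setT (lik_energy eps).
Proof.
apply: measurable_funM => //; apply: measurable_funX.
apply: measurable_funM; first exact: measurable_lik_dom.
exact: measurable_inv_gt0.
Qed.

Lemma lik_energy_ge0 eps y : 0 <= lik_energy eps y.
Proof. by rewrite mulr_ge0// sqr_ge0. Qed.

Lemma score_energy_integrable :
  leb.-integrable setT (EFin \o (fun x => (derive1 g x / w x) ^+ 2 * g x)).
Proof.
apply: ge0_integrable => //; last by move=> x; rewrite mulr_ge0 ?sqr_ge0.
apply: measurable_funM => //; apply: measurable_funX.
by apply: measurable_funM => //; exact: measurable_inv_gt0.
Qed.

(** The square of the sum in [lik_dom] is at most twice the sum of the squares. The score part is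
    the first integrability condition, the remainder part is dominated by the second, and neither
    bound involves eps. *)
Lemma lik_energy_bounded :
  exists2 C, 0 <= C & forall eps, small_noise_ratio eps ->
    leb.-integrable setT (EFin \o lik_energy eps) /\
    \int[leb]_y lik_energy eps y <= C.
Proof.
pose A := fine (\int[leb]_x ((derive1 g x / w x) ^+ 2 * g x)%:E)%E.
pose B := fine (\int[leb]_x ((M x / w x) ^+ 2 * g x)%:E)%E.
pose c := d.+1%:R * H ^+ 2.
have c0 : 0 < c by rewrite mulr_gt0// exprn_gt0// (lt_le_trans _ H_ge1).
have A0 : 0 <= A.
  by apply: Rintegral_ge0 => x _; rewrite mulr_ge0 ?sqr_ge0.
have B0 : 0 <= B.
  by apply: Rintegral_ge0 => x _; rewrite mulr_ge0 ?sqr_ge0.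
exists (2 * H ^+ 2 * A + 2 * c ^+ 2 * B).
  by rewrite addr_ge0// mulr_ge0// mulr_ge0// sqr_ge0.
move=> eps es.
(* Division by [c] brings [lik_rem] below the window supremum. [q] is itself measurable, so the
   supremum is met only in a comparison of integrals. *)
pose q y := (lik_rem eps y / c / w y) ^+ 2 * g y.
have q0 y : 0 <= q y by rewrite mulr_ge0// sqr_ge0.
have mq : measurable_fun setT q.
  apply: measurable_funM => //; apply: measurable_funX.
  apply: measurable_funM; last exact: measurable_inv_gt0.
  by apply: measurable_funM; [exact: measurable_lik_rem|exact: measurable_cst].
have qB : (\int[leb]_y (q y)%:E <= \int[leb]_x ((M x / w x) ^+ 2 * g x)%:E)%E.
  apply: ge0_le_integral_lower => y; first by rewrite lee_fin.
  rewrite lee_fin ler_wpM2r// lerXn2r ?nnegrE ?divr_ge0 ?lik_rem_ge0 ?(ltW c0) ?(ltW (w_gt0 y))//.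
    exact: max_abs_near_ge0.
  rewrite ler_wpM2r ?invr_ge0 ?(ltW (w_gt0 y))// ler_pdivrMr// mulrC.
  exact: lik_rem_le.
have iq : leb.-integrable setT (EFin \o q).
  by apply: ge0_integrable => //; exact: le_lt_trans qB curvature_energy.
have iqB : \int[leb]_y q y <= B.
  apply: fine_le => //; first exact: integrable_fin_num iq.
  by rewrite ge0_fin_numE ?curvature_energy// integral_ge0// => x _;
     rewrite lee_fin mulr_ge0 ?sqr_ge0.
pose F y := 2 * H ^+ 2 * ((derive1 g y / w y) ^+ 2 * g y) + 2 * c ^+ 2 * q y.
have iF : leb.-integrable setT (EFin \o F).
  by apply: integrableDr; apply: integrableZlr => //; exact: score_energy_integrable.
have EF y : lik_energy eps y <= F y.
  pose a := H * `|derive1 g y| / w y; pose b := lik_rem eps y / w y.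
  have -> : F y = (2 * a ^+ 2 + 2 * b ^+ 2) * g y.
    have key (c' u s r h G : R) : c' != 0 -> u != 0 ->
        2 * h ^+ 2 * ((s / u) ^+ 2 * G) + 2 * c' ^+ 2 * ((r / c' / u) ^+ 2 * G) =
        (2 * (h * `|s| / u) ^+ 2 + 2 * (r / u) ^+ 2) * G.
      move=> c'0 u0; rewrite !expr_div_n exprMn real_normK ?num_real//.
      by field; rewrite c'0 u0.
    by apply: key; rewrite gt_eqF.
  rewrite /lik_energy /lik_dom ler_wpM2r// mulrDl -/a -/b.
  by have := sqr_ge0 (a - b); nra.
have nE y : `|lik_energy eps y| <= F y by rewrite ger0_norm ?lik_energy_ge0.
have iE : leb.-integrable setT (EFin \o lik_energy eps).
  by apply: (integrable_dominated _ _ iF) => //; exact: measurable_lik_energy.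
split => //; apply: (le_trans (le_Rintegral _ iE iF (fun y _ => EF y))) => //.
rewrite RintegralD ?RintegralZl//; last 3 first.
- exact: score_energy_integrable.
- by apply: integrableZlr; exact: score_energy_integrable.
- exact: integrableZlr.
by rewrite lerD2l ler_wpM2l// mulr_ge0// sqr_ge0.
Qed.

(** With q = [lik_dom] / w, this combines q <= 1 + q^2 with w <= g. *)
Lemma lik_dom_le eps y : lik_dom eps y <= g y + lik_energy eps y.
Proof.
rewrite /lik_energy; set q := lik_dom eps y / w y.
have q0 : 0 <= q by rewrite divr_ge0 ?lik_dom_ge0// ltW.
have -> : lik_dom eps y = q * w y by rewrite /q divfK// gt_eqF.
have qq : q <= 1 + q ^+ 2 by have := sqr_ge0 (q - 1); nra.
have -> : g y + q ^+ 2 * g y = (1 + q ^+ 2) * g y by ring.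
by apply: ler_pM => //; exact: ltW.
Qed.

Lemma lik_dom_sqr_le eps y : lik_dom eps y ^+ 2 / w y <= lik_energy eps y.
Proof.
rewrite /lik_energy expr_div_n -[leRHS]mulrA; apply: ler_wpM2l; first exact: sqr_ge0.
rewrite [leRHS]mulrC ler_pdivlMr ?exprn_gt0// expr2 mulrA mulVf ?gt_eqF// mul1r.
exact: wg.
Qed.

Lemma lik_dom_integrable eps : leb.-integrable setT (EFin \o lik_energy eps) ->
  leb.-integrable setT (EFin \o lik_dom eps).
Proof.
move=> iE; have iF := integrableDr density_integrable iE.
apply: (integrable_dominated _ _ iF); first exact: measurable_lik_dom.
by move=> y; rewrite ger0_norm ?lik_dom_ge0// lik_dom_le.
Qed.

Lemma Rintegral_lik_dom_le eps : leb.-integrable setT (EFin \o lik_energy eps) ->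
  \int[leb]_y lik_dom eps y <= 1 + \int[leb]_y lik_energy eps y.
Proof.
move=> iE; rewrite -Rintegral_density -RintegralD//; last exact: density_integrable.
apply: le_Rintegral => //; first exact: lik_dom_integrable.
- by apply: integrableDr => //; exact: density_integrable.
- by move=> y _; exact: lik_dom_le.
Qed.

Lemma fisher_information_integrable :
  leb.-integrable setT (EFin \o (fun x => derive1 g x ^+ 2 / g x)).
Proof.
apply: (integrable_dominated _ _ score_energy_integrable).
  apply: measurable_funM; first exact: measurable_funX.
  exact: measurable_inv_gt0.
move=> x; rewrite ger0_norm; first exact: fisher_le.
by rewrite divr_ge0// sqr_ge0.
Qed.

Lemma fisher_information_lty : (fisher_information g < +oo)%E.
Proof.
exact: integrable_lty measurableT _ fisher_information_integrable.
Qed.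

Lemma signal_lik_is_lik eps : is_lik (signal_lik eps).
Proof.
split; first exact: measurable_signal_lik.
- exact: signal_lik_gt0.
- exact: signal_lik_int1.
Qed.

Lemma min_near_le_lik eps p y : small_noise_ratio eps -> in_simplex p ->
  w y <= lik (signal_lik eps) p y.
Proof.
move=> es [p0 p1]; rewrite -[w y]mul1r -p1 mulr_suml.
by apply: ler_sum => i _; rewrite ler_wpM2l ?p0 ?min_near_le_signal_lik.
Qed.

(* Bounds the error of replacing the predictive density by [g] in the Fisher
   information integrand; the minimum makes it both dominated and pointwise
   vanishing as [eps] tends to 0. *)
Definition lik_gap (eps y : R) : R :=
  derive1 g y ^+ 2 *
  Num.min (2 / w y) ((\sum_i `|signal_lik eps i y - g y|) / (w y * g y)).

Lemma lik_gap_ge0 eps y : 0 <= lik_gap eps y.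
Proof.
rewrite mulr_ge0 ?sqr_ge0// le_min !divr_ge0 ?sumr_ge0 ?(ltW (w_gt0 y))//.
by rewrite mulr_ge0// ltW.
Qed.

Lemma measurable_lik_gap eps : measurable_fun setT (lik_gap eps).
Proof.
apply: measurable_funM; first exact: measurable_funX.
apply: measurable_minr.
  apply: measurable_funM; first exact: measurable_cst.
  exact: measurable_inv_gt0.
apply: measurable_funM.
  apply: measurable_sum => i; apply: measurableT_comp => //.
  by apply: measurable_funB => //; exact: measurable_signal_lik.
apply: measurable_inv_gt0; first exact: measurable_funM.
by move=> y; rewrite mulr_gt0.
Qed.

Lemma lik_gap_le eps y : lik_gap eps y <= 2 * ((derive1 g y / w y) ^+ 2 * g y).
Proof.
apply: (@le_trans _ _ (derive1 g y ^+ 2 * (2 / w y))).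
  by rewrite ler_wpM2l ?sqr_ge0// ge_min lexx.
rewrite mulrCA ler_wpM2l// expr_div_n -[leRHS]mulrA ler_wpM2l ?sqr_ge0//.
rewrite [leRHS]mulrC ler_pdivlMr ?exprn_gt0// expr2 mulrA mulVf ?gt_eqF// mul1r.
exact: wg.
Qed.

Lemma lik_gap_integrable eps : leb.-integrable setT (EFin \o lik_gap eps).
Proof.
apply: (integrable_dominated _ _ (integrableZlr 2 score_energy_integrable)).
  exact: measurable_lik_gap.
by move=> y; rewrite ger0_norm ?lik_gap_ge0 ?lik_gap_le.
Qed.

(** Dominated convergence along sequences: [lik_gap_le] provides the majorant, continuity of [g] the
    pointwise limit. *)
Lemma lik_gap_cvg : (\int[leb]_y lik_gap eps y) @[eps --> 0^'+] --> (0 : R).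
Proof.
apply/cvg_at_rightP => u [u0 ucvg].
suff h : (\int[leb]_y (lik_gap (u n) y)%:E)%E @[n --> \oo] -->
    (\int[leb]_y (cst 0 y : \bar R))%E.
  by rewrite integral0 in h; exact: fine_cvg h.
have gc (z : R) i : signal_lik (u n) i z @[n --> \oo] --> g z.
  have zc : z - u n * hv i 0 @[n --> \oo] --> z.
    rewrite -[X in _ --> X]subr0; apply: cvgB; first exact: cvg_cst.
    rewrite -[X in _ --> X](mul0r (hv i 0)).
    by apply: cvgM; [exact: ucvg|exact: cvg_cst].
  apply: (@cvg_comp _ _ _ (fun n => z - u n * hv i 0) g _ (nbhs z) _ zc).
  exact: density_continuous.
have ig := integrableZlr 2 score_energy_integrable.
apply: (dominated_cvg measurableT _ _ _ ig) => //.
- by move=> n; apply/measurable_EFinP; exact: measurable_lik_gap.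
- move=> y _; apply: cvg_EFin; first exact: nearW.
  rewrite /comp /=.

  have s0 : (\sum_i `|signal_lik (u n) i y - g y|) @[n --> \oo] --> (0 : R).
    rewrite [X in _ --> X](_ : 0 = \sum_(i < d) `|g y - g y|); last first.
      by rewrite big1// => i _; rewrite subrr normr0.
    apply: cvg_sumr => i; apply: cvg_norm.
    by apply: cvgB; [exact: gc|exact: cvg_cst].
  apply: (@squeeze_cvgr _ _ _ _ (fun=> 0) (fun n => derive1 g y ^+ 2 *
    ((\sum_i `|signal_lik (u n) i y - g y|) / (w y * g y)))).
  + apply: nearW => n; rewrite lik_gap_ge0 /= ler_wpM2l ?sqr_ge0//.
    by rewrite ge_min lexx orbT.
  + exact: cvg_cst.
  + rewrite -[X in _ --> X](mulr0 (derive1 g y ^+ 2)).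
    apply: cvgM; first exact: cvg_cst.
    rewrite -[X in _ --> X](mul0r (w y * g y)^-1).
    by apply: cvgM; [exact: s0|exact: cvg_cst].
- by move=> n y _; rewrite lee_fin ger0_norm ?lik_gap_ge0 ?lik_gap_le.
Qed.

Definition fisher : R := \int[leb]_x (derive1 g x ^+ 2 / g x).

(** The second-order part of a product of two posterior entries: with K the predictive density, G_i
    G_j / K = [lik_coef] + (G_i - K) + (G_j - K) + K. *)
Definition lik_coef eps p i j y : R :=
  (signal_lik eps i y - lik (signal_lik eps) p y) *
  (signal_lik eps j y - lik (signal_lik eps) p y) / lik (signal_lik eps) p y.

(** With K the predictive density, G_k - K = -eps al_k + rho_k, where al_k is the centred signal
    times g' and rho_k is of order eps^2. The main term of the product is eps^2 al_i al_j / K. The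
    three terms containing some rho are each at most 4 eps^3 times the square of [lik_dom], which
    gives 12; replacing 1/K by 1/g gives the gap term, with 4 H^2 from the two centred signals. *)
Lemma lik_coef_le eps p i j y : small_noise_ratio eps -> in_simplex p ->
  `|lik_coef eps p i j y - eps ^+ 2 * ((hv i 0 - dotv hv p) * (hv j 0 - dotv hv p)) *
     (derive1 g y ^+ 2 / g y)| <=
  eps ^+ 2 * (12 * eps * lik_energy eps y + 4 * H ^+ 2 * lik_gap eps y).
Proof.
move=> es ps; have [e0 e1 _] := es.
have [p0 p1] := ps.
have D0 := lik_dom_ge0 eps y; have r0 := lik_rem_ge0 eps y.
have wK := min_near_le_lik y es ps.
set K := lik (signal_lik eps) p y in wK *.
have K0 : 0 < K := lt_le_trans (w_gt0 y) wK.
pose al k := (hv k 0 - dotv hv p) * derive1 g y.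
pose e k := signal_lik eps k y - g y + eps * hv k 0 * derive1 g y.
have eB k : `|e k| <= eps ^+ 2 * lik_rem eps y by exact: signal_lik_expansion.
have KE : K - g y = - (eps * dotv hv p * derive1 g y) + \sum_k p k 0 * e k.
  rewrite /e; under eq_bigr do rewrite mulrDr mulrBr.
  rewrite !big_split /= sumrN -mulr_suml p1 mul1r -/K.
  have -> : \sum_k p k 0 * (eps * hv k 0 * derive1 g y) = eps * dotv hv p * derive1 g y.
    by rewrite /dotv mulr_sumr mulr_suml; apply: eq_bigr => k _; ring.
  by rewrite /K /lik; ring.
have sB : `|\sum_k p k 0 * e k| <= eps ^+ 2 * lik_rem eps y.
  apply: (le_trans (ler_norm_sum _ _ _)).
  rewrite -[leRHS]mul1r -p1 mulr_suml; apply: ler_sum => k _.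
  by rewrite normrM (ger0_norm (p0 k)) ler_wpM2l.
pose rho k := e k - \sum_k p k 0 * e k.
have uE k : signal_lik eps k y - K = - eps * al k + rho k.
  have -> : signal_lik eps k y - K = (signal_lik eps k y - g y) - (K - g y) by ring.
  by rewrite KE /rho /al /e; ring.
have rhoB k : `|rho k| <= 2 * eps ^+ 2 * lik_dom eps y.
  apply: (le_trans (ler_normB _ _)).
  rewrite -mulrA mulr_natl mulr2n; apply: lerD.
    apply: (le_trans (eB k)); rewrite ler_wpM2l ?sqr_ge0// /lik_dom lerDr.
    by rewrite mulr_ge0// (le_trans _ H_ge1).
  apply: (le_trans sB); rewrite ler_wpM2l ?sqr_ge0// /lik_dom lerDr.
  by rewrite mulr_ge0// (le_trans _ H_ge1).
have hB k : `|hv k 0 - dotv hv p| <= 2 * H.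
  apply: (le_trans (ler_normB _ _)); rewrite mulr_natl mulr2n.
  by apply: lerD => //; exact: dotv_simplex_le.
have alB k : `|al k| <= 2 * lik_dom eps y.
  rewrite normrM; apply: (@le_trans _ _ (2 * H * `|derive1 g y|)).
    by rewrite ler_wpM2r.
  by rewrite -mulrA ler_wpM2l// /lik_dom lerDl.
have split_coef : lik_coef eps p i j y - eps ^+ 2 *
    ((hv i 0 - dotv hv p) * (hv j 0 - dotv hv p)) * (derive1 g y ^+ 2 / g y) =
    (rho i * rho j - eps * (al i * rho j + al j * rho i)) / K +
    eps ^+ 2 * ((hv i 0 - dotv hv p) * (hv j 0 - dotv hv p)) *
      (derive1 g y ^+ 2 * (K^-1 - (g y)^-1)).
  rewrite /lik_coef -/K !uE /al.
  by field; rewrite !gt_eqF// lt_neqAle.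
rewrite split_coef; apply: (le_trans (ler_normD _ _)).
rewrite [leRHS]mulrDr; apply: lerD.
  rewrite normrM normfV (gtr0_norm K0).
  have num : `|rho i * rho j - eps * (al i * rho j + al j * rho i)| <=
      12 * eps ^+ 3 * lik_dom eps y ^+ 2.
    set a := eps ^+ 2 * lik_dom eps y.
    have a0 : 0 <= a by rewrite mulr_ge0 ?sqr_ge0.
    have h1 : `|rho i * rho j| <= 4 * eps ^+ 3 * lik_dom eps y ^+ 2.
      rewrite normrM; apply: (@le_trans _ _ ((2 * eps ^+ 2 * lik_dom eps y) *
        (2 * eps ^+ 2 * lik_dom eps y))); first exact: ler_pM.
      rewrite [leLHS](_ : _ = eps * (4 * eps ^+ 3 * lik_dom eps y ^+ 2)); last by ring.
      by rewrite ler_piMl// mulr_ge0 ?sqr_ge0// mulr_ge0// exprn_ge0// ltW.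
    have h2 k l : `|al k * rho l| <= 4 * eps ^+ 2 * lik_dom eps y ^+ 2.
      rewrite normrM; apply: (@le_trans _ _ ((2 * lik_dom eps y) *
        (2 * eps ^+ 2 * lik_dom eps y))); first exact: ler_pM.
      by rewrite le_eqVlt; apply/orP; left; apply/eqP; ring.
    apply: (le_trans (ler_normB _ _)).
    rewrite [leRHS](_ : _ = 4 * eps ^+ 3 * lik_dom eps y ^+ 2 +
      eps * (4 * eps ^+ 2 * lik_dom eps y ^+ 2 + 4 * eps ^+ 2 * lik_dom eps y ^+ 2)); last by ring.
    apply: lerD => //; rewrite normrM (gtr0_norm e0) ler_wpM2l ?(ltW e0)//.
    by apply: (le_trans (ler_normD _ _)); apply: lerD.
  apply: (@le_trans _ _ (12 * eps ^+ 3 * lik_dom eps y ^+ 2 / w y)).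
    apply: ler_pM => //; first by rewrite invr_ge0 ltW.
    by rewrite lef_pV2 ?posrE.
  rewrite [leRHS](_ : _ = 12 * eps ^+ 3 * lik_energy eps y); last by ring.
  by rewrite -mulrA ler_wpM2l ?lik_dom_sqr_le// mulr_ge0// exprn_ge0// ltW.
rewrite -mulrA normrM (ger0_norm (sqr_ge0 eps)) ler_wpM2l ?sqr_ge0//.
rewrite normrM; apply: ler_pM => //.
  rewrite normrM [leRHS](_ : _ = 2 * H * (2 * H)); last by ring.
  exact: ler_pM.
rewrite normrM (ger0_norm (sqr_ge0 _)) ler_wpM2l ?sqr_ge0// le_min.
(* The two entries of the minimum: 1/K and 1/g are both at most 1/w, and |g - K| is at most the sum
   of the deviations of the likelihoods. *)
apply/andP; split.
  apply: (le_trans (ler_normB _ _)).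
  rewrite !normfV (gtr0_norm K0) (gtr0_norm (g_gt0 y)) mulr_natl mulr2n.
  by apply: lerD; rewrite lef_pV2 ?posrE//; exact: wg.
have -> : K^-1 - (g y)^-1 = (g y - K) / (K * g y).
  by field; rewrite !gt_eqF.
have Kg0 : 0 < K * g y by rewrite mulr_gt0.
rewrite normrM normfV (gtr0_norm Kg0).
apply: ler_pM => //; first by rewrite invr_ge0 ltW ?mulr_gt0.
  have -> : g y - K = \sum_k p k 0 * (g y - signal_lik eps k y).
    under eq_bigr do rewrite mulrBr.
    by rewrite big_split /= sumrN -mulr_suml p1 mul1r.
  apply: (le_trans (ler_norm_sum _ _ _)); apply: ler_sum => k _.
  rewrite normrM (ger0_norm (p0 k)) distrC ler_piMl//.
  exact: simplex_le1.
by rewrite lef_pV2 ?posrE ?mulr_gt0// ler_wpM2r// ltW.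
Qed.

Lemma measurable_lik_coef eps p i j : in_simplex p ->
  measurable_fun setT (lik_coef eps p i j).
Proof.
move=> ps; have mK := measurable_lik (signal_lik_is_lik eps) p.
apply: measurable_funM.
  by apply: measurable_funM; apply: measurable_funB => //; exact: measurable_signal_lik.
by apply: measurable_inv_gt0 => // y; apply: lik_gt0 => //; exact: signal_lik_is_lik.
Qed.

Lemma Rintegral_lik_coef eps C p i j : small_noise_ratio eps -> in_simplex p ->
  leb.-integrable setT (EFin \o lik_energy eps) ->
  \int[leb]_y lik_energy eps y <= C ->
  leb.-integrable setT (EFin \o lik_coef eps p i j) /\
  `|\int[leb]_y lik_coef eps p i j y -
    eps ^+ 2 * ((hv i 0 - dotv hv p) * (hv j 0 - dotv hv p)) * fisher| <=
  eps ^+ 2 * (12 * eps * C + 4 * H ^+ 2 * \int[leb]_y lik_gap eps y).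
Proof.
move=> es ps iE EC; have [e0 _ _] := es.
pose c := eps ^+ 2 * ((hv i 0 - dotv hv p) * (hv j 0 - dotv hv p)).
pose F y := eps ^+ 2 * (12 * eps * lik_energy eps y + 4 * H ^+ 2 * lik_gap eps y).
have iG := lik_gap_integrable eps; have iI := fisher_information_integrable.
have i1 := integrableZlr (12 * eps) iE; have i2 := integrableZlr (4 * H ^+ 2) iG.
have i3 := integrableDr i1 i2; have iF := integrableZlr (eps ^+ 2) i3.
have mc := measurable_lik_coef eps i j ps.
pose r y := lik_coef eps p i j y - c * (derive1 g y ^+ 2 / g y).
have mr : measurable_fun setT r.
  apply: measurable_funB => //; apply: measurable_funM; first exact: measurable_cst.
  by apply: measurable_funM; [exact: measurable_funX|exact: measurable_inv_gt0].
have ir : leb.-integrable setT (EFin \o r).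
  apply: (integrable_dominated _ _ iF) => // y.
  exact: lik_coef_le.
have ic : leb.-integrable setT (EFin \o lik_coef eps p i j).
  have := integrableDr ir (integrableZlr c iI); apply: eq_integrable => // y _ /=.
  by rewrite /r subrK.
split=> //.
have -> : \int[leb]_y lik_coef eps p i j y - c * fisher = \int[leb]_y r y.
  by rewrite /r RintegralB// ?RintegralZl//; exact: integrableZlr.
apply: le_trans; first apply: (le_normr_Rintegral_dominated _ _ iF) => //.
  by move=> y; exact: lik_coef_le.
rewrite RintegralZl// RintegralD// RintegralZl// RintegralZl//.
rewrite ler_wpM2l ?sqr_ge0// lerD2r ler_wpM2l//.
by rewrite mulr_ge0// ltW.
Qed.

(** When G_i G_j / K is expanded around K, the linear terms integrate to zero because likelihoods
    and K are probability densities. What is left is [quadf Q] at the prediction plus the integrals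
    of [lik_coef], whose leading part assembles into the covariance vector. *)
Lemma bayes_op_quadf eps C (L Q : 'M[R]_d) x : is_stochastic L ->
  small_noise_ratio eps -> in_simplex x ->
  leb.-integrable setT (EFin \o lik_energy eps) ->
  \int[leb]_y lik_energy eps y <= C ->
  `|bayes_op (signal_lik eps) L (quadf Q) x - quadf Q (L^T *m x) -
    eps ^+ 2 * (fisher * quadf Q (cov_vec (L^T *m x) hv))| <=
  eps ^+ 2 * ((\sum_i \sum_j `|Q i j|) *
    (12 * eps * C + 4 * H ^+ 2 * \int[leb]_y lik_gap eps y)).
Proof.
move=> L_stoch es xs iE EC.
set p := L^T *m x; have ps : in_simplex p by exact: simplex_trmulmx.
have Gl := signal_lik_is_lik eps.
set E := 12 * eps * C + _.
pose co i j := \int[leb]_y lik_coef eps p i j y.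
have coP i j := @Rintegral_lik_coef eps C p i j es ps iE EC.
have ico i j := (coP i j).1.
pose u i y := signal_lik eps i y - lik (signal_lik eps) p y.
have iG i := is_lik_integrable Gl i.
have iK := lik_integrable Gl p.
have iu i : leb.-integrable setT (EFin \o u i) by exact: integrableBr.
have u0 i : \int[leb]_y u i y = 0.
  by rewrite RintegralB// is_lik_int1// Rintegral_lik// subrr.
pose term i j y := Q i j * (p i 0 * p j 0) *
  (lik_coef eps p i j y + (u i y + (u j y + lik (signal_lik eps) p y))).
have iterm i j : leb.-integrable setT (EFin \o term i j).
  by apply: integrableZlr; do 3 apply: integrableDr => //.
have isum i : leb.-integrable setT (EFin \o (fun y => \sum_j term i j y)).
  by apply: integrable_sumr => j; exact: iterm.
have TE : bayes_op (signal_lik eps) L (quadf Q) x =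
    \sum_i \sum_j Q i j * (p i 0 * p j 0) * (co i j + 1).
  transitivity (\int[leb]_y \sum_i \sum_j term i j y).
    rewrite /bayes_op; apply: eq_Rintegral => y _; rewrite -/p quadf_sum mulr_suml.
    apply: eq_bigr => i _; rewrite mulr_suml; apply: eq_bigr => j _.
    have K0 := lik_gt0 Gl y ps.
    have bE k : bayes (signal_lik eps) p y k 0 =
      p k 0 * signal_lik eps k y / lik (signal_lik eps) p y by rewrite mxE.
    rewrite !bE /term /u /lik_coef; move: (lik _ p y) K0 => K K0.
    by field; rewrite gt_eqF.
  rewrite Rintegral_sum//; apply: eq_bigr => i _.
  rewrite Rintegral_sum//; apply: eq_bigr => j _.
  rewrite RintegralZl//; last by do 3 apply: integrableDr => //.
  congr (_ * _); rewrite RintegralD//; last by do 2 apply: integrableDr => //.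
  rewrite RintegralD//; last by apply: integrableDr.
  by rewrite RintegralD// !u0 !add0r Rintegral_lik.
rewrite TE !quadf_sum !mulr_sumr -!sumrB; apply: (le_trans (ler_norm_sum _ _ _)).
rewrite mulr_suml mulr_sumr; apply: ler_sum => i _.
rewrite !mulr_sumr -!sumrB; apply: (le_trans (ler_norm_sum _ _ _)).
rewrite mulr_suml mulr_sumr; apply: ler_sum => j _.
rewrite [X in `|X|](_ : _ = Q i j * ((p i 0 * p j 0) * (co i j -
  eps ^+ 2 * ((hv i 0 - dotv hv p) * (hv j 0 - dotv hv p)) * fisher))); last first.
  by rewrite ![cov_vec _ _ _ _]mxE; ring.
rewrite normrM [leRHS]mulrCA ler_wpM2l//.
rewrite normrM -[leRHS]mul1r; apply: ler_pM => //; last exact: (coP i j).2.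
have [p0 _] := ps.
rewrite ger0_norm ?mulr_ge0// -[leRHS]mulr1.
by apply: ler_pM => //; exact: simplex_le1.
Qed.

End Signal.

(** * The conditional law of the chain given the observations *)

Section WeightedIntegral.
Context {d0 d1 d2 : measure_display} {U : measurableType d0}
  {S1 : measurableType d1} {S2 : measurableType d2} {R : realType}.

Import HBNNSimple.

(** The values and level sets of the simple approximations depend on [u] alone, so two
    representations with the same [u] can be compared term by term. *)
Local Lemma weighted_integral_approx (dd : measure_display) (S : measurableType dd)
    (m : {measure set S -> \bar R}) (k : S -> R) (f : S -> U) (u : U -> \bar R)
    (mu_ : measurable_fun setT u) :
  measurable_fun setT k -> (forall s, 0 <= k s) -> measurable_fun setT f ->
  (forall x, 0 <= u x)%E ->
  (\int[m]_s ((k s)%:E * u (f s)) = limn (fun n =>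
    \sum_(r \in range (nnsfun_approx measurableT mu_ n))
      r%:E * \int[m]_s (k s * \1_(nnsfun_approx measurableT mu_ n @^-1` [set r]) (f s))%:E))%E.
Proof.
move=> mk k0 mf u0; set u_ := nnsfun_approx measurableT mu_.
transitivity (limn (fun n => \int[m]_s ((k s)%:E * (u_ n (f s))%:E)))%E.
  rewrite -monotone_convergence//.
  - apply: eq_integral => s _; apply/esym/cvg_lim => //.
    apply: cvgeZl => //; apply: (@cvg_nnsfun_approx _ _ _ _ measurableT u mu_) => //.
  - move=> n; apply: emeasurable_funM; first exact/measurable_EFinP.
    by apply/measurable_EFinP; apply: measurableT_comp.
  - by move=> n s _; rewrite mule_ge0 ?lee_fin.
  - move=> s _ p q pq; rewrite lee_wpmul2l ?lee_fin//.
    exact/lefP/nd_nnsfun_approx.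
congr (limn _); apply/funext => n.
have mi (r : R) : measurable_fun setT (fun s => \1_(u_ n @^-1` [set r]) (f s) : R).
  by apply: measurableT_comp => //; exact: measurable_indic.
have mki (r : R) : measurable_fun setT (fun s => (k s * \1_(u_ n @^-1` [set r]) (f s))%:E).
  by apply/measurable_EFinP; exact: measurable_funM.
transitivity (\int[m]_s (\sum_(r \in range (u_ n))
    (r%:E * (k s * \1_(u_ n @^-1` [set r]) (f s))%:E)))%E.
  apply: eq_integral => s _.
  rewrite [in LHS](fimfunE (u_ n)) -fsumEFin// ge0_mule_fsumr; last first.
    move=> r; rewrite lee_fin.
    have [r0|r0] := leP 0 r; first by rewrite mulr_ge0.
    by rewrite preimage_nnfun0// indic0 mulr0.
  apply: eq_fsbigr => r _; rewrite -!EFinM; congr EFin; ring.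
rewrite ge0_integral_fsum//; last 2 first.
- by move=> r; apply: emeasurable_funM => //; exact: measurable_cst.
- move=> r s _; rewrite -EFinM lee_fin.
  have [r0|r0] := leP 0 r; first by rewrite mulr_ge0// mulr_ge0.
  by rewrite preimage_nnfun0// indic0 !mulr0.
apply: eq_fsbigr => r; rewrite inE => -[x _ <-].
rewrite ge0_integralZl//; first by move=> s _; rewrite lee_fin mulr_ge0.
by rewrite lee_fin.
Qed.

Variables (m1 : {measure set S1 -> \bar R}) (m2 : {measure set S2 -> \bar R}).
Variables (k1 : S1 -> R) (k2 : S2 -> R) (f1 : S1 -> U) (f2 : S2 -> U).
Hypothesis mk1 : measurable_fun setT k1.
Hypothesis mk2 : measurable_fun setT k2.
Hypothesis k1_ge0 : forall s, 0 <= k1 s.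
Hypothesis k2_ge0 : forall s, 0 <= k2 s.
Hypothesis mf1 : measurable_fun setT f1.
Hypothesis mf2 : measurable_fun setT f2.
Hypothesis agree : forall A, measurable A ->
  (\int[m1]_s (k1 s * \1_A (f1 s))%:E = \int[m2]_s (k2 s * \1_A (f2 s))%:E)%E.

Lemma weighted_integral_ext (u : U -> \bar R) : measurable_fun setT u ->
  (forall x, 0 <= u x)%E ->
  (\int[m1]_s ((k1 s)%:E * u (f1 s)) = \int[m2]_s ((k2 s)%:E * u (f2 s)))%E.
Proof.
move=> mu u0; rewrite !(@weighted_integral_approx _ _ _ _ _ u mu)//.
congr (limn _); apply/funext => n; apply: eq_fsbigr => r _; congr (_ * _)%E.
by apply: agree; exact: measurable_funPTI.
Qed.

End WeightedIntegral.

Lemma measure_partition {dd : measure_display} {T : measurableType dd} {R : realType}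
    (m : {measure set T -> \bar R}) (I : finType) (A : I -> set T) (E : set T) :
  measurable E -> (forall i, measurable (A i)) ->
  (forall i j w, A i w -> A j w -> i = j) -> (forall w, exists i, A i w) ->
  (m E = \sum_i m (A i `&` E))%E.
Proof.
move=> mE mA Adisj Acov.
have mAE i : measurable (A i `&` E) by exact: measurableI.
rewrite -[E in LHS]setIT -integral_indic//.
under [RHS]eq_bigr do rewrite -[_ `&` E]setIT -integral_indic//.
rewrite -ge0_integral_sum//; last first.
  by move=> i; apply/measurable_EFinP; exact: measurable_indic.
apply: eq_integral => w _; rewrite sumEFin; congr EFin.
have [i Aiw] := Acov w; rewrite (bigD1 i)//= big1 ?addr0.
  by rewrite !indicE in_setI (mem_set Aiw).
move=> j ji; rewrite indicE memNset// => -[Ajw _].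
by move/eqP: ji; apply; exact: Adisj Ajw Aiw.
Qed.

Section WeightedMeasure.
Context {d0 d1 : measure_display} {U : measurableType d0} {S : measurableType d1}
  {R : realType}.
Variables (m : {measure set S -> \bar R}) (k : S -> R) (f : S -> U).
Hypothesis mk : measurable_fun setT k.
Hypothesis k_ge0 : forall s, 0 <= k s.
Hypothesis mf : measurable_fun setT f.

Definition weighted_measure (A : set U) : \bar R :=
  (\int[m]_(s in f @^-1` A) (k s)%:E)%E.

Let wm0 : weighted_measure set0 = 0%E.
Proof. by rewrite /weighted_measure preimage_set0 integral_set0. Qed.

Let wm_ge0 A : (0 <= weighted_measure A)%E.
Proof. by apply: integral_ge0 => s _; rewrite lee_fin. Qed.

Let mpre A : measurable A -> measurable (f @^-1` A).
Proof. by move=> mA; rewrite -[X in measurable X]setTI; exact: mf. Qed.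

Let wm_additive : semi_sigma_additive weighted_measure.
Proof.
move=> F mF tF mUF; rewrite /weighted_measure preimage_bigcup.
apply: semi_sigma_additive_nng_induced.
- exact/measurable_EFinP.
- by move=> s; rewrite lee_fin.
- by move=> i; exact: mpre.
- by move=> i j _ _ [s [si sj]]; apply: (tF i j) => //; exists (f s).
- by rewrite -preimage_bigcup; exact: mpre.
Qed.

HB.instance Definition _ :=
  isMeasure.Build d0 U R weighted_measure wm0 wm_ge0 wm_additive.

Definition weighted_measure_pack : {measure set U -> \bar R} := weighted_measure.

Lemma weighted_measureE A : measurable A ->
  weighted_measure A = (\int[m]_s (k s * \1_A (f s))%:E)%E.
Proof.
move=> mA; rewrite /weighted_measure integral_mkcond; apply: eq_integral => s _.
rewrite /patch indicE; have [sA|sA] := boolP (s \in _).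
  by rewrite mem_set ?mulr1//; rewrite inE in sA.
by rewrite memNset ?mulr0//; rewrite notin_setE in sA.
Qed.

End WeightedMeasure.

(** [weighted_measure] is the image under [f] of the measure with density [k]; two such measures
    that agree on a generating pi-system and are finite coincide. *)
Lemma weighted_integral_pi_ext {d0 d1 d2 : measure_display} {U : measurableType d0}
    {S1 : measurableType d1} {S2 : measurableType d2} {R : realType}
    (m1 : {measure set S1 -> \bar R}) (m2 : {measure set S2 -> \bar R})
    (k1 : S1 -> R) (k2 : S2 -> R) (f1 : S1 -> U) (f2 : S2 -> U)
    (G : set (set U)) (u : U -> \bar R) :
  measurable_fun setT k1 -> measurable_fun setT k2 ->
  (forall s, 0 <= k1 s) -> (forall s, 0 <= k2 s) ->
  measurable_fun setT f1 -> measurable_fun setT f2 ->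
  measurable = <<s G >> -> setI_closed G -> G setT ->
  (\int[m1]_s (k1 s)%:E < +oo)%E ->
  (forall A, G A ->
    \int[m1]_s (k1 s * \1_A (f1 s))%:E = \int[m2]_s (k2 s * \1_A (f2 s))%:E)%E ->
  measurable_fun setT u -> (forall x, 0 <= u x)%E ->
  (\int[m1]_s ((k1 s)%:E * u (f1 s)) = \int[m2]_s ((k2 s)%:E * u (f2 s)))%E.
Proof.
move=> mk1 mk2 k10 k20 mf1 mf2 mG GI GT m1oo agree mu u0.
apply: weighted_integral_ext => // A mA.
rewrite -(weighted_measureE m1 k1 f1 mA) -(weighted_measureE m2 k2 f2 mA).
apply: (@measure_unique _ R U G (fun=> setT) mG GI _ _
  (weighted_measure_pack m1 mk1 k10 mf1) (weighted_measure_pack m2 mk2 k20 mf2)) => //.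
- by apply/seteqP; split => // w _; exists 0%N.
- move=> B GB; have mB : measurable B by rewrite mG; exact: sub_sigma_algebra.
  rewrite /weighted_measure_pack/=.
  by rewrite (weighted_measureE m1 k1 f1 mB) (weighted_measureE m2 k2 f2 mB) agree.
Qed.

Section BayesOpShift.
Context {R : realType} {d : nat}.
Variables (G : 'I_d -> R -> R) (L : 'M[R]_d).
Hypothesis G_lik : is_lik G.
Hypothesis L_stoch : is_stochastic L.
Variables (phi : 'cV[R]_d -> R) (B : R).
Hypothesis mphi : simplex_measurable phi.
Hypothesis phiB : forall x, in_simplex x -> `|phi x| <= B.

Lemma simplex_measurableD c : simplex_measurable (fun x => phi x + c).
Proof.
by move=> d' S u mu us; apply: measurable_funD => //; exact: mphi.
Qed.

Lemma bayes_opD c x : in_simplex x ->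
  bayes_op G L (fun x => phi x + c) x = bayes_op G L phi x + c.
Proof.
move=> xs; have ps := simplex_trmulmx L_stoch xs; rewrite /bayes_op.
under eq_Rintegral do rewrite mulrDl.
have iK := lik_integrable G_lik (L^T *m x).
have ip := bayes_integrand_integrable G_lik mphi phiB ps.
rewrite RintegralD//; last exact: integrableZlr.
by rewrite RintegralZl// Rintegral_lik// mulr1.
Qed.

(** Adding the bound [B] makes [phi] nonnegative, and [bayes_op] carries the constant through. *)
Lemma simplex_measurable_bayes_op_bounded : simplex_measurable (bayes_op G L phi).
Proof.
move=> d' S u mu us.
have f0 x : in_simplex x -> 0 <= phi x + B.
  by move=> xs; have := phiB xs; rewrite ler_norml => /andP[] *; lra.
have := simplex_measurable_bayes_op G_lik L_stoch (simplex_measurableD B) f0 mu us.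
under eq_fun do rewrite bayes_opD//.
move=> mB; have := measurable_funB mB (measurable_cst B).
rewrite (_ : _ \- _ = fun s => bayes_op G L phi (u s))//.
by apply/funext => s /=; rewrite addrK.
Qed.

Lemma bayes_op_le x : in_simplex x -> `|bayes_op G L phi x| <= B.
Proof.
move=> xs; have ps := simplex_trmulmx L_stoch xs.
have iK := integrableZlr B (lik_integrable G_lik (L^T *m x)).
have K0 y : 0 < lik G (L^T *m x) y by exact: lik_gt0.
apply: le_trans.
  apply: (le_normr_Rintegral_dominated _ _ iK).
    exact: measurable_bayes_integrand.
  move=> y; rewrite normrM [X in _ * X]gtr0_norm// ler_wpM2r ?(ltW (K0 y))//.
  by apply: phiB; exact: bayes_simplex.
by rewrite RintegralZl ?Rintegral_lik ?mulr1//; exact: lik_integrable.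
Qed.

End BayesOpShift.

Section BayesOpLinear.
Context {R : realType} {d : nat}.
Variables (G : 'I_d -> R -> R) (L : 'M[R]_d).
Hypothesis G_lik : is_lik G.
Hypothesis L_stoch : is_stochastic L.

(** Multiplication by [lik] cancels the normalisation, so the posterior averages back to the
    predicted law. *)
Lemma bayes_op_dotv b x : in_simplex x -> bayes_op G L (dotv b) x = dotv (L *m b) x.
Proof.
move=> xs; have ps := simplex_trmulmx L_stoch xs; rewrite -dotv_mulmx.
transitivity (\int[@lebesgue_measure R]_y
    (\sum_i (b i 0 * (L^T *m x) i 0) * G i y)).
  rewrite /bayes_op; apply: eq_Rintegral => y _; rewrite /dotv mulr_suml.
  apply: eq_bigr => i _; rewrite -mulrA [bayes _ _ _ _ _ * _]mulrC lik_bayes//.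
  by rewrite mulrA.
rewrite Rintegral_sum; last by move=> i; apply: integrableZlr; exact: is_lik_integrable.
apply: eq_bigr => i _; rewrite RintegralZl//; last exact: is_lik_integrable.
by rewrite is_lik_int1// mulr1.
Qed.

End BayesOpLinear.

(** * Convergence of means along the filter *)

Section FilterProcess.
Context {dd : measure_display} {T : measurableType dd} {R : realType} {d : nat}.
Variables (P : probability T R) (L : 'M[R]_d) (nu : 'cV[R]_d).
Variables (G : 'I_d -> R -> R) (F : nat -> T -> 'cV[R]_d).
Hypothesis L_stoch : is_stochastic L.
Hypothesis G_lik : is_lik G.
Hypothesis mF : forall n i, measurable_fun setT (fun w => F n w i 0).
Hypothesis F_simplex : forall n w, in_simplex (F n w).
Hypothesis F0 : forall w, F 0 w = nu.
Hypothesis F_step : forall n phi B, simplex_measurable phi ->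
  (forall x, in_simplex x -> 0 <= phi x) -> (forall x, in_simplex x -> `|phi x| <= B) ->
  (\int[P]_w (phi (F n.+1 w))%:E = \int[P]_w (bayes_op G L phi (F n w))%:E)%E.

Definition mean (phi : 'cV[R]_d -> R) n : R := \int[P]_w phi (F n w).

Lemma mean_integrable phi B n : simplex_measurable phi ->
  (forall x, in_simplex x -> `|phi x| <= B) ->
  P.-integrable setT (EFin \o (fun w => phi (F n w))).
Proof.
move=> mphi phiB; apply: (@integrable_dominated _ _ _ P _ (fun=> B)).
- exact: mphi.
- by move=> w; exact: phiB.
- exact: finite_measure_integrable_cst.
Qed.

Lemma mean_cst c n : mean (fun=> c) n = c.
Proof.
rewrite /mean /Rintegral integral_cst//.
by transitivity (fine (c%:E * 1)); [rewrite -(probability_setT P)|rewrite mule1].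
Qed.

Lemma mean_step phi B n : simplex_measurable phi ->
  (forall x, in_simplex x -> `|phi x| <= B) ->
  mean phi n.+1 = mean (bayes_op G L phi) n.
Proof.
move=> mphi phiB.
have f0 x : in_simplex x -> 0 <= phi x + B.
  by move=> xs; have := phiB x xs; rewrite ler_norml => /andP[] *; lra.
have fB x : in_simplex x -> `|phi x + B| <= B + B.
  by move=> xs; have := phiB x xs; rewrite !ler_norml => /andP[] *; apply/andP; split; lra.
have : mean (fun x => phi x + B) n.+1 = mean (bayes_op G L (fun x => phi x + B)) n.
  rewrite /mean /Rintegral; congr fine.
  exact: (F_step n (simplex_measurableD mphi B) f0 fB).
have mb := simplex_measurable_bayes_op_bounded G_lik L_stoch mphi phiB.
have bB := bayes_op_le G_lik L_stoch mphi phiB.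

rewrite {1}/mean RintegralD; [|exact: measurableT|..]; last 2 first.
- exact: (mean_integrable n.+1 mphi phiB).
- exact: finite_measure_integrable_cst.
have -> : mean (bayes_op G L (fun x => phi x + B)) n =
    \int[P]_w (bayes_op G L phi (F n w) + B).
  by apply: eq_Rintegral => w _; rewrite (bayes_opD G_lik L_stoch mphi phiB).
rewrite RintegralD//; last 2 first.
- exact: (mean_integrable n mb bB).
- exact: finite_measure_integrable_cst.
exact: addIr.
Qed.

Lemma mean_dotv b n : mean (dotv b) n = dotv b (marginal_law L nu n).
Proof.
elim: n b => [|n IH] b.
  rewrite /mean; under eq_Rintegral do rewrite F0.
  exact: (mean_cst (dotv b nu) 0).
have bB x : in_simplex x -> `|dotv b x| <= l1norm b.
  by apply: dotv_simplex_le => i; exact: entry_le_l1norm.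
rewrite (mean_step n (simplex_measurable_dotv b) bB) [RHS]dotv_mulmx -IH.
by apply: eq_Rintegral => w _; rewrite bayes_op_dotv.
Qed.

Definition tame (phi : 'cV[R]_d -> R) : Prop :=
  simplex_measurable phi /\ exists B, forall x, in_simplex x -> `|phi x| <= B.

Lemma tame_cst c : tame (fun=> c).
Proof.
by split; [move=> d' S u mu _; exact: measurable_cst|exists `|c|].
Qed.

Lemma tameD phi psi : tame phi -> tame psi -> tame (fun x => phi x + psi x).
Proof.
move=> [m1 [B1 b1]] [m2 [B2 b2]]; split.
  by move=> d' S u mu us; apply: measurable_funD; [exact: m1|exact: m2].
exists (B1 + B2) => x xs; apply: (le_trans (ler_normD _ _)).
by apply: lerD; [exact: b1|exact: b2].
Qed.

Lemma tameZ c phi : tame phi -> tame (fun x => c * phi x).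
Proof.
move=> [m1 [B1 b1]]; split.
  by move=> d' S u mu us; apply: measurable_funM; [exact: measurable_cst|exact: m1].
by exists (`|c| * B1) => x xs; rewrite normrM ler_wpM2l//; exact: b1.
Qed.

Lemma tame_sum (I : Type) (r : seq I) (phi : I -> 'cV[R]_d -> R) :
  (forall i, tame (phi i)) -> tame (fun x => \sum_(i <- r) phi i x).
Proof.
move=> ti; elim: r => [|i r IH].
  by rewrite (_ : (fun _ => _) = fun=> 0); [exact: tame_cst|apply/funext => x; rewrite big_nil].
rewrite (_ : (fun _ => _) = fun x => phi i x + \sum_(j <- r) phi j x).
  exact: tameD.
by apply/funext => x; rewrite big_cons.
Qed.

Lemma tame_integrable phi n : tame phi ->
  P.-integrable setT (EFin \o (fun w => phi (F n w))).
Proof. by move=> [mphi [B phiB]]; exact: (mean_integrable n mphi phiB). Qed.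

Lemma meanD phi psi n : tame phi -> tame psi ->
  mean (fun x => phi x + psi x) n = mean phi n + mean psi n.
Proof.
move=> /(tame_integrable n) i1 /(tame_integrable n) i2.
by rewrite /mean RintegralD//.
Qed.

Lemma meanZ c phi n : tame phi -> mean (fun x => c * phi x) n = c * mean phi n.
Proof. by move=> /(tame_integrable n) i1; rewrite /mean RintegralZl. Qed.

Lemma mean_sum (I : Type) (r : seq I) (phi : I -> 'cV[R]_d -> R) n :
  (forall i, tame (phi i)) ->
  mean (fun x => \sum_(i <- r) phi i x) n = \sum_(i <- r) mean (phi i) n.
Proof. by move=> ti; apply: Rintegral_sum => i; exact: tame_integrable. Qed.

Lemma le_mean_dist phi psi c n : tame phi -> tame psi ->
  (forall x, in_simplex x -> `|phi x - c| <= psi x) -> `|mean phi n - c| <= mean psi n.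
Proof.
move=> tphi /(tame_integrable n) i2 h; have i1 := tame_integrable n tphi.
have ic := finite_measure_integrable_cst P c measurableT.
rewrite -{1}(mean_cst c n) /mean -RintegralB//.
apply: (@le_normr_Rintegral_dominated _ _ _ P) => //.
- apply: measurable_funB; last exact: measurable_cst.
  by apply: tphi.1.
- by move=> w; exact: h.
Qed.

Lemma tame_bayes_op phi : tame phi -> tame (bayes_op G L phi).
Proof.
move=> [mphi [B phiB]]; split; last by exists B => x; exact: bayes_op_le.
exact: simplex_measurable_bayes_op_bounded phiB.
Qed.

Section Convergence.
Variables (kappa : R) (K : nat).
Hypothesis kappa_ge0 : 0 <= kappa.
Hypothesis kappa_lt1 : kappa < 1.
Hypothesis bayes_contr : forall l phi, 0 <= l -> simplex_measurable phi ->
  simplex_lipschitz L K l phi -> simplex_lipschitz L K (kappa * l) (bayes_op G L phi).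

(** Steps are moved from the process to the function: each costs one application of [bayes_op] and
    gains a factor [kappa] in the Lipschitz constant. *)
Lemma iter_bayes_op l phi m n : 0 <= l -> simplex_measurable phi ->
  simplex_lipschitz L K l phi ->
  [/\ simplex_measurable (iter n (bayes_op G L) phi),
      simplex_lipschitz L K (kappa ^+ n * l) (iter n (bayes_op G L) phi) &
      mean phi (n + m) = mean (iter n (bayes_op G L) phi) m].
Proof.
elim: n l phi => [|n IH] l phi l0 mphi lphi; first by split; rewrite ?mul1r.
have [B phiB] := simplex_lipschitz_bounded L_stoch l0 lphi.
have mb := simplex_measurable_bayes_op_bounded G_lik L_stoch mphi phiB.
have [m1 l1 e1] := IH _ _ (mulr_ge0 kappa_ge0 l0) mb (bayes_contr l0 mphi lphi).
rewrite iterSr exprSr -mulrA; split=> //.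
by rewrite addSn (mean_step _ mphi phiB).
Qed.

(** The change from time n to n+1 is the change from time 0 to 1 for the n-fold iterate of
    [bayes_op], whose Lipschitz constant is kappa^n l. The increments are therefore summable. *)
Lemma mean_cvg l phi : 0 <= l -> simplex_measurable phi ->
  simplex_lipschitz L K l phi -> cvgn (mean phi).
Proof.
move=> l0 mphi lphi.
pose u n := mean phi n.+1 - mean phi n.
have uB n : `|u n| <= (l * (K%:R * 2)) * kappa ^+ n.
  have [m1 l1 e1] := iter_bayes_op 1 n l0 mphi lphi.
  have [_ _ e0] := iter_bayes_op 0 n l0 mphi lphi.
  have ln0 : 0 <= kappa ^+ n * l by rewrite mulr_ge0// exprn_ge0.
  rewrite /u -addn1 e1 -{2}(addn0 n) e0.
  set psi := iter n _ _ in m1 l1 e1 e0 *.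
  have [B psiB] := simplex_lipschitz_bounded L_stoch ln0 l1.
  rewrite /mean; under [X in _ - X]eq_Rintegral do rewrite F0.
  have i1 := mean_integrable 1 m1 psiB.
  rewrite -RintegralB//; last exact: finite_measure_integrable_cst.
  rewrite -[leRHS](mean_cst _ 1) /mean.
  apply: (@le_normr_Rintegral_dominated _ _ _ P).
  - apply: measurable_funB; last exact: measurable_cst.
    by apply: m1.
  - move=> w; rewrite -(F0 w); apply: (le_trans (l1 _ _ (F_simplex _ _) (F_simplex _ _))).
    rewrite -mulrA [leRHS]mulrC ler_wpM2l ?exprn_ge0// ler_wpM2l//.
    apply: (le_trans (orbit_norm_le L_stoch _ _)).
    by rewrite ler_wpM2l//; exact: l1norm_simplexB.
  - exact: finite_measure_integrable_cst.
have gc : cvgn (series (fun n => (l * (K%:R * 2)) * kappa ^+ n)).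
  by apply: is_cvg_geometric_series; rewrite ger0_norm.
have uc : cvgn (series u).
  apply: normed_cvg; apply: (series_le_cvg _ _ uB gc) => n.
    exact: normr_ge0.
  by rewrite mulr_ge0 ?exprn_ge0// mulr_ge0// mulr_ge0.
have -> : mean phi = (fun n => series u n + mean phi 0).
  by apply/funext => n; rewrite /series /= telescope_sumr// subrK.
apply: is_cvgD => //; exact: is_cvg_cst.
Qed.

End Convergence.

End FilterProcess.

Section GeneratedSigmaAlgebra.
Context {dd : measure_display} {T : measurableType dd} {R : realType}.
Implicit Types (D : set nat) (Z : nat -> T -> R).

Lemma measurable_preimageT {d' : measure_display} {U : measurableType d'}
    (f : T -> U) (B : set U) :
  measurable_fun setT f -> measurable B -> measurable (f @^-1` B).
Proof. by move=> mf mB; rewrite -[X in measurable X]setTI; exact: mf. Qed.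

Definition cylinder D Z (B : nat -> set R) : set T :=
  \bigcap_(k in D) (Z k @^-1` B k).

Lemma sigma_generated_preimage D Z k B : D k -> measurable B ->
  sigma_generated D Z (Z k @^-1` B).
Proof.
by move=> Dk mB; apply: sub_sigma_algebra; exists k => //; exists B => //; rewrite setTI.
Qed.

Lemma sigma_generated_cylinder D D' Z B : D' `<=` D ->
  (forall k, measurable (B k)) -> sigma_generated D Z (cylinder D' Z B).
Proof.
move=> DD mB.
apply: (@bigcap_measurableType _ (g_sigma_algebraType
  (\bigcup_(k in D) preimage_set_system setT (Z k) measurable))) => k Dk.
exact: sigma_generated_preimage (DD _ Dk) (mB k).
Qed.

Lemma sigma_generated_measurable D Z : (forall k, measurable_fun setT (Z k)) ->
  sigma_generated D Z `<=` measurable.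
Proof.
move=> mZ; apply: smallest_sub; first exact: sigma_algebra_measurable.
by move=> _ [k _ [B mB <-]]; exact: mZ.
Qed.

Lemma cylinderI D Z A B : cylinder D Z A `&` cylinder D Z B =
  cylinder D Z (fun k => A k `&` B k).
Proof.
apply/seteqP; split => w /= => [[wA wB] k Dk|wAB].
  by split; [exact: wA|exact: wB].
by split=> k Dk; have [] := wAB k Dk.
Qed.

Lemma cylinderT D Z : cylinder D Z (fun=> setT) = setT.
Proof. by apply/seteqP; split => w. Qed.

End GeneratedSigmaAlgebra.

(** * The joint law of chain and observations, and the filter as conditional law *)

Section ChainStep.
Context {dd : measure_display} {T : measurableType dd} {R : realType} {d : nat}.
Variables (P : probability T R) (a : 'I_d -> R) (L : 'M[R]_d) (nu : 'cV[R]_d).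
Variables (X xi : nat -> T -> R).
Hypothesis a_inj : injective a.
Hypothesis mX : forall n, measurable_fun setT (X n).
Hypothesis mxi : forall n, measurable_fun setT (xi n).
Hypothesis X_markov : is_markov_chain P a L nu X.
Hypothesis xi_indep : mutually_independent P [set k | (1 <= k)%N] xi.
Hypothesis X_xi_indep : independent_sigma_algebras P (sigma_generated setT X)
  (sigma_generated [set k | (1 <= k)%N] xi).

Definition state n i : set T := X n @^-1` [set a i].

Lemma state_cover n w : exists i, state n i w.
Proof. by case: X_markov => + _ _; apply. Qed.

Lemma state_disj n i j w : state n i w -> state n j w -> i = j.
Proof. by rewrite /state /= => -> /a_inj. Qed.

Lemma measurable_state n i : measurable (state n i).
Proof. by apply: measurable_preimageT => //; exact: measurable_set1. Qed.

Let past n := [set k | (k <= n)%N].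
Let times n := [set k | (1 <= k <= n)%N].

Let measurable_cylinder D (Z : nat -> T -> R) B : (forall k, measurable_fun setT (Z k)) ->
  (forall k, measurable (B k)) -> measurable (cylinder D Z B).
Proof.
by move=> mZ mB; apply: bigcap_measurableType => k _; exact: measurable_preimageT.
Qed.

(** There are finitely many state histories up to time n. Intersected with each of them, the past
    event is either the full history or empty, so the elementary Markov property can be summed. *)
Lemma markov_cylinder n A i j : (forall k, measurable (A k)) ->
  (P (cylinder (past n) X A `&` state n i `&` state n.+1 j) =
   P (cylinder (past n) X A `&` state n i) * (L i j)%:E)%E.
Proof.
move=> mA; have [_ _ markov] := X_markov.
pose at_ (x : {ffun 'I_n.+1 -> 'I_d}) : set T :=
  [set w | forall k, (k <= n)%N -> X k w = a (x (inord k))].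
have m_at x : measurable (at_ x).
  rewrite (_ : at_ x = cylinder (past n) X (fun k => [set a (x (inord k))])).
    by apply: measurable_cylinder => // k; exact: measurable_set1.
  by [].
have at_disj x y w : at_ x w -> at_ y w -> x = y.
  move=> xw yw; apply/ffunP => k; apply: a_inj.
  have kn : (k <= n)%N by rewrite -ltnS.
  by have := xw k kn; rewrite (yw k kn) inord_val.
have at_cover w : exists x, at_ x w.
  have [f fP] := choice (fun k => state_cover k w).
  exists [ffun k : 'I_n.+1 => f k] => k kn.
  by rewrite ffunE inordK ?ltnS//; exact: fP.
have mE : measurable (cylinder (past n) X A `&` state n i).
  by apply: measurableI; [exact: measurable_cylinder|exact: measurable_state].
rewrite (@measure_partition _ _ _ P _ at_)//; last first.
  by apply: measurableI => //; exact: measurable_state.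
rewrite (@measure_partition _ _ _ P _ at_ (_ `&` state n i))//.
rewrite ge0_sume_distrl//.
apply: eq_bigr => x _.
have [xP|xP] := pselect ((forall k, (k <= n)%N -> A k (a (x (inord k)))) /\ x (inord n) = i).
  have [xA xi_] := xP.
  have -> : at_ x `&` (cylinder (past n) X A `&` state n i) = at_ x.
    apply/seteqP; split => [w []//|w xw]; split => //; split.
      by move=> k /= kn; rewrite (xw k kn); exact: xA.
    by rewrite /state /= (xw n (leqnn n)) xi_.
  have -> : at_ x `&` (cylinder (past n) X A `&` state n i `&` state n.+1 j) =
      [set w | (forall k, (k <= n)%N -> X k w = a (x (inord k))) /\ X n.+1 w = a j].
    apply/seteqP; split => [w [xw [_ wj]]//|w [xw wj]]; split => //; split => //; split.
      by move=> k /= kn; rewrite (xw k kn); exact: xA.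
    by rewrite /state /= (xw n (leqnn n)) xi_.
  by have := markov n (fun k => x (inord k)) j; rewrite /= xi_.
have E0 : at_ x `&` (cylinder (past n) X A `&` state n i) = set0.
  apply/seteqP; split => // w [xw [wA wi]]; apply: xP; split.
    by move=> k kn; rewrite -(xw k kn); exact: wA.
  by apply: a_inj; rewrite -(xw n (leqnn n)).
by rewrite setIA (setIA (at_ x)) in E0 *; rewrite !setIA in E0 *; rewrite E0 set0I measure0 mul0e.
Qed.

Lemma noise_cylinder n B B' : (forall k, measurable (B k)) -> measurable B' ->
  (P (cylinder (times n) xi B `&` xi n.+1 @^-1` B') =
   P (cylinder (times n) xi B) * P (xi n.+1 @^-1` B'))%E.
Proof.
move=> mB mB'.
pose J n := [fset k in iota 1 n]%fset.
have JE m k : (k \in J m) = (1 <= k <= m)%N.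
  by rewrite in_fset /= mem_iota add1n ltnS.
pose B2 k := if k == n.+1 then B' else B k.
have mB2 k : measurable (B2 k) by rewrite /B2; case: ifP.
have cylE m C : cylinder (times m) xi C = \bigcap_(k in [set` J m]) (xi k @^-1` C k).
  by apply/seteqP; split => w h k; [rewrite /= JE => /h|move=> /= kn; apply: h; rewrite /= JE].
have J1 k m : k \in J m -> (1 <= k)%N by rewrite JE => /andP[].
have -> : cylinder (times n) xi B `&` xi n.+1 @^-1` B' = cylinder (times n.+1) xi B2.
  apply/seteqP; split => w.
    move=> [wB wB'] k /= /andP[k1 kn]; rewrite /B2; case: eqP => [->//|kE].
    by apply: wB; apply/andP; split; rewrite // -ltnS ltn_neqAle kn andbT; apply/eqP.
  move=> wB; split.
    move=> k /= /andP[k1 kn].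
    have : B2 k (xi k w) by apply: wB; apply/andP; split => //; exact: leqW.
    by rewrite /B2 ltn_eqF.
  have : B2 n.+1 (xi n.+1 w) by apply: wB; apply/andP.
  by rewrite /B2 eqxx.
rewrite !cylE !xi_indep//; [|by move=> k /J1..].
have -> : J n.+1 = (n.+1 |` J n)%fset.
  apply/fsetP => k; rewrite JE in_fset1U JE.
  by rewrite (leq_eqVlt k) ltnS andb_orr; case: eqP => [->//|_]; rewrite andbF.
rewrite big_fsetU1 ?JE ?ltnn ?andbF//= /B2 eqxx muleC; congr (_ * _)%E.
rewrite big_seq [RHS]big_seq; apply: eq_bigr => k; rewrite JE => /andP[_ kn].
by rewrite ltn_eqF.
Qed.

(** A pi-system generating the joint past of chain and noise, on which independence and the Markov
    property apply directly. *)
Definition history_sets n : set (set T) :=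
  [set C | exists A B, [/\ forall k, measurable (A k), forall k, measurable (B k) &
    C = cylinder (past n) X A `&` cylinder (times n) xi B]].

Lemma step_history_sets n i j B' C : measurable B' -> history_sets n C ->
  (P (C `&` (state n i `&` state n.+1 j `&` xi n.+1 @^-1` B')) =
   P (C `&` state n i) * (L i j)%:E * P (xi n.+1 @^-1` B'))%E.
Proof.
move=> mB' [A [B [mA mB ->]]].
have XA : sigma_generated setT X (cylinder (past n) X A `&` state n i).
  apply: (@measurableI _ (g_sigma_algebraType
    (\bigcup_(k in setT) preimage_set_system setT (X k) measurable))).
    exact: sigma_generated_cylinder.
  by apply: sigma_generated_preimage => //; exact: measurable_set1.
have XAj : sigma_generated setT X (cylinder (past n) X A `&` state n i `&` state n.+1 j).
  apply: (@measurableI _ (g_sigma_algebraType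
    (\bigcup_(k in setT) preimage_set_system setT (X k) measurable))) => //.
  by apply: sigma_generated_preimage => //; exact: measurable_set1.
have xB : sigma_generated [set k | (1 <= k)%N] xi (cylinder (times n) xi B).
  by apply: sigma_generated_cylinder => // k /= /andP[].
have xBB : sigma_generated [set k | (1 <= k)%N] xi
    (cylinder (times n) xi B `&` xi n.+1 @^-1` B').
  apply: (@measurableI _ (g_sigma_algebraType
    (\bigcup_(k in [set k | (1 <= k)%N]) preimage_set_system setT (xi k) measurable))) => //.
  exact: sigma_generated_preimage.
rewrite [X in P X = _](_ : _ = (cylinder (past n) X A `&` state n i `&` state n.+1 j) `&`
  (cylinder (times n) xi B `&` xi n.+1 @^-1` B')); last first.
  by rewrite -!setIA; congr (_ `&` _); rewrite !setIA; apply/seteqP; split => w /=; tauto.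
rewrite (X_xi_indep XAj xBB) markov_cylinder// noise_cylinder//.
rewrite [X in _ = (P X * _ * _)%E](_ : _ = (cylinder (past n) X A `&` state n i) `&`
  cylinder (times n) xi B); last first.
  by apply/seteqP; split => w /=; tauto.
by rewrite (X_xi_indep XA xB) [LHS]muleACA [LHS]muleA.
Qed.

(** As functions of C both sides are finite measures, one a restriction of [P] and the other a
    multiple of a restriction; they agree on the pi-system [history_sets]. *)
Lemma step_generated n i j B' C : measurable B' -> 0 <= L i j ->
  <<s history_sets n >> C ->
  (P (C `&` (state n i `&` state n.+1 j `&` xi n.+1 @^-1` B')) =
   P (C `&` state n i) * (L i j)%:E * P (xi n.+1 @^-1` B'))%E.
Proof.
move=> mB' L0 sC.
have mE : measurable (state n i `&` state n.+1 j `&` xi n.+1 @^-1` B').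
  apply: measurableI; last exact: measurable_preimageT.
  by apply: measurableI; exact: measurable_state.
have mS := measurable_state n i.
have c0 : 0 <= L i j * fine (P (xi n.+1 @^-1` B')).
  by rewrite mulr_ge0// fine_ge0.
have cE : (L i j * fine (P (xi n.+1 @^-1` B')))%:E = ((L i j)%:E * P (xi n.+1 @^-1` B'))%E.
  by rewrite EFinM fineK// fin_num_measure//; exact: measurable_preimageT.
suff : mrestr P mE C = mscale (NngNum c0) (mrestr P mS) C.
  by rewrite /mscale /mrestr /= cE => ->; rewrite muleC muleA.
apply: (g_sigma_algebra_measure_unique (history_sets n) _ (fun=> setT)) => //.
- move=> _ [A [B [mA mB ->]]]; apply: measurableI; exact: measurable_cylinder.
- move=> _; exists (fun=> setT), (fun=> setT); split => //.
  by rewrite !cylinderT setIT.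
- by apply/seteqP; split => // w _; exists 0%N.
- move=> _ _ [A [B [mA mB ->]]] [A' [B1 [mA' mB1 ->]]].
  exists (fun k => A k `&` A' k), (fun k => B k `&` B1 k); split.
  + by move=> k; exact: measurableI.
  + by move=> k; exact: measurableI.
  + by rewrite -!cylinderI; apply/seteqP; split => w /=; tauto.
- move=> E hE; change (P (E `&` (state n i `&` state n.+1 j `&` xi n.+1 @^-1` B')) =
    ((L i j * fine (P (xi n.+1 @^-1` B')))%:E * P (E `&` state n i))%E).
  by rewrite (step_history_sets i j mB' hE) cE -muleA muleC.
- move=> _; apply: (@le_lt_trans _ _ 1%E); last exact: ltry.
  by apply: probability_le1; exact: measurableI.
Qed.

Variables (sg : R -> R) (G : 'I_d -> R -> R).
Hypothesis L_stoch : is_stochastic L.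
Hypothesis nu_simplex : in_simplex nu.
Hypothesis G_lik : is_lik G.
Notation leb := (@lebesgue_measure R).
Hypothesis G_law : forall n i B, (1 <= n)%N -> measurable B ->
  P (xi n @^-1` [set z | B (z + sg (a i))]) = (\int[leb]_(y in B) (G i y)%:E)%E.

Definition obs (n : nat) (w : T) : R := xi n w + sg (X n w).

Definition obs_sets (n : nat) : set (set T) :=
  \bigcup_(k in [set k | (1 <= k <= n)%N]) preimage_set_system setT (obs k) measurable.

(** [x] takes finitely many values, so [sg] composed with [x] is a finite combination of indicators
    whatever [sg] is. The source space is left free so that the history sigma-algebra can be used
    there. *)
Lemma measurable_obs_comp {d' : measure_display} {S : measurableType d'} (x z : S -> R) :
  measurable_fun setT x -> measurable_fun setT z -> (forall s, exists i, x s = a i) ->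
  measurable_fun setT (fun s => z s + sg (x s)).
Proof.
move=> mx mz xa; apply: measurable_funD => //.
rewrite (_ : (fun s => _) = fun s => \sum_i sg (a i) * \1_[set a i] (x s)).
  apply: measurable_sum => i; apply: measurable_funM; first exact: measurable_cst.
  apply: measurableT_comp => //; apply: measurable_indic; exact: measurable_set1.
apply/funext => s; have [i xi_] := xa s.
rewrite (bigD1 i)//= big1 ?addr0 => [|j ji].
  by rewrite indicE mem_set ?mulr1// xi_.
rewrite indicE memNset ?mulr0//= xi_ => /a_inj ij.
by rewrite ij eqxx in ji.
Qed.

Lemma measurable_obs n : measurable_fun setT (obs n).
Proof. by apply: measurable_obs_comp => // w; exact: state_cover. Qed.

Let X_history k n : (k <= n)%N ->
  measurable_fun setT (X k : g_sigma_algebraType (history_sets n) -> R).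
Proof.
move=> kn _ B mB; rewrite setTI; apply: sub_sigma_algebra.
exists (fun l => if l == k then B else setT), (fun=> setT); split => //.
- by move=> l; case: ifP.
- rewrite cylinderT setIT; apply/seteqP; split => w /=.
    by move=> Bw l _; rewrite /preimage/=; case: eqP => [->|].
  by move=> /(_ k kn); rewrite /preimage /= eqxx.
Qed.

Let xi_history k n : (1 <= k <= n)%N ->
  measurable_fun setT (xi k : g_sigma_algebraType (history_sets n) -> R).
Proof.
move=> kn _ B mB; rewrite setTI; apply: sub_sigma_algebra.
exists (fun=> setT), (fun l => if l == k then B else setT); split => //.
- by move=> l; case: ifP.
- rewrite cylinderT setTI; apply/seteqP; split => w /=.
    by move=> Bw l _; rewrite /preimage/=; case: eqP => [->|].
  by move=> /(_ k kn); rewrite /preimage /= eqxx.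
Qed.

Lemma obs_sets_history n : <<s obs_sets n >> `<=` <<s history_sets n >>.
Proof.
apply: smallest_sub; first exact: smallest_sigma_algebra.
move=> _ [k kn [B mB <-]]; have /andP[_ kn'] := kn.
have := @measurable_obs_comp _ (g_sigma_algebraType (history_sets n)) (X k) (xi k).
by move=> /(_ (X_history kn') (xi_history kn) (state_cover k)) /(_ measurableT B mB).
Qed.

Lemma obs_sets_measurable n : <<s obs_sets n >> `<=` measurable.
Proof. by apply: sigma_generated_measurable => k; exact: measurable_obs. Qed.

Lemma measurable_id_obs n : measurable_fun setT (id : T -> g_sigma_algebraType (obs_sets n)).
Proof.
by move=> _ A mA; rewrite setTI preimage_id; exact: (@obs_sets_measurable n).
Qed.

Lemma measurable_obs_lift n {d' : measure_display} {S : measurableType d'} (f : T -> S) :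
  measurable_fun setT (f : g_sigma_algebraType (obs_sets n) -> S) ->
  measurable_fun setT f.
Proof.
by move=> mf _ B mB; apply: (@obs_sets_measurable n); exact: mf.
Qed.

Lemma obs_setsS n : <<s obs_sets n >> `<=` <<s obs_sets n.+1 >>.
Proof.
apply: smallest_sub; first exact: smallest_sigma_algebra.
move=> A [k /andP[k1 kn] kA]; apply: sub_sigma_algebra; exists k => //.
by apply/andP; split => //; exact: leqW.
Qed.

(** On the event that the next state is j, an observation event is an event of the next noise,
    independent of the past; summing over the current state brings in the transition
    probabilities. *)
Lemma step_obs n j A B : <<s obs_sets n >> A -> measurable B ->
  (P (A `&` (state n.+1 j `&` obs n.+1 @^-1` B)) =
   (\sum_i P (A `&` state n i) * (L i j)%:E) * \int[leb]_(y in B) (G j y)%:E)%E.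
Proof.
move=> sA mB; have mA := obs_sets_measurable sA.
pose B' : set R := [set z | B (z + sg (a j))].
have mB' : measurable B'.
  have mt : measurable_fun setT (fun z : R => z + sg (a j)).
    by apply: measurable_funD => //; exact: measurable_cst.
  exact: measurable_preimageT mt mB.
have sE : state n.+1 j `&` obs n.+1 @^-1` B = state n.+1 j `&` xi n.+1 @^-1` B'.
  by apply/seteqP; split => w [wj]; rewrite /obs /B' /preimage /= wj.
have q0 : (0 <= \int[leb]_(y in B) (G j y)%:E)%E.
  by apply: integral_ge0 => y _; rewrite lee_fin ltW//; case: G_lik.
rewrite (@measure_partition _ _ _ P _ (state n)); last 4 first.
- apply: measurableI => //; apply: measurableI; first exact: measurable_state.
  by apply: measurable_preimageT => //; exact: measurable_obs.
- exact: measurable_state.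
- by move=> i k w; exact: state_disj.
- exact: state_cover.
rewrite ge0_sume_distrl; last first.
  by move=> i _; rewrite mule_ge0// lee_fin; case: L_stoch.
apply: eq_bigr => i _; rewrite -(@G_law n.+1 j B)// -step_generated//; last 2 first.
- by case: L_stoch.
- exact: obs_sets_history.
by rewrite sE; congr (P _); apply/seteqP; split => w /=; tauto.
Qed.

Fixpoint filt (n : nat) (w : T) : 'cV[R]_d :=
  if n is m.+1 then bayes G (L^T *m filt m w) (obs m.+1 w) else nu.

Lemma filt_simplex n w : in_simplex (filt n w).
Proof.
elim: n => //= n IH; apply: bayes_simplex => //; exact: simplex_trmulmx.
Qed.

Lemma measurable_trmulmx {d' : measure_display} {S : measurableType d'}
    (p : S -> 'cV[R]_d) i :
  (forall i, measurable_fun setT (fun s => p s i 0)) ->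
  measurable_fun setT (fun s => (L^T *m p s) i 0).
Proof.
move=> mp; under eq_fun do rewrite mxE.
apply: measurable_sum => j; apply: measurable_funM => //; exact: measurable_cst.
Qed.

Lemma measurable_lik_joint {d' : measure_display} {S : measurableType d'}
    (p : S -> 'cV[R]_d) (z : S -> R) :
  (forall i, measurable_fun setT (fun s => p s i 0)) -> measurable_fun setT z ->
  measurable_fun setT (fun s => lik G (p s) (z s)).
Proof.
move=> mp mz; apply: measurable_sum => i; apply: measurable_funM => //.
by apply: measurableT_comp => //; case: G_lik.
Qed.

Lemma measurable_bayes_joint {d' : measure_display} {S : measurableType d'}
    (p : S -> 'cV[R]_d) (z : S -> R) i :
  (forall i, measurable_fun setT (fun s => p s i 0)) -> measurable_fun setT z ->
  (forall s, in_simplex (p s)) ->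
  measurable_fun setT (fun s => bayes G (p s) (z s) i 0).
Proof.
move=> mp mz ps; under eq_fun do rewrite mxE.
apply: measurable_funM.
  by apply: measurable_funM => //; apply: measurableT_comp => //; case: G_lik.
apply: measurable_inv_gt0; first exact: measurable_lik_joint.
by move=> s; exact: lik_gt0.
Qed.

Lemma measurable_filt n i : measurable_fun setT
  (fun w : g_sigma_algebraType (obs_sets n) => filt n w i 0).
Proof.
elim: n i => [|n IH] i /=; first exact: measurable_cst.
apply: (@measurable_bayes_joint _ (g_sigma_algebraType (obs_sets n.+1))
  (fun w => L^T *m filt n w) (obs n.+1)).
- move=> j; apply: (@measurable_trmulmx _ (g_sigma_algebraType (obs_sets n.+1)) (filt n)).
  by move=> k _ B mB; apply: obs_setsS; exact: IH.
- move=> _ B mB; apply: sub_sigma_algebra; exists n.+1 => //=.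
  by exists B.
- by move=> w; apply: simplex_trmulmx => //; exact: filt_simplex.
Qed.

Lemma measurable_filtT n i : measurable_fun setT (fun w => filt n w i 0).
Proof. by apply: (@measurable_obs_lift n); exact: measurable_filt. Qed.

(* [filt n] is a version of the conditional law of [X n] given the first [n]
   observations. *)
Definition filt_claim n : Prop :=
  forall i (u : g_sigma_algebraType (obs_sets n) -> \bar R),
    measurable_fun setT u -> (forall w, 0 <= u w)%E ->
    (\int[P]_w ((\1_(state n i) w)%:E * u w) = \int[P]_w ((filt n w i 0)%:E * u w))%E.

Let comp_measurable {d1 d2 d3 : measure_display} (S1 : measurableType d1)
    (S2 : measurableType d2) (S3 : measurableType d3) (f : S2 -> S3) (h : S1 -> S2) :
  measurable_fun setT f -> measurable_fun setT h -> measurable_fun setT (fun s => f (h s)).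
Proof. exact: measurableT_comp. Qed.

Local Notation FT n := (g_sigma_algebraType (obs_sets n)).

Let indic_rectangle {U V : Type} (A : set U) (B : set V) (z : U * V) :
  \1_(A `*` B) z = \1_A z.1 * \1_B z.2 :> R.
Proof.
rewrite !indicE -natrM mulnb; congr (_%:R); congr nat_of_bool.
by apply/idP/andP; rewrite !inE.
Qed.

(** The identity on points; only the sigma-algebra on the first factor shrinks to that of the
    observations. *)
Let prod_id n (z : T * R) : g_sigma_algebraType (obs_sets n) * R := (z.1, z.2).

Let measurable_prod_id n : measurable_fun setT (prod_id n).
Proof.
apply: measurable_fun_pair; last exact: measurable_snd.
exact: (@comp_measurable _ _ _ (T * R)%type T (FT n) id fst (@measurable_id_obs n) measurable_fst).
Qed.

Let with_obs n (w : T) : g_sigma_algebraType (obs_sets n) * R := (w, obs n.+1 w).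

Let measurable_with_obs n : measurable_fun setT (with_obs n).
Proof.
by apply: measurable_fun_pair; [exact: measurable_id_obs|exact: measurable_obs].
Qed.

Let pred n w : 'cV[R]_d := L^T *m filt n w.

Let pred_simplex n w : in_simplex (pred n w).
Proof. by apply: simplex_trmulmx => //; exact: filt_simplex. Qed.

Let measurable_predT n i : measurable_fun setT (fun w => pred n w i 0).
Proof. by apply: measurable_trmulmx => j; exact: measurable_filtT. Qed.

Let measurable_indic_state n i : measurable_fun setT (\1_(state n i) : T -> R).
Proof. by apply: measurable_indic; exact: measurable_state. Qed.

Let sum_indic_state n w : \sum_i \1_(state n i) w = 1 :> R.
Proof.
have [i iw] := state_cover n w; rewrite (bigD1 i)//= big1 ?addr0.
  by rewrite indicE mem_set.
move=> j ji; rewrite indicE memNset// => jw.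
by rewrite (state_disj jw iw) eqxx in ji.
Qed.

(** The left side is linear in the probabilities of the current state on [A], and the claim, tested
    with the indicator of [A], turns each of them into an integral of [filt]. *)
Lemma filt_claim_pred n A j : filt_claim n -> <<s obs_sets n >> A ->
  (\sum_i P (A `&` state n i) * (L i j)%:E = \int[P]_w (pred n w j 0 * \1_A w)%:E)%E.
Proof.
move=> cl sA; have mA := obs_sets_measurable sA.
have m1A : measurable_fun setT (\1_A : T -> R) by exact: measurable_indic.
transitivity (\sum_i \int[P]_w ((L i j)%:E * (filt n w i 0 * \1_A w)%:E))%E.
  apply: eq_bigr => i _; rewrite ge0_integralZl//; last 3 first.
  - by apply/measurable_EFinP; apply: measurable_funM => //; exact: measurable_filtT.
  - by move=> w _; rewrite lee_fin mulr_ge0//; case: (filt_simplex n w).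
  - by rewrite lee_fin; case: L_stoch.
  rewrite muleC; congr (_ * _)%E.
  have := cl i (fun w => (\1_A w)%:E); rewrite -[A `&` _]setIT -integral_indic//; last first.
    by apply: measurableI => //; exact: measurable_state.
  move=> h; transitivity (\int[P]_w ((\1_(state n i) w)%:E * (\1_A w)%:E))%E.
    apply: eq_integral => w _; rewrite -EFinM; congr EFin.
    by rewrite !indicE in_setI andbC; case: (_ \in _); case: (_ \in _); rewrite ?mulr0 ?mulr1.
  by rewrite h//; apply/measurable_EFinP; exact: measurable_indic.
rewrite -ge0_integral_sum//; last 2 first.
- move=> i; apply: emeasurable_funM; first exact: measurable_cst.
  by apply/measurable_EFinP; apply: measurable_funM => //; exact: measurable_filtT.
- move=> i w _; rewrite -EFinM lee_fin mulr_ge0//; first by case: L_stoch.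
  by rewrite mulr_ge0//; case: (filt_simplex n w).
apply: eq_integral => w _; under eq_bigr do rewrite -EFinM.
rewrite sumEFin; congr EFin; rewrite /pred mxE mulr_suml.
by apply: eq_bigr => i _; rewrite mxE mulrA.
Qed.

(** Products of a past-observation event and a Borel set form a generating pi-system; on them
    [step_obs] and [filt_claim_pred] apply and Tonelli factors the right side. In other words,
    pred_j G_j is the joint density of next state and next observation given the past. *)
Lemma filt_claim_joint n j (u : g_sigma_algebraType (obs_sets n) * R -> \bar R) :
  filt_claim n -> measurable_fun setT u -> (forall z, 0 <= u z)%E ->
  (\int[P]_w ((\1_(state n.+1 j) w)%:E * u (w, obs n.+1 w)) =
   \int[P \x leb]_z ((pred n z.1 j 0 * G j z.2)%:E * u (z.1, z.2)))%E.
Proof.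
move=> cl mu u0; have [mG G0 _] := G_lik.
have mpG : measurable_fun setT (fun z : T * R => pred n z.1 j 0 * G j z.2).
  apply: measurable_funM.
    exact: (measurableT_comp (@measurable_predT n j) measurable_fst).
  by apply: measurableT_comp => //; exact: measurable_snd.
have p0 w : 0 <= pred n w j 0 by case: (pred_simplex n w).
apply: (@weighted_integral_pi_ext _ _ _ _ _ _ _ P (P \x leb)%E (\1_(state n.+1 j))
  (fun z : T * R => pred n z.1 j 0 * G j z.2) (with_obs n) (prod_id n)
  [set A `*` B | A in measurable & B in measurable] u) => //.
- by move=> z; rewrite mulr_ge0// ltW.
- exact: measurable_prod_id.
- exact: measurable_prod_measurableType.
- move=> _ _ [A mA [B mB <-]] [A' mA' [B' mB' <-]].
  exists (A `&` A'); first exact: measurableI.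
  exists (B `&` B'); first exact: measurableI.
  by rewrite setXI.
- by exists setT => //; exists setT => //; rewrite setXTT.
- rewrite integral_indic// ?setIT; last exact: measurable_state.
  apply: (@le_lt_trans _ _ 1%E); last exact: ltry.
  by apply: probability_le1; exact: measurable_state.
move=> _ [A sA [B mB <-]]; have mA := obs_sets_measurable sA.
transitivity (P (A `&` (state n.+1 j `&` obs n.+1 @^-1` B))).
  have mI : @measurable dd T (A `&` (state n.+1 j `&` obs n.+1 @^-1` B)).
    apply: measurableI => //; apply: measurableI; first exact: measurable_state.
    by apply: measurable_preimageT => //; exact: measurable_obs.
  rewrite -[X in P X]setIT -integral_indic//.
  apply: eq_integral => w _; congr EFin.
  rewrite (indic_rectangle A B (with_obs n w)) /with_obs /= !indicE !in_setI.
  have -> : (w \in obs n.+1 @^-1` B) = (obs n.+1 w \in B).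
    by apply/idP/idP; rewrite !inE.
  by rewrite -!natrM !mulnb andbCA.
rewrite step_obs// filt_claim_pred//.
have mA1 : measurable_fun setT (\1_A : T -> R) by exact: measurable_indic.
have mB1 : measurable_fun setT (\1_B : R -> R) by exact: measurable_indic.
pose h (z : T * R) : \bar R := ((pred n z.1 j 0 * \1_A z.1) * (G j z.2 * \1_B z.2))%:E.
transitivity (\int[(P \x leb)%E]_z h z)%E; last first.
  apply: eq_integral => z _; rewrite /h; congr EFin.
  rewrite (indic_rectangle A B (prod_id n z)) /prod_id /= !indicE.
  by rewrite mulrACA.
have mh : measurable_fun setT h.
  apply/measurable_EFinP; apply: measurable_funM.
    apply: measurable_funM.
      exact: (measurableT_comp (@measurable_predT n j) measurable_fst).
    exact: (measurableT_comp mA1 measurable_fst).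
  apply: measurable_funM.
    exact: (measurableT_comp (mG j) measurable_snd).
  exact: (measurableT_comp mB1 measurable_snd).
have GB0 y : 0 <= G j y * \1_B y by rewrite mulr_ge0// ltW.
have mGB : measurable_fun setT (fun y => G j y * \1_B y) by exact: measurable_funM.
rewrite fubini_tonelli1; last 2 first.
- exact: mh.
- by move=> z; rewrite lee_fin mulr_ge0// mulr_ge0.
have -> : (\int[leb]_(y in B) (G j y)%:E = \int[leb]_y (G j y * \1_B y)%:E)%E.
  rewrite integral_mkcond; apply: eq_integral => y _.
  by rewrite /patch indicE; case: ifP => _; rewrite ?mulr1 ?mulr0.
rewrite -ge0_integralZr//; last 3 first.
- apply/measurable_EFinP; apply: measurable_funM => //; exact: measurable_predT.
- by move=> w _; rewrite lee_fin mulr_ge0.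
- by apply: integral_ge0 => y _; rewrite lee_fin.
apply: eq_integral => w _; rewrite /fubini_F /h /=.
rewrite -ge0_integralZl//; first by apply/measurable_EFinP.
- by move=> y _; rewrite lee_fin.
- by rewrite lee_fin mulr_ge0.
Qed.

Lemma filt_claim_law n (u : g_sigma_algebraType (obs_sets n) * R -> \bar R) :
  filt_claim n -> measurable_fun setT u -> (forall z, 0 <= u z)%E ->
  (\int[P]_w u (w, obs n.+1 w) =
   \int[P \x leb]_z ((lik G (pred n z.1) z.2)%:E * u (z.1, z.2)))%E.
Proof.
move=> cl mu u0; have [mG G0 _] := G_lik.
have p0 w j : 0 <= pred n w j 0 by case: (pred_simplex n w).
have mu1 : measurable_fun setT (fun w => u (w, obs n.+1 w)).
  exact: (@comp_measurable _ _ _ T (FT n * R)%type _ u (with_obs n) mu (@measurable_with_obs n)).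
have mu2 : measurable_fun setT (fun z : T * R => u (z.1, z.2)).
  exact: (@comp_measurable _ _ _ (T * R)%type (FT n * R)%type _ u (prod_id n) mu (@measurable_prod_id n)).
transitivity (\int[P]_w \sum_j ((\1_(state n.+1 j) w)%:E * u (w, obs n.+1 w)))%E.
  apply: eq_integral => w _; rewrite -ge0_sume_distrl; last by move=> j _; rewrite lee_fin.
  by rewrite sumEFin sum_indic_state mul1e.
rewrite ge0_integral_sum//; last 2 first.
- by move=> j; apply: emeasurable_funM => //; apply/measurable_EFinP.
- by move=> j w _; rewrite mule_ge0.
under eq_bigr do rewrite filt_claim_joint//.
rewrite -ge0_integral_sum//; last 2 first.
- move=> j; apply: emeasurable_funM => //; apply/measurable_EFinP; apply: measurable_funM.
    exact: (measurableT_comp (@measurable_predT n j) measurable_fst).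
  exact: (measurableT_comp (mG j) measurable_snd).
- by move=> j z _; rewrite mule_ge0// lee_fin mulr_ge0// ltW.
apply: eq_integral => z _; rewrite -ge0_sume_distrl.
  by rewrite sumEFin.
by move=> j _; rewrite lee_fin mulr_ge0// ltW.
Qed.

(** The preimages under [with_obs n] form a sigma-algebra. It contains the generators: earlier
    observations depend on the first coordinate, the newest one is the second. *)
Lemma obs_setsS_preimage n A : <<s obs_sets n.+1 >> A ->
  exists2 C, measurable C & A = with_obs n @^-1` C.
Proof.
pose F := preimage_set_system setT (with_obs n) measurable.
suff : <<s obs_sets n.+1 >> `<=` F.
  by move=> h /h [C mC <-]; exists C => //; rewrite setTI.
apply: smallest_sub.
  by apply: sigma_algebra_preimage; exact: sigma_algebra_measurable.
move=> _ [k /andP[k1 kn] [B mB <-]].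
move: kn; rewrite leq_eqVlt ltnS => /orP[/eqP ->|kn].
  by exists (setT `*` B); [exact: measurableX|apply/seteqP; split => w /=; tauto].
exists ((obs k @^-1` B) `*` setT); last by apply/seteqP; split => w /=; tauto.
apply: measurableX => //; apply: sub_sigma_algebra; exists k; first exact/andP.
by exists B => //; rewrite setTI.
Qed.

Lemma filt_claim0 : filt_claim 0.
Proof.
move=> i u mu u0; have [nu0 _] := nu_simplex.
apply: (@weighted_integral_pi_ext _ _ _ (FT 0) T T R P P (\1_(state 0 i)) (fun=> nu i 0)
  id id [set setT] u) => //.
- exact: measurable_id_obs.
- exact: measurable_id_obs.
- apply/seteqP; split; apply: smallest_sub; try exact: smallest_sigma_algebra.
    by move=> A [k /= /andP[k1 k0]]; move: (leq_trans k1 k0).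
  by move=> _ ->; exact: (@measurableT _ (g_sigma_algebraType (obs_sets 0))).
- by move=> _ _ -> ->; rewrite setIT.
- rewrite integral_indic// ?setIT; last exact: measurable_state.
  apply: (@le_lt_trans _ _ 1%E); last exact: ltry.
  by apply: probability_le1; exact: measurable_state.
move=> _ ->.
under eq_integral do rewrite indicT mulr1.
under [RHS]eq_integral do rewrite indicT mulr1.
rewrite integral_indic// ?setIT; last exact: measurable_state.
transitivity ((nu i 0)%:E * P [set: T])%E; last by exact/esym/integral_cst.
by rewrite probability_setT mule1; case: X_markov => _ + _; apply.
Qed.

(** Bayes' formula: by [lik_bayes] the joint density pred_j G_j is the predictive density times the
    posterior. [filt_claim_joint] produces the former, and [filt_claim_law] turns the latter back
    into an expectation. *)
Lemma filt_claimS n : filt_claim n -> filt_claim n.+1.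
Proof.
move=> cl j u mu u0.
have b0 p y i : in_simplex p -> 0 <= bayes G p y i 0.
  by move=> ps; case: (bayes_simplex G_lik y ps).
apply: (@weighted_integral_ext _ _ _ (g_sigma_algebraType (obs_sets n.+1)) T T R P P
  (\1_(state n.+1 j)) (fun w => filt n.+1 w j 0) id id) => //.
- exact: measurable_filtT.
- by move=> w; case: (filt_simplex n.+1 w).
- exact: measurable_id_obs.
- exact: measurable_id_obs.
move=> A /obs_setsS_preimage[C mC ->].
have m1C : measurable_fun setT (\1_C : _ -> R) by exact: measurable_indic.
transitivity (\int[P]_w ((\1_(state n.+1 j) w)%:E * (\1_C (with_obs n w))%:E))%E.
  by apply: eq_integral => w _; rewrite EFinM.
rewrite (filt_claim_joint j (u := fun z => (\1_C z)%:E))//; last exact/measurable_EFinP.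
pose v (z : g_sigma_algebraType (obs_sets n) * R) : \bar R :=
  (bayes G (pred n z.1) z.2 j 0 * \1_C z)%:E.
have mv : measurable_fun setT v.
  apply/measurable_EFinP; apply: measurable_funM => //.
  apply: (@measurable_bayes_joint _ (g_sigma_algebraType (obs_sets n) * R)%type
    (fun z => pred n z.1) snd) => //.
  - move=> i; apply: (@measurable_trmulmx _ (g_sigma_algebraType (obs_sets n) * R)%type
      (fun z => filt n z.1)) => k.
    exact: (@comp_measurable _ _ _ (FT n * R)%type (FT n) R (fun w => filt n w k 0) fst (@measurable_filt n k) measurable_fst).
transitivity (\int[P]_w v (w, obs n.+1 w))%E; last first.
  by apply: eq_integral => w _.
rewrite filt_claim_law//; last by move=> z; rewrite lee_fin mulr_ge0// b0.
apply: eq_integral => z _; rewrite /v -!EFinM /= mulrA.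
by rewrite lik_bayes.
Qed.

Lemma filt_claimT n : filt_claim n.
Proof. by elim: n => [|n]; [exact: filt_claim0|exact: filt_claimS]. Qed.

Lemma integral_filtS n (phi : 'cV[R]_d -> R) B : simplex_measurable phi ->
  (forall x, in_simplex x -> 0 <= phi x) -> (forall x, in_simplex x -> `|phi x| <= B) ->
  (\int[P]_w (phi (filt n.+1 w))%:E = \int[P]_w (bayes_op G L phi (filt n w))%:E)%E.
Proof.
move=> mphi phi0 phiB.
have bs z : in_simplex (bayes G (pred n z.1) z.2) by exact: bayes_simplex.
have mb : measurable_fun setT (fun z : g_sigma_algebraType (obs_sets n) * R =>
    phi (bayes G (pred n z.1) z.2)).
  apply: mphi => // i.
  apply: (@measurable_bayes_joint _ (g_sigma_algebraType (obs_sets n) * R)%type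
    (fun z => pred n z.1) snd) => //.
  move=> k; apply: (@measurable_trmulmx _ (g_sigma_algebraType (obs_sets n) * R)%type
      (fun z => filt n z.1)) => l.
  exact: (@comp_measurable _ _ _ (FT n * R)%type (FT n) R (fun w => filt n w l 0) fst (@measurable_filt n l) measurable_fst).
rewrite (filt_claim_law (u := fun z => (phi (bayes G (pred n z.1) z.2))%:E))//; last 3 first.
- exact: filt_claimT.
- exact/measurable_EFinP.
- by move=> z; rewrite lee_fin phi0.
rewrite fubini_tonelli1; last 2 first.
- apply: emeasurable_funM; apply/measurable_EFinP.
    apply: (@measurable_lik_joint _ (T * R)%type (fun z => pred n z.1) snd) => // i.
    exact: (measurableT_comp (@measurable_predT n i) measurable_fst).
  exact: (@comp_measurable _ _ _ (T * R)%type (FT n * R)%type R _ (prod_id n) mb (@measurable_prod_id n)).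
- by move=> z; rewrite mule_ge0// lee_fin ?phi0// ltW// lik_gt0.
apply: eq_integral => w _; rewrite /fubini_F /bayes_op /= EFin_Rintegral; last first.
  exact: (bayes_integrand_integrable G_lik mphi phiB (pred_simplex n w)).
by apply: eq_integral => y _; rewrite -EFinM mulrC.
Qed.

Definition cond_var (x : 'cV[R]_d) : R :=
  \sum_i a i ^+ 2 * x i 0 - (\sum_i a i * x i 0) ^+ 2.

(** The gap between the two sides is the squared bias of [t] as a guess for the mean under [x]. *)
Lemma cond_var_le (x : 'cV[R]_d) t : in_simplex x ->
  cond_var x <= \sum_i x i 0 * (a i - t) ^+ 2.
Proof.
move=> [_ x1].
have -> : \sum_i x i 0 * (a i - t) ^+ 2 =
    cond_var x + (\sum_i a i * x i 0 - t) ^+ 2; last by rewrite lerDl sqr_ge0.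
rewrite /cond_var -addrA; under eq_bigr do rewrite sqrrB mulrDr mulrBr.
rewrite big_split /= big_split /= sumrN -!mulr_suml x1.
rewrite (_ : \sum_i x i 0 * (a i * t *+ 2) = (\sum_i a i * x i 0) * t *+ 2); last first.
  by rewrite mulr_suml -sumrMnl; apply: eq_bigr => i _; ring.
by under eq_bigr do rewrite mulrC; ring.
Qed.

Lemma cond_var_eq (x : 'cV[R]_d) : in_simplex x ->
  \sum_i x i 0 * (a i - \sum_j a j * x j 0) ^+ 2 = cond_var x.
Proof.
move=> [_ x1]; rewrite /cond_var; set t := \sum_j a j * x j 0.
under eq_bigr do rewrite sqrrB mulrDr mulrBr.
rewrite big_split /= big_split /= sumrN -!mulr_suml x1.
rewrite (_ : \sum_i x i 0 * (a i * t *+ 2) = t * t *+ 2); last first.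
  transitivity ((\sum_j a j * x j 0) * t *+ 2) => //.
  by rewrite mulr_suml -sumrMnl; apply: eq_bigr => i _; ring.
by under eq_bigr do rewrite mulrC; ring.
Qed.

Lemma cond_var_ge0 (x : 'cV[R]_d) : in_simplex x -> 0 <= cond_var x.
Proof.
move=> xs; rewrite -cond_var_eq//; case: xs => x0 _.
by apply: sumr_ge0 => i _; rewrite mulr_ge0// sqr_ge0.
Qed.

(** After splitting by the value of X_n, the squared error becomes a test function measurable in the
    observations, to which the conditional law applies. *)
Lemma expectation_sqr_error n (theta : T -> R) :
  (forall B, measurable B -> <<s obs_sets n >> (theta @^-1` B)) ->
  ('E_P[(fun w => ((X n w - theta w) ^+ 2)%R)] =
   \int[P]_w (\sum_i filt n w i 0 * (a i - theta w) ^+ 2)%R%:E)%E.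
Proof.
move=> mth0.
have mth : measurable_fun setT (theta : FT n -> R).
  by move=> _ B mB; rewrite setTI; exact: mth0.
have mthT : measurable_fun setT theta by exact: measurable_obs_lift mth.
have msq i : measurable_fun setT (fun w : FT n => ((a i - theta w) ^+ 2)%:E).
  by apply/measurable_EFinP; apply: measurable_funX; apply: measurable_funB.
have msqT i : measurable_fun setT (fun w => ((a i - theta w) ^+ 2)%:E).
  by apply/measurable_EFinP; apply: measurable_funX; apply: measurable_funB.
rewrite unlock.
transitivity (\int[P]_w \sum_i ((\1_(state n i) w)%:E * ((a i - theta w) ^+ 2)%:E))%E.
  apply: eq_integral => w _; have [i iw] := state_cover n w.
  rewrite (bigD1 i)//= big1 ?adde0; first by rewrite indicE mem_set// mul1e iw.
  move=> j ji; rewrite indicE memNset ?mul0e// => jw.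
  by rewrite (state_disj jw iw) eqxx in ji.
rewrite ge0_integral_sum//; last 2 first.
- by move=> i; apply: emeasurable_funM => //; apply/measurable_EFinP.
- by move=> i w _; rewrite -EFinM lee_fin mulr_ge0// sqr_ge0.
transitivity (\sum_i \int[P]_w ((filt n w i 0)%:E * ((a i - theta w) ^+ 2)%:E))%E.
  apply: eq_bigr => i _; apply: (filt_claimT i (u := fun w => ((a i - theta w) ^+ 2)%:E)) => //.
  by move=> w; rewrite lee_fin sqr_ge0.
rewrite -ge0_integral_sum//; last 2 first.
- move=> i; apply: emeasurable_funM => //; apply/measurable_EFinP.
  exact: measurable_filtT.
- by move=> i w _; rewrite -EFinM lee_fin mulr_ge0 ?sqr_ge0//; case: (filt_simplex n w).
by apply: eq_integral => w _; under eq_bigr do rewrite -EFinM; rewrite sumEFin.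
Qed.

(** The posterior mean is bounded, hence admissible, and it attains the pointwise lower bound of
    [cond_var_le]. *)
Lemma mmse_filt n : mmse P X obs n = \int[P]_w cond_var (filt n w).
Proof.
pose th w := \sum_i a i * filt n w i 0.
have mth : measurable_fun setT (th : FT n -> R).
  apply: measurable_sum => i; apply: measurable_funM; first exact: measurable_cst.
  exact: measurable_filt.
have mthT : measurable_fun setT th by exact: measurable_obs_lift mth.
have th_meas B : measurable B -> <<s obs_sets n >> (th @^-1` B).
  by move=> mB; rewrite -[_ @^-1` _]setTI; exact: mth.
have thB w : `|th w| <= \sum_i `|a i|.
  apply: (le_trans (ler_norm_sum _ _ _)); apply: ler_sum => i _.
  have fs := filt_simplex n w; have [f0 _] := fs.
  by rewrite normrM (ger0_norm (f0 i)) ler_piMr//; exact: simplex_le1.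
have th2 : th \in Lfun P 2%:E.
  rewrite inE/=; apply/andP; split; rewrite inE//=.
  rewrite /finite_norm unlock poweR_lty//.
  have : P.-integrable setT (EFin \o (fun w => `|th w| `^ 2)).
    apply: (@integrable_dominated _ _ _ P _ (fun=> (\sum_i `|a i|) ^+ 2)).
    - apply: (measurableT_comp (measurable_powR 2)); exact: measurableT_comp.
    - move=> w; rewrite ger0_norm ?powR_ge0// -[2]/(2%:R) powR_mulrn//.
      by rewrite lerXn2r ?nnegrE ?sumr_ge0.
    - exact: finite_measure_integrable_cst.
  by move/(integrable_lty measurableT).
congr fine; apply/eqP; rewrite eq_le; apply/andP; split.
  apply: ereal_inf_lbound; exists th; first by split.
  rewrite expectation_sqr_error//; apply: eq_integral => w _; congr EFin.
  by apply: cond_var_eq; exact: filt_simplex.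
apply/ereal_infP => _ [theta [mtheta _] <-].
rewrite expectation_sqr_error//; apply: ge0_le_integral_lower => w.
  by rewrite lee_fin cond_var_ge0//; exact: filt_simplex.
by rewrite lee_fin cond_var_le//; exact: filt_simplex.
Qed.

End ChainStep.

(** * Expansion of the steady-state error *)

Section SteadyState.
Context {R : realType} {d : nat}.
Notation leb := (@lebesgue_measure R).
Variables (g : R -> R) (delta : R).
Hypothesis g_regular : noise_regularity g.
Hypothesis g_ge0 : forall x, 0 <= g x.
Hypothesis g_int1 : (\int[leb]_x (g x)%:E = 1)%E.
Hypothesis delta_gt0 : 0 < delta.
Hypothesis score_energy :
  (\int[leb]_x ((derive1 g x / min_near delta g x) ^+ 2 * g x)%:E < +oo)%E.
Variables (hv : 'cV[R]_d) (H : R).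
Hypothesis H_ge1 : 1 <= H.
Hypothesis hvH : forall i, `|hv i 0| <= H.
Variable C : R.
Hypothesis C_ge0 : 0 <= C.
Hypothesis energy_le : forall eps, small_noise_ratio delta H eps ->
  leb.-integrable setT (EFin \o lik_energy g delta hv H eps) /\
  \int[leb]_y lik_energy g delta hv H eps y <= C.
Variables (L : 'M[R]_d) (mu : 'cV[R]_d) (K : nat).
Hypothesis L_stoch : is_stochastic L.
Hypothesis mu_inv : is_invariant L mu.
Hypothesis HK : forall x, zero_sum x ->
  l1norm (iter K.+1 (mulmx L^T) x) <= l1norm x / 2.

Local Notation signal eps := (signal_lik g hv eps).

Definition contraction_rate (eps : R) : R :=
  ergodic_rate K + 4 * K.+1%:R * (eps * (1 + C)).

Lemma signal_contraction eps l phi : small_noise_ratio delta H eps -> 0 <= l ->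
  simplex_measurable phi -> simplex_lipschitz L K.+1 l phi ->
  simplex_lipschitz L K.+1 (contraction_rate eps * l) (bayes_op (signal eps) L phi).
Proof.
move=> es l0 mphi lphi x y xs ys; have [e0 _ _] := es.
have [iE EC] := energy_le es.
have iD := lik_dom_integrable g_regular g_ge0 g_int1 delta_gt0 H_ge1 iE.
have iD' := integrableZlr eps iD.
have Gl := signal_lik_is_lik g_regular g_ge0 g_int1 hv eps.
have ig := density_integrable g_regular g_ge0 g_int1.
have D0 z : 0 <= eps * lik_dom g hv H eps z by apply: mulr_ge0; [exact: ltW|exact: lik_dom_ge0].
have := @bayes_op_lipschitz _ _ L K.+1 L_stoch (signal eps) g _ (ergodic_rate K) Gl D0
  (fun i z => signal_likB_le g hvH es i z) g_ge0 ig iD' (Rintegral_density g_int1)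
  (orbit_norm_contr L_stoch HK) (fun x => l1norm_le_orbit_norm L K x)
  l phi l0 mphi lphi x y xs ys.
move/le_trans; apply; rewrite ler_wpM2r ?orbit_norm_ge0// ler_wpM2r// lerD2l.
rewrite ler_wpM2l ?mulr_ge0// RintegralZl// ler_wpM2l ?(ltW e0)//.
apply: (le_trans (Rintegral_lik_dom_le g_regular g_ge0 g_int1 delta_gt0 H_ge1 iE)).
by rewrite lerD2l.
Qed.

(** The error in [bayes_op_quadf] relative to eps^2 and the size of the matrix; [lik_gap_cvg] makes
    it vanish as eps tends to 0. *)
Definition expansion_error (eps : R) : R :=
  12 * eps * C + 4 * H ^+ 2 * \int[leb]_y lik_gap g delta hv eps y.

(** Written as a rank-one quadratic form so that the results on [quadf] apply to it. *)
Definition sq_centered b x : R := quadf (centered mu b *m (centered mu b)^T) x.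

Lemma sq_centeredE b x : in_simplex x -> sq_centered b x = (dotv b x - dotv b mu) ^+ 2.
Proof. by move=> xs; rewrite /sq_centered quadf_rank1 dotv_centered. Qed.

Definition gain (M : 'M[R]_d) x : R := quadf M (cov_vec (L^T *m x) hv).

Lemma tame_quadf (M : 'M[R]_d) : tame (quadf M).
Proof.
split; first exact: simplex_measurable_quadf.
by exists (mx_abs_sum M) => x; exact: quadf_simplex_le.
Qed.

Lemma gain_le M x : in_simplex x -> `|gain M x| <= mx_abs_sum M * (4 * H ^+ 2).
Proof.
move=> xs; have ps := simplex_trmulmx L_stoch xs.
have -> : 4 * H ^+ 2 = (2 * H) ^+ 2 by ring.
by apply: quadf_le => i; exact: cov_vec_le.
Qed.

Lemma tame_gain M : tame (gain M).
Proof.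
split; last by eexists => x; exact: gain_le.
move=> d' S u mu' us; rewrite /gain.
have mp i : measurable_fun setT (fun s => (L^T *m u s) i 0).
  under eq_fun do rewrite mxE; apply: measurable_sum => j.
  by apply: measurable_funM => //; exact: measurable_cst.
have mc i : measurable_fun setT (fun s => cov_vec (L^T *m u s) hv i 0).
  under eq_fun do rewrite mxE; apply: measurable_funM => //.
  apply: measurable_funB; first exact: measurable_cst.
  by apply: measurable_sum => j; apply: measurable_funM => //; exact: measurable_cst.
under eq_fun do rewrite quadf_sum.
apply: measurable_sum => i; apply: measurable_sum => j.
apply: measurable_funM; first exact: measurable_cst.
exact: measurable_funM.
Qed.

(* Young's inequality trades the first-order bound for the second moments
   [sq_centered], which are themselves O(eps^2); taking [t = eps] balances. *)
Lemma gain_dist_le M t x : 0 < t -> in_simplex x ->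
  `|gain M x - quadf M (cov_vec mu hv)| <=
  mx_abs_sum M * (12 * H ^+ 2) *
    \sum_i (t / 2 + (2 * t)^-1 * sq_centered (L *m delta_mx i 0) x).
Proof.
move=> t0 xs; have ps := simplex_trmulmx L_stoch xs.
apply: (le_trans (quadf_cov_vecB_le hvH M ps mu_inv.1)).
rewrite ler_wpM2l//; first by rewrite mulr_ge0 ?mx_abs_sum_ge0// mulr_ge0// sqr_ge0.
apply: ler_sum => i _; rewrite sq_centeredE//.
have -> : (L^T *m x - mu) i 0 = dotv (L *m delta_mx i 0) x - dotv (L *m delta_mx i 0) mu.
  by rewrite -!dotv_mulmx mu_inv.2 -dotvBr dotvC dotv_delta.
set s := _ - _ : R.
have : 0 <= (`|s| - t) ^+ 2 / (2 * t) by rewrite divr_ge0 ?sqr_ge0// mulr_ge0// ltW.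
rewrite sqrrB -normrX (ger0_norm (sqr_ge0 s)).
have -> : (s ^+ 2 - `|s| * t *+ 2 + t ^+ 2) / (2 * t) =
  t / 2 + (2 * t)^-1 * s ^+ 2 - `|s| by field; rewrite gt_eqF.
by rewrite subr_ge0.
Qed.

Section FixedNoise.
Context {dd : measure_display} {T : measurableType dd}.
Variables (P : probability T R) (nu : 'cV[R]_d) (F : nat -> T -> 'cV[R]_d) (eps : R).
Hypothesis eps_small : small_noise_ratio delta H eps.
Hypothesis rate_lt1 : contraction_rate eps < 1.
Hypothesis mF : forall n i, measurable_fun setT (fun w => F n w i 0).
Hypothesis F_simplex : forall n w, in_simplex (F n w).
Hypothesis F0 : forall w, F 0 w = nu.
Hypothesis F_step : forall n phi B, simplex_measurable phi ->
  (forall x, in_simplex x -> 0 <= phi x) -> (forall x, in_simplex x -> `|phi x| <= B) ->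
  (\int[P]_w (phi (F n.+1 w))%:E =
   \int[P]_w (bayes_op (signal_lik g hv eps) L phi (F n w))%:E)%E.

Let eps_gt0 : 0 < eps. Proof. by case: eps_small. Qed.
Let Gl := signal_lik_is_lik g_regular g_ge0 g_int1 hv eps.
Local Notation mean := (mean P F).
Local Notation eta := (expansion_error eps).
Local Notation J := (fisher g).

Lemma mean_quadf_cvg M : cvgn (mean (quadf M)).
Proof.
apply: (@mean_cvg _ _ _ _ P L nu (signal_lik g hv eps) F L_stoch Gl mF F_simplex F0 F_step
  (contraction_rate eps) K.+1 _ rate_lt1 _ (mx_abs_sum M * 2)).
- rewrite addr_ge0 ?ergodic_rate_ge0// !mulr_ge0 ?(ltW eps_gt0)//.
  by rewrite addr_ge0.
- by move=> l phi l0 mphi; exact: signal_contraction.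
- by rewrite mulr_ge0 ?mx_abs_sum_ge0.
- exact: simplex_measurable_quadf.
- exact: quadf_simplex_lipschitz.
Qed.

Definition steady_var b : R := limn (mean (sq_centered b)).

Lemma steady_var_cvg b : mean (sq_centered b) n @[n --> \oo] --> steady_var b.
Proof. exact: mean_quadf_cvg. Qed.

(** The defect from stationarity at time n; it vanishes in the limit because the means converge. *)
Let incr M n := `|mean (quadf M) n.+1 - mean (quadf M) n|.

Let incr_cvg0 M : incr M n @[n --> \oo] --> 0.
Proof.
have c : mean (quadf M) n @[n --> \oo] --> limn (mean (quadf M)) by exact: mean_quadf_cvg.
have cS : mean (quadf M) n.+1 @[n --> \oo] --> limn (mean (quadf M)) by rewrite cvg_shiftS.
by have := cvg_norm (cvgB cS c); rewrite subrr normr0; apply.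
Qed.

Let fisher_ge0 : 0 <= J.
Proof.
by apply: Rintegral_ge0 => y _; rewrite mulr_ge0 ?sqr_ge0// invr_ge0.
Qed.

Lemma mean_sq_centered_gain b M n : is_gramian L (centered mu b) M ->
  `|mean (sq_centered b) n - eps ^+ 2 * (J * mean (gain M) n)| <=
  eps ^+ 2 * (mx_abs_sum M * eta) + incr M n.
Proof.
move=> gM; have [iE EC] := energy_le eps_small.
have tV := tame_quadf M; have tg := tame_gain M.
have ts : tame (sq_centered b) by exact: tame_quadf.
have tb := tame_bayes_op L_stoch Gl tV.
(* By [quadf_gramian_pred], [r] is exactly the remainder estimated in [bayes_op_quadf], while its
   mean is the increment of the quadratic form plus [sq_centered] minus the gain. *)
pose r x := bayes_op (signal_lik g hv eps) L (quadf M) x +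
  ((-1) * quadf M x + (sq_centered b x + (- (eps ^+ 2 * J)) * gain M x)).
have tr : tame r.
  by apply: tameD => //; apply: tameD; [exact: tameZ|apply: tameD => //; exact: tameZ].
have rE : mean r n = mean (quadf M) n.+1 - mean (quadf M) n +
    (mean (sq_centered b) n - eps ^+ 2 * (J * mean (gain M) n)).
  have [mV [B VB]] := tV.
  rewrite (mean_step L_stoch Gl mF F_simplex F_step _ mV VB) /r.
  rewrite !(meanD P mF F_simplex, meanZ P mF F_simplex)//; first by ring.
  - exact: tameZ.
  - exact: tameZ.
  - by apply: tameD => //; exact: tameZ.
  - by apply: tameD; [exact: tameZ|apply: tameD => //; exact: tameZ].
have rB x : in_simplex x -> `|r x - 0| <= eps ^+ 2 * (mx_abs_sum M * eta).
  move=> xs; have := bayes_op_quadf g_regular g_ge0 g_int1 delta_gt0 score_energy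
    H_ge1 hvH M L_stoch eps_small xs iE EC.
  rewrite (quadf_gramian_pred gM xs) -sq_centeredE// subr0.
  by congr (`|_| <= _); rewrite /r /gain; ring.
have := le_mean_dist P mF F_simplex n tr (tame_cst _) rB.
rewrite (mean_cst P F) subr0 rE => h.
set u := _ - _ in h; set v := _ - _ in h *.
have -> : v = (u + v) - u by rewrite addrC addKr.
by apply: (le_trans (ler_normB _ _)); exact: lerD.
Qed.

(** Here the gain is merely bounded. This crude balance must precede the sharp one, where replacing
    the prediction by [mu] already requires second moments of order eps^2. *)
Lemma steady_var_le b M : is_gramian L (centered mu b) M ->
  steady_var b <= eps ^+ 2 * (mx_abs_sum M * (J * (4 * H ^+ 2) + eta)).
Proof.
move=> gM; set A := _ * (_ * _).
have cA : A + incr M n @[n --> \oo] --> A + 0.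
  by apply: cvgD; [exact: cvg_cst|exact: incr_cvg0].
have c1 : mean (sq_centered b) n @[n --> \oo] --> steady_var b by exact: steady_var_cvg.
apply: (@le_trans _ _ (A + 0)); last by rewrite addr0.
apply: (ler_cvg_to c1 cA); near=> n.
have := mean_sq_centered_gain n gM; set s := mean _ n; set j := mean _ n => h.
have jB : `|j| <= mx_abs_sum M * (4 * H ^+ 2).
  have := le_mean_dist P mF F_simplex n (tame_gain M) (tame_cst (mx_abs_sum M * (4 * H ^+ 2))).
  move=> /(_ 0); rewrite subr0 (mean_cst P F); apply => x xs.
  by rewrite subr0 gain_le.
have : eps ^+ 2 * (J * j) <= eps ^+ 2 * (J * (mx_abs_sum M * (4 * H ^+ 2))).
  rewrite ler_wpM2l ?sqr_ge0// ler_wpM2l//; exact: le_trans (ler_norm _) jB.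
move: h; rewrite ler_norml => /andP[_ h1] h2.
rewrite (_ : A = eps ^+ 2 * (J * (mx_abs_sum M * (4 * H ^+ 2))) +
  eps ^+ 2 * (mx_abs_sum M * eta)); last by rewrite /A; ring.
move: h1 h2; move: (eps ^+ 2 * (J * j)) => z; lra.
Unshelve. all: by end_near.
Qed.

Lemma steady_var_expansion b M (Mf : 'I_d -> 'M[R]_d) : is_gramian L (centered mu b) M ->
  (forall i, is_gramian L (centered mu (L *m delta_mx i 0)) (Mf i)) ->
  `|steady_var b - eps ^+ 2 * (J * quadf M (cov_vec mu hv))| <=
  eps ^+ 2 * (mx_abs_sum M * eta + J * (mx_abs_sum M * (12 * H ^+ 2)) *
   (eps * \sum_i (2^-1 + 2^-1 * (mx_abs_sum (Mf i) * (J * (4 * H ^+ 2) + eta))))).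
Proof.
move=> gM gMf.
set c := mx_abs_sum M * (12 * H ^+ 2); set J0 := quadf M _.
have c0 : 0 <= c by rewrite mulr_ge0 ?mx_abs_sum_ge0// mulr_ge0// sqr_ge0.
pose m i := mean (sq_centered (L *m delta_mx i 0)).
(* Affine in the moments [v], so the same expression serves at finite n and in the limit. *)
pose B (v : 'I_d -> R) := eps ^+ 2 * (J * (c * \sum_i (eps / 2 + (2 * eps)^-1 * v i))).
have Bcvg : B (fun i => m i n) @[n --> \oo] --> B (fun i => steady_var (L *m delta_mx i 0)).
  do 3 (apply: cvgM; first exact: cvg_cst).
  apply: cvg_sumr => i; apply: cvgD; first exact: cvg_cst.
  apply: cvgM; [exact: cvg_cst|exact: steady_var_cvg].
have lim1 : `|mean (sq_centered b) n - eps ^+ 2 * (J * J0)| @[n --> \oo] -->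
    `|steady_var b - eps ^+ 2 * (J * J0)|.
  apply: cvg_norm; apply: cvgB; [exact: steady_var_cvg|exact: cvg_cst].
have lim2 : eps ^+ 2 * (mx_abs_sum M * eta) + incr M n + B (fun i => m i n)
    @[n --> \oo] --> eps ^+ 2 * (mx_abs_sum M * eta) + 0 +
      B (fun i => steady_var (L *m delta_mx i 0)).
  by apply: cvgD => //; apply: cvgD; [exact: cvg_cst|exact: incr_cvg0].
apply: (@le_trans _ _ (eps ^+ 2 * (mx_abs_sum M * eta) + 0 +
      B (fun i => steady_var (L *m delta_mx i 0)))).
  apply: (ler_cvg_to lim1 lim2); near=> n.
  have -> : mean (sq_centered b) n - eps ^+ 2 * (J * J0) =
      (mean (sq_centered b) n - eps ^+ 2 * (J * mean (gain M) n)) +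
      eps ^+ 2 * (J * (mean (gain M) n - J0)) by ring.
  apply: (le_trans (ler_normD _ _)); apply: lerD; first exact: mean_sq_centered_gain.
  rewrite normrM (ger0_norm (sqr_ge0 _)) ler_wpM2l ?sqr_ge0//.
  rewrite normrM (ger0_norm fisher_ge0) ler_wpM2l//.
  have tsum i : tame (fun x => eps / 2 + (2 * eps)^-1 * sq_centered (L *m delta_mx i 0) x).
    by apply: tameD; [exact: tame_cst|apply: tameZ; exact: tame_quadf].
  have := le_mean_dist P mF F_simplex n (tame_gain M)
    (tameZ c (@tame_sum _ _ _ (index_enum _) _ tsum)) (fun x => gain_dist_le M eps_gt0).
  rewrite (meanZ P mF F_simplex); last exact: tame_sum.
  rewrite (mean_sum P mF F_simplex)//.
  under [X in _ * X]eq_bigr => i _.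
    rewrite (meanD P mF F_simplex); [|exact: tame_cst|by apply: tameZ; exact: tame_quadf].
    rewrite (mean_cst P F) (meanZ P mF F_simplex); last exact: tame_quadf.
    over.
  by [].
rewrite addr0 [leRHS]mulrDr lerD2l /B ler_wpM2l ?sqr_ge0// -[leRHS]mulrA.
rewrite ler_wpM2l// ler_wpM2l//.
rewrite mulr_sumr; apply: ler_sum => i _; rewrite mulrDr lerD2l.
(* The second moment is at most eps^2 A; against the weight 1/(2 eps) this leaves eps A / 2. *)
have := steady_var_le (gMf i); set A := mx_abs_sum _ * _ => h.
apply: (@le_trans _ _ ((2 * eps)^-1 * (eps ^+ 2 * A))).
  by rewrite ler_wpM2l// invr_ge0 mulr_ge0// ltW.
rewrite le_eqVlt; apply/orP; left; apply/eqP; field.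
by rewrite gt_eqF.
Unshelve. all: by end_near.
Qed.

Hypothesis L_erg : is_ergodic L.
Hypothesis nu_simplex : in_simplex nu.

(** [cond_var] plus [sq_centered] is affine in the law. The mean of the filter is the marginal law
    of the chain, which converges by ergodicity. *)
Lemma mean_cond_var_cvg (a : 'I_d -> R) :
  mean (cond_var a) n @[n --> \oo] -->
  apriori_error a mu - steady_var (\col_i a i).
Proof.
pose b : 'cV[R]_d := \col_i a i; pose b2 : 'cV[R]_d := \col_i a i ^+ 2.
pose m := dotv b mu.
have bE (x : 'cV[R]_d) : \sum_i a i * x i 0 = dotv b x by apply: eq_bigr => i _; rewrite mxE.
have b2E (x : 'cV[R]_d) : \sum_i a i ^+ 2 * x i 0 = dotv b2 x by apply: eq_bigr => i _; rewrite mxE.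
have td c : tame (dotv c).
  split; first exact: simplex_measurable_dotv.
  by exists (l1norm c) => x; apply: dotv_simplex_le => i; exact: entry_le_l1norm.
have ts : tame (sq_centered b) by exact: tame_quadf.
have mE n : mean (cond_var a) n = dotv b2 (marginal_law L nu n) +
    ((-1) * mean (sq_centered b) n + (- (2 * m) * dotv b (marginal_law L nu n) + m ^+ 2)).
  rewrite -!(mean_dotv L_stoch Gl mF F_simplex F0 F_step).
  rewrite -(mean_cst P F (m ^+ 2) n) -!(meanZ P mF F_simplex)// -!(meanD P mF F_simplex)//.
  - apply: eq_Rintegral => w _; rewrite sq_centeredE// -/m /cond_var bE b2E; ring.
  - by apply: tameD; [exact: tameZ|apply: tameD; [exact: tameZ|exact: tame_cst]].
  - exact: tameZ.
  - by apply: tameD; [exact: tameZ|exact: tame_cst].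
  - exact: tameZ.
  - exact: tame_cst.
have dc c : dotv c (marginal_law L nu n) @[n --> \oo] --> dotv c mu.
  apply: cvg_sumr => i; apply: cvgM; first exact: cvg_cst.
  exact: ergodic_cvg.
have -> : apriori_error a mu - steady_var b =
    dotv b2 mu + ((-1) * steady_var b + (- (2 * m) * m + m ^+ 2)).
  by rewrite /apriori_error b2E bE -/m; ring.
rewrite (funext mE).
have sc : mean (sq_centered b) n @[n --> \oo] --> steady_var b by exact: steady_var_cvg.
apply: cvgD; first exact: dc.
apply: cvgD; first by apply: cvgM; [exact: cvg_cst|exact: sc].
by apply: cvgD; [apply: cvgM; [exact: cvg_cst|exact: dc]|exact: cvg_cst].
Qed.

End FixedNoise.

End SteadyState.

(** * From the original observations to the normalised ones *)

Section Rescaling.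
Context {dd : measure_display} {T : measurableType dd} {R : realType}.

Lemma sigma_generated_scale (D : set nat) (Z : nat -> T -> R) c : c != 0 ->
  sigma_generated D (fun n w => c * Z n w) = sigma_generated D Z.
Proof.
move=> c0; rewrite /sigma_generated; congr (<<s _ >>).
have mc e : measurable_fun setT (fun z : R => e * z).
  by apply: measurable_funM; [exact: measurable_cst|exact: measurable_id].
apply/seteqP; split=> A [k Dk [B mB <-]]; exists k => //.
- exists ((fun z => c * z) @^-1` B) => //.
  by rewrite -[_ @^-1` B]setTI; exact: mc.
- exists ((fun z => c^-1 * z) @^-1` B); first by rewrite -[_ @^-1` B]setTI; exact: mc.
  by rewrite !setTI; apply/seteqP; split=> w /=; rewrite mulrA mulVf// mul1r.
Qed.

(** The error depends on the observations only through the sigma-algebra they generate. *)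
Lemma mmse_scale (P : probability T R) (X Y : nat -> T -> R) c n : c != 0 ->
  mmse P X (fun n w => c * Y n w) n = mmse P X Y n.
Proof. by move=> c0; rewrite /mmse sigma_generated_scale. Qed.

Lemma shifted_noise_law (P : probability T R) (Z : T -> R) (g : R -> R) (t : R) (B : set R) :
  has_density P Z g -> measurable B ->
  P (Z @^-1` [set z | B (z + t)]) =
  (\int[@lebesgue_measure R]_(y in B) (g (y - t))%:E)%E.
Proof.
move=> [mg g0 ZP] mB.
have mBt : measurable [set z | B (z + t)].
  rewrite -[X in measurable X]setTI.
  have mt : measurable_fun setT (fun z : R => z + t).
    by apply: measurable_funD => //; exact: measurable_cst.
  exact: (mt measurableT B mB).
rewrite ZP// integral_mkcond [RHS]integral_mkcond.
rewrite -(@ge0_integral_shift R t).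
- apply: eq_integral => y _; rewrite !patchE.
  by rewrite (_ : (y - t \in [set z | B (z + t)]) = (y \in B))//;
     apply/idP/idP; rewrite !inE /= subrK.
- apply/(measurable_restrictT _ mBt).
  by apply: measurable_funTS; apply/measurable_EFinP.
- by move=> y; rewrite patchE; case: ifP => // _; rewrite lee_fin.
Qed.

End Rescaling.

Section ObservationFilter.
Context {dd : measure_display} {T : measurableType dd} {R : realType} {d : nat}.
Variables (P : probability T R) (a : 'I_d -> R) (L : 'M[R]_d) (nu : 'cV[R]_d).
Variables (X xi : nat -> T -> R) (h g : R -> R).
Hypothesis a_inj : injective a.
Hypothesis mX : forall n, measurable_fun setT (X n).
Hypothesis mxi : forall n, measurable_fun setT (xi n).
Hypothesis L_stoch : is_stochastic L.
Hypothesis nu_simplex : in_simplex nu.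
Hypothesis X_markov : is_markov_chain P a L nu X.
Hypothesis xi_iid : is_iid_noise P g xi.
Hypothesis X_xi_indep : independent_sigma_algebras P (sigma_generated setT X)
  (sigma_generated [set k | (1 <= k)%N] xi).
Hypothesis g_regular : noise_regularity g.

Lemma noise_density_ge0 x : 0 <= g x.
Proof. by have [_ /(_ 1%N isT)[_ + _]] := xi_iid; exact. Qed.

Lemma noise_density_int1 : (\int[@lebesgue_measure R]_x (g x)%:E = 1)%E.
Proof.
have [_ /(_ 1%N isT)[_ _ xiP]] := xi_iid.
by rewrite -xiP// preimage_setT probability_setT.
Qed.

Lemma observation_filter (sigma : R) : 0 < sigma ->
  exists F : nat -> T -> 'cV[R]_d,
  [/\ (forall n i, measurable_fun setT (fun w => F n w i 0)),
      (forall n w, in_simplex (F n w)),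
      (forall w, F 0%N w = nu),
      (forall n phi B, simplex_measurable phi -> (forall x, in_simplex x -> 0 <= phi x) ->
        (forall x, in_simplex x -> `|phi x| <= B) ->
        (\int[P]_w (phi (F n.+1 w))%:E =
         \int[P]_w (bayes_op (signal_lik g (\col_i h (a i)) sigma^-1) L phi (F n w))%:E)%E) &
      forall n, mmse P X (observation h X xi sigma) n = mean P F (cond_var a) n].
Proof.
move=> s0; pose sg x := sigma^-1 * h x.
pose G := signal_lik g (\col_i h (a i)) sigma^-1.
have Gl : is_lik G := signal_lik_is_lik g_regular noise_density_ge0 noise_density_int1 _ _.
have [xi_indep xi_density] := xi_iid.
have Glaw n i B : (1 <= n)%N -> measurable B -> P (xi n @^-1` [set z | B (z + sg (a i))]) =
    (\int[@lebesgue_measure R]_(y in B) (G i y)%:E)%E.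
  move=> n1 mB; rewrite (shifted_noise_law _ (xi_density n n1))//.
  by apply: eq_integral => y _; rewrite /G /signal_lik mxE.
exists (filt L nu X xi sg G); split => //.
- exact: (measurable_filtT a_inj mX mxi X_markov).
- exact: filt_simplex.
- exact: (integral_filtS a_inj mX mxi X_markov xi_indep X_xi_indep L_stoch nu_simplex Gl Glaw).
move=> n; rewrite /mean -(mmse_filt a_inj mX mxi X_markov xi_indep X_xi_indep L_stoch
  nu_simplex Gl Glaw) -(mmse_scale P X (observation h X xi sigma) n (c := sigma^-1)).
  congr mmse; apply/funext => k; apply/funext => w.
  by rewrite /obs /observation mulrDr mulKf ?gt_eqF// addrC.
by rewrite invr_eq0 gt_eqF.
Qed.

End ObservationFilter.

Theorem theorem2p2 (R : realType) (disp : measure_display)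
  (T : measurableType disp) (P : probability T R)
  (d : nat) (a : 'I_d -> R) (Lambda : 'M[R]_d) (nu mu : 'cV[R]_d)
  (X : nat -> {RV P >-> R}) (h : R -> R) (xi : nat -> {RV P >-> R})
  (g : R -> R)
  (a_inj : injective a)
  (Lambda_stochastic : is_stochastic Lambda)
  (nu_simplex : in_simplex nu)
  (X_markov : is_markov_chain P a Lambda nu X)
  (X_ergodic : is_ergodic Lambda)
  (mu_invariant : is_invariant Lambda mu)
  (xi_iid : is_iid_noise P g xi)
  (X_xi_indep : independent_sigma_algebras P (sigma_generated setT X)
     (sigma_generated [set k | (1 <= k)%N] xi))
  (g_regular : noise_regularity g)
  (g_integrability : noise_integrability g) :
  (fisher_information g < +oo)%E /\
  exists Q : 'M[R]_d,
    [/\ lyapunov_solution Lambda mu (\col_i h (a i))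
          (fine (fisher_information g)) Q,
        (forall Q' : 'M[R]_d,
           lyapunov_solution Lambda mu (\col_i h (a i))
             (fine (fisher_information g)) Q' -> Q' = Q) &
        sigma ^+ 2 * (apriori_error a mu -
            steady_state_mmse P X (observation h X xi sigma))
          @[sigma --> +oo] -->
        ((\col_i a i)^T *m Q *m (\col_i a i)) 0 0].
Proof.
have g_ge0 := noise_density_ge0 xi_iid.
have g_int1 := noise_density_int1 xi_iid.
have [delta delta_gt0 [score curvature]] := g_integrability.
split; first exact: (fisher_information_lty g_regular g_ge0 delta_gt0 score).
pose hv : 'cV[R]_d := \col_i h (a i); pose b : 'cV[R]_d := \col_i a i.
(* The summand 1 keeps [H] positive, so that [delta / H] is a valid threshold for eps. *)
pose H : R := 1 + l1norm hv.
have H_ge1 : 1 <= H by rewrite lerDl l1norm_ge0.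
have hvH i : `|hv i 0| <= H.
  by apply: (le_trans (entry_le_l1norm hv i)); rewrite lerDr.
have [C C_ge0 energy] :=
  lik_energy_bounded g_regular g_ge0 delta_gt0 score curvature H_ge1 hvH.
have [K HK] := zero_sum_halving X_ergodic mu_invariant.
have [Q Qg] := gramian_cov Lambda_stochastic X_ergodic mu_invariant hv.
have [M Mg] := gramian_centered Lambda_stochastic X_ergodic mu_invariant b.
(* Coordinate i of the predicted law pairs the current law with L e_i; one Gramian per state
   therefore controls the distance of the prediction to [mu]. *)
have /choice[Mf Mfg] : forall i : 'I_d, exists Mi,
    is_gramian Lambda (centered mu (Lambda *m delta_mx i 0)) Mi.
  by move=> i; exact: gramian_centered.
set J := fisher g.
have JE : fine (fisher_information g) = J by [].
have J_ge0 : 0 <= J.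
  by apply: Rintegral_ge0 => y _; rewrite mulr_ge0 ?sqr_ge0// invr_ge0.
have QL : lyapunov_solution Lambda mu hv J (J *: Q) by exact: lyapunov_gramian.
exists (J *: Q); split; rewrite ?JE //.
  by move=> Q' Q'L; exact: (lyapunov_unique X_ergodic mu_invariant Q'L QL).
rewrite -quadfE.
have -> : quadf (J *: Q) b = J * quadf M (cov_vec mu hv).
  rewrite -(gramian_duality Lambda_stochastic mu_invariant Qg Mg).
  by rewrite !quadfE -scalemxAr -scalemxAl mxE.
pose eta := expansion_error g delta hv H C.
(* The bound of [steady_var_expansion] divided by eps^2. *)
pose rate eps := mx_abs_sum M * eta eps + J * (mx_abs_sum M * (12 * H ^+ 2)) *
   (eps * \sum_i (2^-1 + 2^-1 * (mx_abs_sum (Mf i) * (J * (4 * H ^+ 2) + eta eps)))).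
have id0 : (fun eps : R => eps) @ 0^'+ --> (0 : R).
  exact: (cvg_at_right_filter (f := id) cvg_id).
have eta0 : eta eps @[eps --> 0^'+] --> 0.
  rewrite [X in _ --> X](_ : 0 = 12 * 0 * C + 4 * H ^+ 2 * 0); last by ring.
  apply: cvgD; first by apply: cvgM; [apply: cvgM => //; exact: cvg_cst|exact: cvg_cst].
  by apply: cvgM; [exact: cvg_cst|exact: lik_gap_cvg].
have rate0 : rate eps @[eps --> 0^'+] --> 0.
  rewrite [X in _ --> X](_ : 0 = mx_abs_sum M * 0 + J * (mx_abs_sum M * (12 * H ^+ 2)) *
    (0 * \sum_i (2^-1 + 2^-1 * (mx_abs_sum (Mf i) * (J * (4 * H ^+ 2) + 0)))));
    last by ring.
  apply: cvgD; first by apply: cvgM => //; exact: cvg_cst.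
  apply: cvgM; first exact: cvg_cst.
  apply: cvgM => //; apply: cvg_sumr => i.
  apply: cvgD; first exact: cvg_cst.
  do 2 (apply: cvgM; first exact: cvg_cst).
  by apply: cvgD => //; exact: cvg_cst.
have contr0 : contraction_rate C K eps @[eps --> 0^'+] --> ergodic_rate K.
  rewrite [X in _ --> X](_ : _ = ergodic_rate K + 4 * K.+1%:R * (0 * (1 + C))); last by ring.
  apply: cvgD; first exact: cvg_cst.
  by apply: cvgM; [exact: cvg_cst|apply: cvgM => //; exact: cvg_cst].
apply/cvgrPdist_lt => e e0.
have [r r0 rP] : exists2 r, 0 < r & forall eps, 0 < eps -> eps < r ->
    [/\ small_noise_ratio delta H eps, contraction_rate C K eps < 1 & rate eps < e].
  have [r r0 rP] : \forall eps \near 0^'+,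
    [/\ small_noise_ratio delta H eps, contraction_rate C K eps < 1 & rate eps < e].
    near=> eps; split.
    - have ep : 0 < eps by near: eps; exact: nbhs_right_gt.
      split=> //; first by near: eps; exact: nbhs_right_le.
      rewrite -ler_pdivlMr; last exact: lt_le_trans ltr01 H_ge1.
      by near: eps; apply: nbhs_right_le; rewrite divr_gt0// (lt_le_trans ltr01).
    - by near: eps; exact: (cvgr_lt _ contr0 _ (ergodic_rate_lt1 K)).
    - by near: eps; exact: (cvgr_lt _ rate0).
  exists r => // eps ep er; apply: rP => //=.
  by rewrite sub0r normrN gtr0_norm.
(* Every sigma beyond 1/r has eps = 1/sigma below r. *)
exists r^-1; split; first exact: num_real.
move=> sigma rs; have s0 : 0 < sigma by apply: lt_trans rs; rewrite invr_gt0.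
have eps_gt0 : 0 < sigma^-1 by rewrite invr_gt0.
have [eps_small contr_lt1 rate_lt] : [/\ small_noise_ratio delta H sigma^-1,
    contraction_rate C K sigma^-1 < 1 & rate sigma^-1 < e].
  by apply: rP => //; rewrite invf_plt ?posrE.
have mX n : measurable_fun setT (X n) by exact: measurable_funPT.
have mxi n : measurable_fun setT (xi n) by exact: measurable_funPT.
have [F [mF Fs F0 Fstep Fmmse]] := observation_filter h a_inj mX mxi Lambda_stochastic
  nu_simplex X_markov xi_iid X_xi_indep g_regular s0.
have steadyE : steady_state_mmse P X (observation h X xi sigma) =
    apriori_error a mu - steady_var mu P F b.
  rewrite /steady_state_mmse (_ : mmse P X _ = mean P F (cond_var a)); last first.
    by apply/funext => n; exact: Fmmse.
  apply: cvg_lim => //.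
  exact: (mean_cond_var_cvg g_regular g_ge0 g_int1 delta_gt0 H_ge1 hvH C_ge0 energy
    Lambda_stochastic mu_invariant HK eps_small contr_lt1 mF Fs F0 Fstep X_ergodic nu_simplex).
have := steady_var_expansion g_regular g_ge0 g_int1 delta_gt0 score H_ge1 hvH C_ge0 energy
  Lambda_stochastic mu_invariant HK eps_small contr_lt1 mF Fs F0 Fstep Mg Mfg.
rewrite steadyE -/J => bound; apply: le_lt_trans rate_lt.
rewrite subKr -/eta -/(rate _) in bound *.
(* Multiplication by eps^2 cancels sigma^2 and leaves the estimate for [steady_var] itself. *)
rewrite -(ler_pM2l (exprn_gt0 2 eps_gt0)); apply: le_trans bound.
rewrite -[X in X * `|_|](ger0_norm (sqr_ge0 _)) -normrM distrC le_eqVlt; apply/orP; left.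
by apply/eqP; congr (`|_|); field; rewrite gt_eqF.
Unshelve. all: by end_near.
Qed.
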